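(* For each $(a,b)\in\mathbf B$ there are unique $(a_+,b_+)\in\mathbf H$ and $(a_-,b_-)\in\mathbf H_0^*$ such that $(a_-,b_-)(a_+,b_+)=(a,b)$ almost everywhere on $\mathbb T$. Moreover, there is a unique $F\in\ell^2(\mathbb Z)$ whose nonlinear Fourier series is $(a,b)$.
   Context: $\mathbb T$ unit circle, $\mathbb D$ open unit disc, $\mathbb D^*=\{\overline z^{-1}:z\in\mathbb D\}\cup\{\infty\}$, $a^*(z)=\overline{a(\overline z^{-1})}$. $H^2(\mathbb D)$: functions in $L^2(\mathbb T)$ with vanishing negative Fourier coefficients (identified with analytic extensions to $\mathbb D$); $H^2(\mathbb D^* )$: $f$ with $f^*\in H^2(\mathbb D)$, extended analytically to $\mathbb D^*$ with $f(\infty)=\overline{f^*(0)}$. Inner function: bounded analytic $g$ on $\mathbb D$ with $|g|=1$ a.e. on $\mathbb T$. Pairs multiply as $(a,b)(c,d)=(ac-bd^*,ad+bc^* )$, with $y^*=\overline y$ for constants and $(z^k)^*=z^{-k}$. $\mathbf L$: pairs $(a,b)$ of measurable functions on $\mathbb T$ with $aa^*+bb^*=1$ a.e., $a\in H^2(\mathbb D^* )$, $a(\infty)>0$; metric $\rho((a,b),(c,d))=\|a-c\|_{L^2}+\|b-d\|_{L^2}+|\log a(\infty)-\log c(\infty)|$. $\overline{\mathbf H}$: $(a,b)\in\mathbf L$ with $b\in H^2(\mathbb D)$. $\mathbf H$: $(a,b)\in\overline{\mathbf H}$ such that any inner $g$ with $a^*g^{-1},bg^{-1}\in H^2(\mathbb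 D)$ is constant. $\mathbf H_0^*$: $(a,b)\in\mathbf L$ with $(a,b^* )\in\mathbf H$ and $b^*(0)=0$. $\mathbf B$: $(a,b)\in\mathbf L$ with $\inf_{z\in\mathbb D^*}|a(z)|^2>\frac12$. Nonlinear Fourier series: for finitely supported $G:\mathbb Z\to\mathbb C$ it is the first row $(a,b)$ of the ordered product $\prod_k(1+|G_k|^2)^{-1/2}\begin{pmatrix}1&G_kz^k\\-\overline{G_k}z^{-k}&1\end{pmatrix}$ ($k$ increasing left to right). For $F\in\ell^2(\mathbb Z)$ write $F=F_-+F_+$ with $F_-$ supported in $(-\infty,-1]$ and $F_+$ in $[0,\infty)$; the nonlinear Fourier series $(a_+,b_+)$ of $F_+$ is the $\rho$-limit as $k\to\infty$ of those of $F_+\mathbf 1_{[0,k]}$, the nonlinear Fourier series $(a_-,b_-)$ of $F_-$ is the $\rho$-limit of those of $F_-\mathbf 1_{[-k,-1]}$ (both limits exist and lie in $\mathbf H$, resp. $\mathbf H_0^*$), and the nonlinear Fourier series of $F$ is $(a_-,b_-)(a_+,b_+)$, which is also the $\rho$-limit of the nonlinear Fourier series of $F\mathbf 1_{[-k,k]}$. *)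

(* Defs.v *)
(* MathComp + MathComp-Analysis, R : realType, complex numbers R[i]
   from mathcomp-real-closed.  Functions on the unit circle T are represented
   through the parametrisation theta |-> e^{i theta}, theta in [0, 2 pi]. *)
From HB Require Import structures.
From mathcomp Require Import all_boot all_order all_algebra.
From mathcomp Require Import all_classical all_reals all_analysis.
From mathcomp Require Import complex.
Set Implicit Arguments. Unset Strict Implicit. Unset Printing Implicit Defensive.
Import Order.TTheory GRing.Theory Num.Theory numFieldNormedType.Exports.
Local Open Scope classical_set_scope.
Local Open Scope ring_scope.
Local Open Scope complex_scope.

Section NLFT.
Variable R : realType.

Definition Tdom : set R := `[0, 2 * pi]%classic.

Definition expi (t : R) : R[i] := cos t +i* sin t.

Definition cabs2 (w : R[i]) : R := complex.Re w ^+ 2 + complex.Im w ^+ 2.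

Definition aeT (P : R -> Prop) : Prop :=
  (@lebesgue_measure R).-negligible (Tdom `&` [set t | ~ P t]).

Definition cvgC (u : nat -> R[i]) (w : R[i]) : Prop :=
  (fun n => complex.Re (u n)) @ \oo --> complex.Re w /\
  (fun n => complex.Im (u n)) @ \oo --> complex.Im w.

Definition measC (f : R -> R[i]) : Prop :=
  measurable_fun Tdom (fun t => complex.Re (f t)) /\
  measurable_fun Tdom (fun t => complex.Im (f t)).

Definition L2 (f : R -> R[i]) : Prop :=
  measC f /\ (\int[@lebesgue_measure R]_(t in Tdom) (cabs2 (f t))%:E < +oo)%E.

Definition l2norm (f : R -> R[i]) : R :=
  Num.sqrt (fine (\int[@lebesgue_measure R]_(t in Tdom) (cabs2 (f t))%:E)).

Definition fourier (f : R -> R[i]) (n : int) : R[i] :=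
  let g := fun t => f t * expi (- (n%:~R) * t) in
  ((2 * pi)^-1 * Rintegral (@lebesgue_measure R) Tdom (fun t => complex.Re (g t)))
  +i* ((2 * pi)^-1 * Rintegral (@lebesgue_measure R) Tdom (fun t => complex.Im (g t))).

(* f^* restricted to T is the pointwise complex conjugate *)
Definition conjf (f : R -> R[i]) : R -> R[i] := fun t => (f t)^*.

Definition H2D (f : R -> R[i]) : Prop :=
  L2 f /\ forall n : int, n < 0 -> fourier f n = 0.
Definition H2Dstar (f : R -> R[i]) : Prop :=
  L2 f /\ forall n : int, 0 < n -> fourier f n = 0.

(* value at infinity of a in H^2(D^* ) : a(oo) = conj(a^*(0)) = hat a(0) *)
Definition at_infty (a : R -> R[i]) : R[i] := fourier a 0.

(* the analytic extension of a in H^2(D^* ) to |z| > 1 is the value w of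
   the series sum_{n >= 0} hat a(-n) z^{-n} *)
Definition ext_Dstar (a : R -> R[i]) (z w : R[i]) : Prop :=
  cvgC (fun N => \sum_(k < N) fourier a (- (k%:Z)) * z ^- k) w.

Definition inL (a b : R -> R[i]) : Prop :=
  [/\ measC a, measC b,
      aeT (fun t => cabs2 (a t) + cabs2 (b t) = 1),
      H2Dstar a & 0 < at_infty a].

(* inner functions, identified with their boundary values on T:
   bounded analytic functions on D = elements of H^2(D) that are essentially
   bounded; inner: modulus one a.e. on T *)
Definition inner (g : R -> R[i]) : Prop :=
  H2D g /\ aeT (fun t => cabs2 (g t) = 1).

Definition inHbar (a b : R -> R[i]) : Prop := inL a b /\ H2D b.

Definition inH (a b : R -> R[i]) : Prop :=
  inHbar a b /\
  forall g : R -> R[i], inner g ->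
    H2D (fun t => (a t)^* / g t) -> H2D (fun t => b t / g t) ->
    exists c : R[i], aeT (fun t => g t = c).

Definition inH0star (a b : R -> R[i]) : Prop :=
  inL a b /\ inH a (conjf b) /\ fourier (conjf b) 0 = 0.

(* the set B : inf_{z in D^*} |a(z)|^2 > 1/2 ; D^* = {|z| > 1} u {oo} *)
Definition inB (a b : R -> R[i]) : Prop :=
  inL a b /\
  exists c : R, [/\ 2^-1 < c, c <= cabs2 (at_infty a) &
    forall z w : R[i], 1 < cabs2 z -> ext_Dstar a z w -> c <= cabs2 w].

Definition pmulA (a b c d : R -> R[i]) : R -> R[i] :=
  fun t => a t * c t - b t * (d t)^*.
Definition pmulB (a b c d : R -> R[i]) : R -> R[i] :=
  fun t => a t * d t + b t * (c t)^*.

Definition rho (a b c d : R -> R[i]) : R :=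
  l2norm (fun t => a t - c t) + l2norm (fun t => b t - d t)
  + `| ln (complex.Re (at_infty a)) - ln (complex.Re (at_infty c)) |.

Definition rho_cvg (ak bk : nat -> R -> R[i]) (a b : R -> R[i]) : Prop :=
  (fun k => rho (ak k) (bk k) a b) @ \oo --> 0.

Definition nlf_factor (G : int -> R[i]) (k : int) (t : R) : 'M[R[i]]_2 :=
  ((Num.sqrt (1 + cabs2 (G k)))^-1)%:C *:
  \matrix_(i < 2, j < 2)
     (if (i == 0 :> nat) then
        (if (j == 0 :> nat) then 1 else G k * expi (k%:~R * t))
      else
        (if (j == 0 :> nat) then - ((G k)^* * expi (- (k%:~R) * t)) else 1)).

Definition nlf_prod (G : int -> R[i]) (m : int) (len : nat) (t : R)
  : 'M[R[i]]_2 :=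
  \prod_(k <- [seq m + (i%:Z) | i <- iota 0 len]) nlf_factor G k t.

(* the nonlinear Fourier series (a,b) of G 1_{[m, m+len-1]} : first row *)
Definition nlftA (G : int -> R[i]) (m : int) (len : nat) : R -> R[i] :=
  fun t => nlf_prod G m len t ord0 ord0.
Definition nlftB (G : int -> R[i]) (m : int) (len : nat) : R -> R[i] :=
  fun t => nlf_prod G m len t ord0 ord_max.

Definition l2Z (F : int -> R[i]) : Prop :=
  exists M : R, forall N : nat,
    \sum_(k < N) (cabs2 (F (k%:Z)) + cabs2 (F (- (k%:Z) - 1))) <= M.

(* (a,b) is the nonlinear Fourier series of F in l^2(Z):
   (a,b) = (a_-,b_-)(a_+,b_+) a.e., where (a_+,b_+) is the rho-limit of the
   series of F 1_{[0,k]} and (a_-,b_-) the rho-limit of those of F 1_{[-k,-1]} *)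
Definition is_nlfs (F : int -> R[i]) (a b : R -> R[i]) : Prop :=
  exists ap bp am bm : R -> R[i],
    [/\ inL ap bp /\ inL am bm,
        rho_cvg (fun k => nlftA F 0 k.+1) (fun k => nlftB F 0 k.+1) ap bp,
        rho_cvg (fun k => nlftA F (- (k%:Z)) k) (fun k => nlftB F (- (k%:Z)) k) am bm,
        aeT (fun t => a t = pmulA am bm ap bp t) &
        aeT (fun t => b t = pmulB am bm ap bp t)].

End NLFT.

(* Main.v *)
(* With r = b / a, the hypothesis |a|^2 > 1/2 gives |r|^2 <= q < 1 and makes 1 / a
   an element of H^2(D^* ).  Splitting (a, b) at frequency n into a left and a right
   factor amounts, after normalising the right factor (A, B), to the linear system
     A in H^2(D^* ), B of frequencies >= n,
     A + r^* B in H^2(D) with mean 1,   r A - B of frequencies < n,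
   which is a contraction, hence uniquely solvable, because |r| <= q^(1/2) < 1.  The
   determinant identity of the two factors, divided by a, shows that an inner g
   dividing one of the factors lies in H^2(D) and in H^2(D^* ), so it is constant.
   Moving the splitting point from n to n + 1 transfers exactly one elementary
   factor, with parameter F_n = rb^(n) / ra^(0); the numbers ra^(0) stay in
   [a(oo), 1] and are multiplied by (1 + |F_n|^2)^(1/2) at each step, whence F is
   square summable.  A unitary pair (u, v) satisfies
   |u - 1|^2 + |v|^2 = 2 - 2 Re u^(0) in mean, so the convergence of the partial
   products reduces to ra^(0) -> 1 as n -> +oo and ra^(0) -> a(oo) as n -> -oo.
   Conversely, the factors produced by any G whose series is (a, b) split (a, b) at
   every n, so they agree with the above and G_n = F_n. *)

(* The linear system is what remains after the left factor is eliminated: solving for it and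
   dividing by [a] gives [la / a = cj A + r cj B] and [lb / a = r A - B], and since [1 / a] has no
   positive frequencies, the conditions on the left factor become conditions on these quotients. Two
   obstacles shape the analysis. The hypothesis bounds [a] only outside the closed disc, through
   sums of its coefficient series; carrying the bound to the circle and inverting [a] goes through
   dilated polynomials, which are invertible by factoring them. Moreover, the solutions are a priori
   only square integrable, so that products such as |A|^2 are merely integrable: uniqueness of
   Fourier coefficients is therefore proved in L^1, and it yields that |A|^2 + |B|^2 is constant,
   without which no normalisation would be possible. The two limits of [ra^(0)] come from one energy
   identity, applied to the difference between the solution and what it should tend to: (1, 0) at
   one end, alpha (a, b) with alpha = a(oo) at the other. *)
Require Import Defs.
From HB Require Import structures.
From mathcomp Require Import all_boot all_order all_algebra.
From mathcomp Require Import all_classical all_reals all_analysis.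
From mathcomp Require Import measurable_realfun complex ring lra zify.
Import Order.TTheory GRing.Theory Num.Theory numFieldNormedType.Exports.
Local Open Scope classical_set_scope.
Local Open Scope ring_scope.
Local Open Scope complex_scope.
Set Implicit Arguments. Unset Strict Implicit. Unset Printing Implicit Defensive.

(* One constant for complex conjugation: [^*] denotes [conjc] or [Num.conj]
   depending on the surrounding scope. *)
Definition cj (R : realType) (z : R[i]) : R[i] := conjc z.

(** * Complex arithmetic through the real-valued squared modulus *)

Section ComplexBasics.
Variable R : realType.
Implicit Types (u v w : R[i]) (s t : R).

Lemma complex_ext u v :
  complex.Re u = complex.Re v -> complex.Im u = complex.Im v -> u = v.
Proof. by case: u v => [? ?] [? ?] /= -> ->. Qed.

Lemma Re_add u v : complex.Re (u + v) = complex.Re u + complex.Re v.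
Proof. by case: u v => [? ?] [? ?]. Qed.
Lemma Im_add u v : complex.Im (u + v) = complex.Im u + complex.Im v.
Proof. by case: u v => [? ?] [? ?]. Qed.
Lemma Re_opp u : complex.Re (- u) = - complex.Re u.
Proof. by case: u. Qed.
Lemma Im_opp u : complex.Im (- u) = - complex.Im u.
Proof. by case: u. Qed.
Lemma Re_mul u v : complex.Re (u * v) =
  complex.Re u * complex.Re v - complex.Im u * complex.Im v.
Proof. by case: u v => [? ?] [? ?]. Qed.
Lemma Im_mul u v : complex.Im (u * v) =
  complex.Re u * complex.Im v + complex.Im u * complex.Re v.
Proof. by case: u v => [? ?] [? ?]. Qed.
Lemma Re_conj u : complex.Re (cj u) = complex.Re u.
Proof. by case: u. Qed.
Lemma Im_conj u : complex.Im (cj u) = - complex.Im u.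
Proof. by case: u. Qed.

Definition ReImE := (Re_add, Im_add, Re_opp, Im_opp, Re_mul, Im_mul, Re_conj, Im_conj).

Lemma cabs2E w : (cabs2 w)%:C = w * cj w.
Proof. by apply: complex_ext; rewrite !ReImE /= /cabs2; ring. Qed.

Lemma Re_mulJ w : complex.Re (w * cj w) = cabs2 w.
Proof. by rewrite -cabs2E. Qed.

Lemma cabs2M u v : cabs2 (u * v) = cabs2 u * cabs2 v.
Proof. by rewrite /cabs2 !ReImE; ring. Qed.

Lemma cabs2X w n : cabs2 (w ^+ n) = cabs2 w ^+ n.
Proof.
elim: n => [|n IH]; last by rewrite !exprS cabs2M IH.
by rewrite !expr0 /cabs2 /= expr1n expr0n addr0.
Qed.

Lemma cabs2J w : cabs2 (cj w) = cabs2 w.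
Proof. by rewrite /cabs2 !ReImE; ring. Qed.

Lemma cabs2N w : cabs2 (- w) = cabs2 w.
Proof. by rewrite /cabs2 !ReImE; ring. Qed.

Lemma cabs2_ge0 w : 0 <= cabs2 w.
Proof. by rewrite addr_ge0// sqr_ge0. Qed.

Lemma cabs2_real (x : R) : cabs2 x%:C = x ^+ 2.
Proof. by rewrite /cabs2 /= expr0n addr0. Qed.

Lemma cabs20 : cabs2 (0 : R[i]) = 0.
Proof. by rewrite cabs2_real expr0n. Qed.

Lemma cabs21 : cabs2 (1 : R[i]) = 1.
Proof. by rewrite cabs2_real expr1n. Qed.

Lemma cabs2_eq0 w : (cabs2 w == 0) = (w == 0).
Proof.
apply/eqP/eqP => [/eqP|->]; last by rewrite cabs20.
rewrite paddr_eq0 ?sqr_ge0// !sqrf_eq0 => /andP[/eqP h1 /eqP h2].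
exact: complex_ext.
Qed.

Lemma cabs2_gt0 w : (0 < cabs2 w) = (w != 0).
Proof. by rewrite lt0r cabs2_eq0 cabs2_ge0 andbT. Qed.

Lemma cabs2V w : cabs2 w^-1 = (cabs2 w)^-1.
Proof.
have [->|w0] := eqVneq w 0; first by rewrite invr0 cabs20 invr0.
apply: (mulfI (x := cabs2 w)); first by rewrite cabs2_eq0.
by rewrite -cabs2M !divff ?cabs2_eq0// cabs21.
Qed.

Lemma cabs2D_le u v : cabs2 (u + v) <= 2 * cabs2 u + 2 * cabs2 v.
Proof.
rewrite /cabs2 !ReImE; have := sqr_ge0 (complex.Re u - complex.Re v).
have := sqr_ge0 (complex.Im u - complex.Im v); nra.
Qed.

Lemma cabs2B_le u v : cabs2 (u - v) <= 2 * cabs2 u + 2 * cabs2 v.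
Proof. by rewrite (le_trans (cabs2D_le _ _))// cabs2N. Qed.

Lemma sqr_Re_le w : complex.Re w ^+ 2 <= cabs2 w.
Proof. by rewrite lerDl sqr_ge0. Qed.

Lemma sqr_Im_le w : complex.Im w ^+ 2 <= cabs2 w.
Proof. by rewrite lerDr sqr_ge0. Qed.

Lemma cjD u v : cj (u + v) = cj u + cj v. Proof. exact: rmorphD. Qed.
Lemma cjN u : cj (- u) = - cj u. Proof. exact: rmorphN. Qed.
Lemma cjB u v : cj (u - v) = cj u - cj v. Proof. exact: rmorphB. Qed.
Lemma cjM u v : cj (u * v) = cj u * cj v. Proof. exact: rmorphM. Qed.
Lemma cjR (x : R) : cj x%:C = x%:C. Proof. by rewrite /cj /= oppr0. Qed.
Lemma cj0 : cj 0 = 0 :> R[i]. Proof. exact: rmorph0. Qed.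
Lemma cj1 : cj 1 = 1 :> R[i]. Proof. exact: rmorph1. Qed.
Lemma cjK u : cj (cj u) = u. Proof. exact: conjcK. Qed.

Lemma cjV w : cj (w^-1) = (cj w)^-1.
Proof. exact: conjc_inv. Qed.

Lemma mulVc_conj w : w != 0 -> w^-1 = ((cabs2 w)^-1)%:C * cj w.
Proof.
move=> w0; apply: (mulfI w0); rewrite divff// mulrCA -cabs2E.
by rewrite -rmorphM /= mulVf ?cabs2_eq0.
Qed.

Lemma expiD s t : expi (s + t) = expi s * expi t.
Proof. by apply: complex_ext; rewrite !ReImE /= ?cosD ?sinD//; ring. Qed.

Lemma expi0 : expi (0 : R) = 1.
Proof. by rewrite /expi cos0 sin0. Qed.

Lemma expiJ t : cj (expi t) = expi (- t).
Proof. by rewrite /cj /expi cosN sinN. Qed.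

Lemma cabs2_expi t : cabs2 (expi t) = 1.
Proof. exact: cos2Dsin2. Qed.

Lemma expi_neq0 t : expi t != 0.
Proof. by rewrite -cabs2_eq0 cabs2_expi oner_eq0. Qed.

Lemma expiN t : expi (- t) = (expi t)^-1.
Proof. by apply: (mulfI (expi_neq0 t)); rewrite divff ?expi_neq0// -expiD subrr expi0. Qed.

Lemma expiX t k : expi (k%:R * t) = expi t ^+ k.
Proof.
elim: k => [|k IH]; first by rewrite mul0r expi0.
by rewrite -natr1 mulrDl mul1r expiD IH exprSr.
Qed.

Lemma expi_2pi (n : int) : expi (n%:~R * (2 * pi : R)) = 1.
Proof.
have h k : expi (k%:R * (2 * pi : R)) = 1.
  rewrite expiX (_ : expi _ = 1) ?expr1n// /expi mulr_natl cos2pi sin2pi.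
  exact: complex_ext.
by case: n => n; rewrite ?NegzE ?mulrNz ?mulNr ?expiN -pmulrn h ?invr1.
Qed.

End ComplexBasics.

Arguments expi : simpl never.
Arguments cj : simpl never.
Arguments cabs2 : simpl never.
Arguments fourier : simpl never.

(** * Measurability and almost-everywhere statements on the circle *)

Section MeasurableComplex.
Variable R : realType.
Local Notation mu := (@lebesgue_measure R).
Local Notation D := (@Tdom R).
Implicit Types (f g h : R -> R[i]).

Lemma mD : measurable (D : set (measurableTypeR R)). Proof. exact: measurable_itv. Qed.
Local Hint Extern 0 (measurable _) => solve [exact: mD] : core.

Lemma pi2_gt0 : 0 < 2 * pi :> R.
Proof. by rewrite mulr_gt0// pi_gt0. Qed.

Lemma muD : mu D = (2 * pi)%:E.
Proof. by rewrite lebesgue_measure_itv/= lte_fin pi2_gt0 oppr0 adde0. Qed.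

Lemma aeT_ae (P : R -> Prop) : aeT P <-> {ae mu, forall t, D t -> P t}.
Proof.
rewrite /aeT /almost_everywhere.
suff -> : D `&` [set t | ~ P t] = ~` [set t | D t -> P t] by [].
by apply/seteqP; split => t /=; [move=> [Dt nP] /(_ Dt)|move=> /not_implyP].
Qed.

Let aeF : Filter (nbhs (almost_everywhere mu)) := ae_filter_ringOfSetsType mu.

#[global] Instance aeT_filter : Filter (@aeT R).
Proof.
split.
- by apply/aeT_ae; apply: aeW.
- move=> P Q /aeT_ae hP /aeT_ae hQ; apply/aeT_ae.
  apply: filterS2; [exact: aeF| |exact: hP|exact: hQ].
  by move=> t pt qt Dt; split; [exact: pt|exact: qt].
- move=> P Q PQ /aeT_ae hP; apply/aeT_ae.
  apply: filterS; [exact: aeF| |exact: hP].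
  by move=> t pt Dt; apply: PQ; exact: pt.
Qed.

Lemma aeTI (P Q : R -> Prop) : aeT P -> aeT Q -> aeT (fun t => P t /\ Q t).
Proof. exact: filterI. Qed.

Lemma aeT_on (P : R -> Prop) : (forall t, D t -> P t) -> aeT P.
Proof. by move=> h; apply/aeT_ae; apply: aeW => t; exact: h. Qed.

(** The circle has positive measure 2 pi. Serves to read off constants from identities that hold
    only almost everywhere. *)
Lemma aeT_ex (P : R -> Prop) : aeT P -> exists2 t, D t & P t.
Proof.
move=> h; apply: contrapT => nP.
suff : mu D = 0%E.
  by rewrite muD => -[] /eqP; rewrite gt_eqF// pi2_gt0.
have -> : D = D `&` [set t | ~ P t].
  by apply/seteqP; split => t //= [] //; split=> // Pt; apply: nP; exists t.
case: h => A [mA A0 sub].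
apply/eqP; rewrite eq_le measure_ge0 andbT -A0 le_measure ?inE//.
suff -> : D `&` [set t | ~ P t] = D by [].
by apply/seteqP; split => t //= [] //; split=> // Pt; apply: nP; exists t.
Qed.

Lemma measC_cst (c : R[i]) : measC (fun=> c).
Proof. by split; exact: measurable_cst. Qed.

Lemma measCD f g : measC f -> measC g -> measC (fun t => f t + g t).
Proof.
move=> [f1 f2] [g1 g2]; split.
- by under eq_fun do rewrite Re_add; exact: measurable_funD.
- by under eq_fun do rewrite Im_add; exact: measurable_funD.
Qed.

Lemma measCN f : measC f -> measC (fun t => - f t).
Proof.
move=> [f1 f2]; split.
- by under eq_fun do rewrite Re_opp; exact: measurableT_comp.
- by under eq_fun do rewrite Im_opp; exact: measurableT_comp.
Qed.

Lemma measCJ f : measC f -> measC (fun t => cj (f t)).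
Proof.
move=> [f1 f2]; split.
- by under eq_fun do rewrite Re_conj.
- by under eq_fun do rewrite Im_conj; exact: measurableT_comp.
Qed.

Lemma measCM f g : measC f -> measC g -> measC (fun t => f t * g t).
Proof.
move=> [f1 f2] [g1 g2]; split.
- by under eq_fun do rewrite Re_mul; apply: measurable_funB; exact: measurable_funM.
- by under eq_fun do rewrite Im_mul; apply: measurable_funD; exact: measurable_funM.
Qed.

Lemma measurable_cabs2 f : measC f -> measurable_fun D (fun t => cabs2 (f t)).
Proof. by move=> [f1 f2]; apply: measurable_funD; exact: measurable_funX. Qed.

Lemma measC_real (f : R -> R) : measurable_fun D f -> measC (fun t => (f t)%:C).
Proof. by move=> mf; split => //=; exact: measurable_cst. Qed.

Lemma measCV f : measC f -> measC (fun t => (f t)^-1).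
Proof.
(* The inverse is rewritten with [ln] and [expR], which are measurable; where [f] vanishes, the
   factor [cj (f t)] produces the value 0 of [0^-1]. *)
move=> mf; have -> : (fun t => (f t)^-1) =
    (fun t => (expR (- ln (cabs2 (f t))))%:C * cj (f t)).
  apply/funext => t; have [->|f0] := eqVneq (f t) 0.
    by rewrite invr0 cj0 mulr0.
  by rewrite mulVc_conj// expRN lnK// posrE cabs2_gt0.
apply: measCM; last exact: measCJ.
apply: measC_real; apply: measurableT_comp => //.
apply: measurableT_comp => //; apply: (@measurableT_comp _ _ _ _ _ _ (@ln R)).
  exact: measurable_ln.
exact: measurable_cabs2.
Qed.

Lemma measC_expi (k : R) : measC (fun t => expi (k * t)).
Proof.
split => /=.
- apply: (@measurableT_comp _ _ _ _ _ _ (@cos R)).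
    by apply: continuous_measurable_fun => x; exact: continuous_cos.
  by apply: measurable_funM => //; exact: measurable_cst.
- apply: (@measurableT_comp _ _ _ _ _ _ (@sin R)).
    by apply: continuous_measurable_fun => x; exact: continuous_sin.
  by apply: measurable_funM => //; exact: measurable_cst.
Qed.

End MeasurableComplex.

(** * Averages and inner products over the circle *)

Section RealIntegrals.
Variable R : realType.
Local Notation mu := (@lebesgue_measure R).
Local Notation D := (@Tdom R).
Local Hint Extern 0 (measurable _) => solve [exact: mD] : core.
Implicit Types f g : R -> R.

Definition rint f := mu.-integrable D (EFin \o f).

Lemma rint_meas f : rint f -> measurable_fun D f.
Proof. by move=> /measurable_int /measurable_EFinP. Qed.

Lemma rint_le f g : measurable_fun D f -> rint g ->
  (forall t, D t -> `|f t| <= g t) -> rint f.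
Proof.
move=> mf ig fg; apply: le_integrable ig => //; first exact/measurable_EFinP.
by move=> t Dt /=; rewrite lee_fin (le_trans (fg _ Dt))// ler_norm.
Qed.

Lemma rint_cst (c : R) : rint (fun=> c).
Proof.
apply: measurable_bounded_integrable => //; first by rewrite (_ : _ D = (2 * pi)%:E) ?ltry//; exact: muD.
exists `|c|; split; first exact: num_real.
by move=> x cx t _ /=; rewrite ltW.
Qed.

Lemma rintD f g : rint f -> rint g -> rint (fun t => f t + g t).
Proof. by move=> hf hg; apply: (integrableD _ hf hg). Qed.

Lemma rintZ c f : rint f -> rint (fun t => c * f t).
Proof. by move=> hf; apply: (integrableZl _ c hf). Qed.

Lemma rintN f : rint f -> rint (fun t => - f t).
Proof.
by move=> /(rintZ (-1)); congr rint; apply/funext => t; rewrite mulN1r.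
Qed.

Lemma rint_ae_le f g : measurable_fun D f -> rint g ->
  (forall t, 0 <= f t) -> (forall t, 0 <= g t) -> aeT (fun t => f t <= g t) ->
  rint f /\ Rintegral mu D f <= Rintegral mu D g.
Proof.
move=> mf ig f0 g0 fg.
have le : (\int[mu]_(t in D) (f t)%:E <= \int[mu]_(t in D) (g t)%:E)%E.
  apply: ae_ge0_le_integral => //.
  - by move=> t _; rewrite lee_fin.
  - exact/measurable_EFinP.
  - by move=> t _; rewrite lee_fin.
  - by apply/measurable_EFinP; exact: (rint_meas ig).
  - have := (aeT_ae _).1 fg; apply: (@filterS _ _ (ae_filter_ringOfSetsType mu)).
    by move=> t h Dt; rewrite lee_fin h.
have fy : (\int[mu]_(t in D) (f t)%:E < +oo)%E.
  by rewrite (le_lt_trans le)// integrable_lty.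
have rf : rint f.
  apply/integrableP; split; first exact/measurable_EFinP.
  by under eq_integral do rewrite /= ger0_norm//.
split=> //; rewrite /Rintegral fine_le//; exact: integrable_fin_num.
Qed.

Lemma Rintegral_ae f g : measurable_fun D f -> measurable_fun D g ->
  aeT (fun t => f t = g t) -> Rintegral mu D f = Rintegral mu D g.
Proof.
move=> mf mg fg; congr fine; apply: ae_eq_integral => //.
- exact/measurable_EFinP.
- exact/measurable_EFinP.
- have := (aeT_ae _).1 fg; apply: (@filterS _ _ (ae_filter_ringOfSetsType mu)).
  by move=> t h Dt; rewrite h.
Qed.

Lemma rint_norm f : rint f -> rint (fun t => `|f t|).
Proof. by move=> rf; exact: integrable_norm. Qed.

Lemma Rintegral_eq0 f : rint f -> (forall t, 0 <= f t) ->
  Rintegral mu D f = 0 -> aeT (fun t => f t = 0).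
Proof.
move=> rf f0 If.
have : (\int[mu]_(t in D) `|(f t)%:E|)%E = 0%E.
  under eq_integral do rewrite /= ger0_norm//.
  move: If; rewrite /Rintegral => If; rewrite -[LHS]fineK ?If//.
  exact: integrable_fin_num.
move=> h; apply/aeT_ae.
have mf : measurable_fun D (EFin \o f) by apply/measurable_EFinP; exact: rint_meas.
have := (ae_eq_integral_abs mu (@mD R) mf).1 h.
apply: (@filterS _ _ (ae_filter_ringOfSetsType mu)).
by move=> t /[apply] -[].
Qed.

End RealIntegrals.

Section ComplexIntegrals.
Variable R : realType.
Local Notation mu := (@lebesgue_measure R).
Local Notation D := (@Tdom R).
Local Hint Extern 0 (measurable _) => solve [exact: mD] : core.
Implicit Types (f g h : R -> R[i]) (c : R[i]).

Definition L1 f := rint (fun t => complex.Re (f t)) /\ rint (fun t => complex.Im (f t)).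

(** The normalisation by 2 pi makes the exponentials [e_ n] orthonormal and [fourier f n] an inner
    product. *)
Definition avg f : R[i] :=
  ((2 * pi)^-1 * Rintegral mu D (fun t => complex.Re (f t)))
  +i* ((2 * pi)^-1 * Rintegral mu D (fun t => complex.Im (f t))).

Definition msq f : R := (2 * pi)^-1 * Rintegral mu D (fun t => cabs2 (f t)).

Definition inp f g : R[i] := avg (fun t => f t * cj (g t)).

Arguments avg : simpl never.
Arguments inp : simpl never.
Arguments msq : simpl never.

Definition e_ (n : int) : R -> R[i] := fun t => expi (n%:~R * t).

Lemma L1_meas f : L1 f -> measC f.
Proof. by move=> [/rint_meas ? /rint_meas ?]. Qed.

Lemma L1D f g : L1 f -> L1 g -> L1 (fun t => f t + g t).
Proof.
move=> [f1 f2] [g1 g2]; split.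
- by under eq_fun do rewrite Re_add; exact: rintD.
- by under eq_fun do rewrite Im_add; exact: rintD.
Qed.

Lemma L1Z c f : L1 f -> L1 (fun t => c * f t).
Proof.
move=> [f1 f2]; split.
- by under eq_fun do rewrite Re_mul; apply: rintD; [|apply: rintN]; exact: rintZ.
- by under eq_fun do rewrite Im_mul; apply: rintD; exact: rintZ.
Qed.

Lemma L1_cst c : L1 (fun=> c).
Proof. by split; exact: rint_cst. Qed.

Lemma L1B f g : L1 f -> L1 g -> L1 (fun t => f t - g t).
Proof.
move=> hf /(L1Z (-1)) hg; have := L1D hf hg.
by under eq_fun do rewrite mulN1r.
Qed.

Lemma L1_bdd h f M : measC h -> (forall t, cabs2 (h t) <= M) -> L1 f ->
  L1 (fun t => h t * f t).
Proof.
move=> mh hM [f1 f2].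
have [m1 m2] := measCM mh (L1_meas (conj f1 f2)).
pose G t := (1 + M) * (`|complex.Re (f t)| + `|complex.Im (f t)|).
have rG : rint G by apply: rintZ; apply: rintD; exact: rint_norm.
(* From x^2 <= M follows |x| <= 1 + M, which avoids a square root of M. *)
have bR t : `|complex.Re (h t)| <= 1 + M.
  have := sqr_Re_le (h t); have := hM t; rewrite ler_norml.
  by move=> ? ?; apply/andP; split; nra.
have bI t : `|complex.Im (h t)| <= 1 + M.
  have := sqr_Im_le (h t); have := hM t; rewrite ler_norml.
  by move=> ? ?; apply/andP; split; nra.
split; apply: (rint_le _ rG) => // t _; rewrite /G ?Re_mul ?Im_mul mulrDr.
- by rewrite (le_trans (ler_normB _ _))// !normrM lerD// ler_pM.
- by rewrite (le_trans (ler_normD _ _))// !normrM addrC lerD// ler_pM.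
Qed.

Lemma avgD f g : L1 f -> L1 g -> avg (fun t => f t + g t) = avg f + avg g.
Proof.
move=> [f1 f2] [g1 g2]; apply: complex_ext; rewrite ReImE /= -mulrDr; congr (_ * _).
- by under eq_Rintegral do rewrite Re_add; exact: RintegralD.
- by under eq_Rintegral do rewrite Im_add; exact: RintegralD.
Qed.

Lemma avgJ f : L1 f -> avg (fun t => cj (f t)) = cj (avg f).
Proof.
move=> [f1 f2]; apply: complex_ext; rewrite ReImE /=.
- by under eq_Rintegral do rewrite Re_conj.
- rewrite -mulrN; congr (_ * _).
  under eq_Rintegral do rewrite Im_conj -mulN1r.
  by rewrite RintegralZl// mulN1r.
Qed.

Lemma avgZ c f : L1 f -> avg (fun t => c * f t) = c * avg f.
Proof.
move=> [f1 f2]; apply: complex_ext; rewrite ReImE /=.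
- under eq_Rintegral do rewrite Re_mul.
  rewrite RintegralB//; [|exact: rintZ|exact: rintZ].
  by rewrite !RintegralZl//; ring.
- under eq_Rintegral do rewrite Im_mul.
  rewrite RintegralD//; [|exact: rintZ|exact: rintZ].
  by rewrite !RintegralZl//; ring.
Qed.

Lemma avgB f g : L1 f -> L1 g -> avg (fun t => f t - g t) = avg f - avg g.
Proof.
move=> hf hg; rewrite -[- avg g]mulN1r -avgZ// -avgD//; last exact: L1Z.
by congr avg; apply/funext => t; rewrite mulN1r.
Qed.

Lemma avg_cst c : avg (fun=> c) = c.
Proof.
have p0 : 2 * pi != 0 :> R by rewrite gt_eqF// pi2_gt0.
have h x : (2 * pi)^-1 * Rintegral mu D (cst x) = x :> R.
  rewrite Rintegral_cst// (_ : _ D = (2 * pi)%:E); last exact: muD.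
  by rewrite /= mulrC -mulrA divff// mulr1.
by apply: complex_ext; exact: h.
Qed.

Lemma avg_ae f g : measC f -> measC g -> aeT (fun t => f t = g t) -> avg f = avg g.
Proof.
move=> [f1 f2] [g1 g2] fg; apply: complex_ext => /=; congr (_ * _);
  by apply: Rintegral_ae => //; apply: filterS fg => t ->.
Qed.

Lemma L2P f : L2 f <-> measC f /\ rint (fun t => cabs2 (f t)).
Proof.
split=> -[mf]; move=> h; split=> //.
- apply/integrableP; split; first by apply/measurable_EFinP; exact: measurable_cabs2.
  by under eq_integral do rewrite /= ger0_norm ?cabs2_ge0//.
- exact: integrable_lty.
Qed.

Lemma L2_meas f : L2 f -> measC f. Proof. by case. Qed.

Lemma L2M f g : L2 f -> L2 g -> L1 (fun t => f t * g t).
Proof.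
move=> /L2P[mf f2] /L2P[mg g2]; have [m1 m2] := measCM mf mg.
have r : rint (fun t => cabs2 (f t) + cabs2 (g t)) by exact: rintD.
split; apply: (rint_le _ r) => // t _; rewrite ler_norml ?Re_mul ?Im_mul /cabs2;
  move: (f t) (g t) => [a b] [c d] /=; apply/andP; split.
- by have := sqr_ge0 (a + c); have := sqr_ge0 (b - d); nra.
- by have := sqr_ge0 (a - c); have := sqr_ge0 (b + d); nra.
- by have := sqr_ge0 (a + d); have := sqr_ge0 (b + c); nra.
- by have := sqr_ge0 (a - d); have := sqr_ge0 (b - c); nra.
Qed.

Lemma L2_cst c : L2 (fun=> c).
Proof. by apply/L2P; split; [exact: measC_cst|exact: rint_cst]. Qed.

Lemma L2_L1 f : L2 f -> L1 f.
Proof. by move=> hf; have := L2M hf (L2_cst 1); under eq_fun do rewrite mulr1. Qed.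

Lemma L2J f : L2 f -> L2 (fun t => cj (f t)).
Proof.
move=> /L2P[mf hf]; apply/L2P; split; first exact: measCJ.
by under eq_fun do rewrite cabs2J.
Qed.

Lemma msq_ge0 f : 0 <= msq f.
Proof.
by rewrite mulr_ge0 ?invr_ge0 ?(ltW (@pi2_gt0 R))// Rintegral_ge0// => t _; exact: cabs2_ge0.
Qed.

Lemma msq_ae_le M f g : 0 <= M -> measC f -> L2 g ->
  aeT (fun t => cabs2 (f t) <= M * cabs2 (g t)) -> L2 f /\ msq f <= M * msq g.
Proof.
move=> M0 mf /L2P[mg ig] fg.
have [||||rf ll] := @rint_ae_le _ _ (fun t => M * cabs2 (g t)) (measurable_cabs2 mf).
- exact: rintZ.
- by move=> t; exact: cabs2_ge0.
- by move=> t; rewrite mulr_ge0// cabs2_ge0.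
- exact: fg.
split; first by apply/L2P.
rewrite /msq mulrCA ler_pM2l ?invr_gt0 ?(@pi2_gt0 R)//.
by rewrite -RintegralZl.
Qed.

Lemma msq_ae f g : measC f -> measC g -> aeT (fun t => f t = g t) -> msq f = msq g.
Proof.
move=> mf mg fg; congr (_ * _); apply: Rintegral_ae; [exact: measurable_cabs2..|].
by apply: filterS fg => t ->.
Qed.

Lemma L2_ae f g : measC g -> L2 f -> aeT (fun t => f t = g t) -> L2 g.
Proof.
move=> mg hf fg; have [] // := @msq_ae_le 1 g f.
by apply: filterS fg => t ->; rewrite mul1r.
Qed.

Lemma msqDE f g : L2 f -> L2 g ->
  L2 (fun t => f t + g t) /\ msq (fun t => f t + g t) <= 2 * msq f + 2 * msq g.
Proof.
move=> /L2P[mf rf] /L2P[mg rg].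
have [||||rfg ll] := @rint_ae_le _ (fun t => cabs2 (f t + g t))
   (fun t => 2 * cabs2 (f t) + 2 * cabs2 (g t)) (measurable_cabs2 (measCD mf mg)).
- by apply: rintD; exact: rintZ.
- by move=> t; exact: cabs2_ge0.
- by move=> t; rewrite addr_ge0// mulr_ge0// cabs2_ge0.
- by apply: aeT_on => t _; exact: cabs2D_le.
split; first by apply/L2P; split => //; exact: measCD.
rewrite /msq mulrCA [2 * ((2 * pi)^-1 * Rintegral mu D (fun t => cabs2 (g t)))]mulrCA.
rewrite -mulrDr ler_pM2l ?invr_gt0 ?(@pi2_gt0 R)//.
by rewrite -!RintegralZl// -RintegralD//; exact: rintZ.
Qed.

Lemma L2D f g : L2 f -> L2 g -> L2 (fun t => f t + g t).
Proof. by move=> hf hg; have [] := msqDE hf hg. Qed.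

Lemma msqD_le f g : L2 f -> L2 g -> msq (fun t => f t + g t) <= 2 * msq f + 2 * msq g.
Proof. by move=> hf hg; have [] := msqDE hf hg. Qed.

Lemma L2_bdd M h f : measC h -> aeT (fun t => cabs2 (h t) <= M) -> L2 f ->
  L2 (fun t => h t * f t).
Proof.
move=> mh hM hf; have [] // := @msq_ae_le `|M| (fun t => h t * f t) f.
- by apply: measCM => //; exact: L2_meas.
- apply: filterS hM => t hM; rewrite cabs2M ler_wpM2r ?cabs2_ge0//.
  by rewrite (le_trans hM)// ler_norm.
Qed.

Lemma msq_bdd M h f : measC h -> aeT (fun t => cabs2 (h t) <= M) -> L2 f ->
  msq (fun t => h t * f t) <= M * msq f.
Proof.
move=> mh hM hf.
have M0 : 0 <= M by have [t _] := aeT_ex hM; apply: le_trans; exact: cabs2_ge0.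
have [] // := @msq_ae_le M (fun t => h t * f t) f.
- by apply: measCM => //; exact: L2_meas.
- by apply: filterS hM => t hM; rewrite cabs2M ler_wpM2r ?cabs2_ge0.
Qed.

Lemma L2Z c f : L2 f -> L2 (fun t => c * f t).
Proof.
apply: (@L2_bdd (cabs2 c)); first exact: measC_cst.
exact: aeT_on.
Qed.

Lemma L2N f : L2 f -> L2 (fun t => - f t).
Proof. by move=> /(L2Z (-1)); under eq_fun do rewrite mulN1r. Qed.

Lemma L2B f g : L2 f -> L2 g -> L2 (fun t => f t - g t).
Proof. by move=> hf /L2N; exact: L2D. Qed.

Lemma msqN f : msq (fun t => - f t) = msq f.
Proof. by rewrite /msq; under eq_Rintegral do rewrite cabs2N. Qed.

Lemma msqJ f : msq (fun t => cj (f t)) = msq f.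
Proof. by rewrite /msq; under eq_Rintegral do rewrite cabs2J. Qed.

Lemma msqZ c f : L2 f -> msq (fun t => c * f t) = cabs2 c * msq f.
Proof.
move=> /L2P[_ h]; rewrite /msq mulrCA -[X in _ = _ * X]RintegralZl//.
by under eq_Rintegral do rewrite cabs2M.
Qed.

Lemma msqB_le f g : L2 f -> L2 g -> msq (fun t => f t - g t) <= 2 * msq f + 2 * msq g.
Proof. by move=> hf hg; rewrite (le_trans (msqD_le hf (L2N hg)))// msqN. Qed.

Lemma msqBC f g : msq (fun t => f t - g t) = msq (fun t => g t - f t).
Proof. by rewrite -msqN; congr msq; apply/funext => t; rewrite opprB. Qed.

Lemma msq0_ae f : L2 f -> msq f = 0 -> aeT (fun t => f t = 0).
Proof.
move=> /L2P[_ h] /eqP; rewrite mulf_eq0 invr_eq0 (gt_eqF (@pi2_gt0 R)) /= => /eqP.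
move=> /(Rintegral_eq0 h) => /(_ (fun t => cabs2_ge0 (f t))).
by apply: filterS => t /eqP; rewrite cabs2_eq0 => /eqP.
Qed.

Lemma avg_real (f : R -> R) : avg (fun t => (f t)%:C) =
  ((2 * pi)^-1 * Rintegral mu D f)%:C.
Proof. by apply: complex_ext => //=; rewrite Rintegral_cst// mul0r mulr0. Qed.

Lemma inp_self f : inp f f = (msq f)%:C.
Proof. by rewrite -avg_real /inp; congr avg; apply/funext => t; rewrite cabs2E. Qed.

Lemma L2_inp f g : L2 f -> L2 g -> L1 (fun t => f t * cj (g t)).
Proof. by move=> hf /L2J; exact: L2M. Qed.

Lemma inpDl f g h : L2 f -> L2 g -> L2 h ->
  inp (fun t => f t + g t) h = inp f h + inp g h.
Proof.
move=> hf hg hh; rewrite /inp -avgD; [|exact: L2_inp..].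
by congr avg; apply/funext => t; rewrite mulrDl.
Qed.

Lemma inpZl c f g : L2 f -> L2 g -> inp (fun t => c * f t) g = c * inp f g.
Proof.
move=> hf hg; rewrite /inp -avgZ; last exact: L2_inp.
by congr avg; apply/funext => t; rewrite mulrA.
Qed.

Lemma inpJ f g : L2 f -> L2 g -> inp g f = cj (inp f g).
Proof.
move=> hf hg; rewrite /inp -avgJ; last exact: L2_inp.
by congr avg; apply/funext => t; rewrite cjM cjK mulrC.
Qed.

Lemma inpBl f g h : L2 f -> L2 g -> L2 h ->
  inp (fun t => f t - g t) h = inp f h - inp g h.
Proof.
move=> hf hg hh; rewrite /inp -avgB; [|exact: L2_inp..].
by congr avg; apply/funext => t; rewrite mulrBl.
Qed.

Lemma inpBr f g h : L2 f -> L2 g -> L2 h ->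
  inp h (fun t => f t - g t) = inp h f - inp h g.
Proof.
move=> hf hg hh; rewrite inpJ ?inpBl//; last exact: L2B.
by rewrite cjB -!inpJ.
Qed.

Lemma inpZr c f g : L2 f -> L2 g -> inp f (fun t => c * g t) = cj c * inp f g.
Proof.
move=> hf hg; rewrite inpJ ?inpZl//; last exact: L2Z.
by rewrite cjM -!inpJ.
Qed.

Lemma msqB f g : L2 f -> L2 g ->
  msq (fun t => f t - g t) = msq f + msq g - 2 * complex.Re (inp f g).
Proof.
move=> hf hg; apply: (@complexI R).
have hfg := L2B hf hg.
rewrite -inp_self inpBl// !inpBr// !inp_self (inpJ hf hg).
by apply: complex_ext; rewrite !ReImE /=; ring.
Qed.

(** The squared norm of f - s <f, g> g is nonnegative for every real s; taking s = 1 / [msq g] gives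
    the claim. *)
Lemma cauchy_schwarz f g : L2 f -> L2 g -> cabs2 (inp f g) <= msq f * msq g.
Proof.
move=> hf hg; set P := cabs2 _.
have key s : 0 <= msq f - 2 * s * P + s ^+ 2 * P * msq g.
  have := msq_ge0 (fun t => f t - (s%:C * inp f g) * g t).
  rewrite msqB//; last exact: L2Z.
  rewrite msqZ// inpZr// cabs2M cabs2_real -/P cjM cjR.
  have -> : s%:C * cj (inp f g) * inp f g = (s * P)%:C.
    by rewrite -mulrA [cj _ * _]mulrC -cabs2E -rmorphM.
  by move=> h; apply: le_trans h _; rewrite /=; lra.
have P0 : 0 <= P by exact: cabs2_ge0.
have := msq_ge0 f; have := msq_ge0 g; rewrite le_eqVlt => /predU1P[g0|g0] f0.
- rewrite -g0 mulr0; move: key; rewrite -g0 => key.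
  rewrite leNgt; apply/negP => Pgt.
  (* If [msq g] = 0 while P > 0, this s gives the expression in [key] the value -1. *)
  have := key ((msq f + 1) / (2 * P)); rewrite mulr0 addr0.
  have -> : 2 * ((msq f + 1) / (2 * P)) * P = msq f + 1 by field; rewrite gt_eqF.
  by lra.
- have := key (msq g)^-1.
  have -> : (msq g)^-1 ^+ 2 * P * msq g = (msq g)^-1 * P by field; rewrite gt_eqF.
  rewrite -mulrA => h.
  have {h} : (msq g)^-1 * P <= msq f by lra.
  by rewrite mulrC ler_pdivrMr.
Qed.

Lemma fourierE f n : fourier f n = avg (fun t => f t * expi (- (n%:~R) * t)).
Proof. by []. Qed.

Lemma fourier_inp f n : fourier f n = inp f (e_ n).
Proof. by rewrite fourierE /inp /e_; congr avg; apply/funext => t; rewrite expiJ mulNr. Qed.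

Lemma L2_e n : L2 (e_ n).
Proof.
apply/L2P; split; first exact: measC_expi.
by under eq_fun do rewrite cabs2_expi; exact: rint_cst.
Qed.

Lemma msq_e n : msq (e_ n) = 1.
Proof.
apply: (@complexI R); rewrite -inp_self -[RHS](avg_cst 1); congr avg.
by apply/funext => t; rewrite -cabs2E cabs2_expi.
Qed.

Lemma fourier_le f n : L2 f -> cabs2 (fourier f n) <= msq f.
Proof.
move=> hf; rewrite fourier_inp (le_trans (cauchy_schwarz hf (L2_e n)))//.
by rewrite msq_e mulr1.
Qed.

Lemma e_D m n t : e_ (m + n) t = e_ m t * e_ n t.
Proof. by rewrite /e_ intrD mulrDl expiD. Qed.

Lemma e_N n t : e_ (- n) t = cj (e_ n t).
Proof. by rewrite /e_ expiJ mulrNz mulNr. Qed.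

Lemma e_0 t : e_ 0 t = 1.
Proof. by rewrite /e_ mul0r expi0. Qed.

Lemma cabs2_e n t : cabs2 (e_ n t) = 1. Proof. exact: cabs2_expi. Qed.

(** For n <> 0 the antiderivatives sin(nx) / n and - cos(nx) / n take equal values at 0 and at 2
    pi. *)
Lemma avg_e n : avg (e_ n) = (n == 0)%:R.
Proof.
have [->|n0] := eqVneq n 0.
  by rewrite -[RHS](avg_cst 1); congr avg; apply/funext => t; rewrite e_0.
have nr : (n%:~R : R) != 0 by rewrite intr_eq0.
have ftc (F f : R -> R) : continuous f -> (forall x : R, is_derive x (1 : R) F (f x)) ->
    F 0 = F (2 * pi) -> Rintegral mu D f = 0.
  move=> cf dF F0; rewrite /Rintegral (@continuous_FTC2 _ f F) ?pi2_gt0//.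
  - by rewrite F0 subee.
  - exact: continuous_subspaceT.
  - have cF : continuous F.
      by move=> x; apply: differentiable_continuous; apply/derivable1_diffP.
    split; first by move=> x _.
    + by apply: cvg_at_right_filter; exact: cF.
    + by apply: cvg_at_left_filter; exact: cF.
  - by move=> x _; rewrite derive1E; apply: derive_val.
have [c2 s2] : cos (n%:~R * (2 * pi) : R) = 1 /\ sin (n%:~R * (2 * pi) : R) = 0.
  by have [] := expi_2pi R n.
have dlin (x : R) : is_derive x (1 : R) (fun y : R => n%:~R * y) (n%:~R : R).
  have := @is_deriveZ _ _ _ (@id R) (n%:~R : R) x 1 1 (is_derive_id x 1).
  by rewrite /GRing.scale /= mulr1.
have nI (x : R) : (n%:~R)^-1 * (x * n%:~R) = x by rewrite mulrCA mulVf// mulr1.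
apply: complex_ext => /=.
- have -> : Rintegral mu D (fun t => complex.Re (e_ n t)) = 0; last by rewrite mulr0.
  apply: (ftc (fun x => (n%:~R)^-1 * sin (n%:~R * x))).
  + move=> x; apply: continuous_comp; last exact: continuous_cos.
    exact: mulrl_continuous.
  + move=> x.
    have h := is_derive1_comp (is_derive_sin (n%:~R * x)) (dlin x).
    have := is_deriveZ (n%:~R)^-1 h; rewrite /GRing.scale /= nI; exact: id.
  + by rewrite mulr0 sin0 s2.
- have -> : Rintegral mu D (fun t => complex.Im (e_ n t)) = 0; last by rewrite mulr0.
  apply: (ftc (fun x => - (n%:~R)^-1 * cos (n%:~R * x))).
  + move=> x; apply: continuous_comp; last exact: continuous_sin.
    exact: mulrl_continuous.
  + move=> x.
    have h := is_derive1_comp (is_derive_cos (n%:~R * x)) (dlin x).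
    have := is_deriveZ (- (n%:~R)^-1) h; rewrite /GRing.scale /= mulNr mulNr mulrN opprK nI; exact: id.
  + by rewrite mulr0 cos0 c2.
Qed.

End ComplexIntegrals.

(** * Completeness of L^2 *)

Section Completeness.
Variable R : realType.
Local Notation mu := (@lebesgue_measure R).
Local Notation D := (@Tdom R).
Local Hint Extern 0 (measurable _) => solve [exact: mD] : core.
Implicit Types (f g h : R -> R[i]) (c : R[i]).

Lemma geom_pow_cvg (C r : R) : 0 <= r < 1 -> (fun n => C * r ^+ n) @ \oo --> (0 : R).
Proof.
by move=> /andP[r0 r1]; have := @cvg_geometric _ C r; rewrite ger0_norm//; apply.
Qed.

Lemma half01 : 0 <= (2^-1 : R) < 1.
Proof. by apply/andP; split; lra. Qed.

Lemma half_pow_cvg (C : R) : (fun n => C / 2 ^+ n) @ \oo --> (0 : R).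
Proof.
under eq_fun do rewrite -exprVn.
by apply: geom_pow_cvg; exact: half01.
Qed.

(** With q_n = C r^n / (1 - r), the tail of the geometric series, u + q is nonincreasing and u - q
    nondecreasing; trapped between them, u has a limit, and the rate comes with it. *)
Lemma geom_cvg (u : nat -> R) (C r : R) : 0 <= r < 1 ->
  (forall n, `|u n.+1 - u n| <= C * r ^+ n) ->
  exists2 l, u @ \oo --> l & forall n, `|u n - l| <= C / (1 - r) * r ^+ n.
Proof.
move=> r01 h; case/andP: (r01) => r0 r1.
have r1' : 0 < 1 - r by rewrite subr_gt0.
pose q n := C / (1 - r) * r ^+ n : R.
have qS n : q n - q n.+1 = C * r ^+ n.
  by rewrite /q exprS; field; rewrite gt_eqF.
have C0 : 0 <= C by have := le_trans (normr_ge0 _) (h 0%N); rewrite expr0 mulr1.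
have q0 n : 0 <= q n by rewrite /q !mulr_ge0// ?exprn_ge0// invr_ge0 ltW.
have vd : nonincreasing_seq (fun n => u n + q n).
  apply/nonincreasing_seqP => n; have := h n; rewrite -qS ler_norml => /andP[_]; lra.
have wi : nondecreasing_seq (fun n => u n - q n).
  apply/nondecreasing_seqP => n; have := h n; rewrite -qS ler_norml => /andP[+ _]; lra.
have wv m n : u m - q m <= u n + q n.
  have h1 := wi _ _ (leq_maxl m n); have h2 := vd _ _ (leq_maxr m n).
  by have := q0 (maxn m n); rewrite /= in h1 h2; lra.
have cv : cvgn (fun n => u n + q n).
  apply: nonincreasing_is_cvgn => //; exists (u 0%N - q 0%N) => _ [n _ <-]; exact: wv.
pose l := limn (fun n => u n + q n).
have lv n : l <= u n + q n by exact: nonincreasing_cvgn_ge.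
have wl n : u n - q n <= l.
  by apply: limr_ge => //; apply: nearW => m; exact: wv.
have ul n : `|u n - l| <= q n.
  by rewrite ler_norml; have := lv n; have := wl n; move=> ? ?; apply/andP; split; lra.
exists l; last exact: ul.
have qc : q @ \oo --> (0 : R) by exact: geom_pow_cvg.
apply/cvgrPdist_le => e e0; have /cvgrPdist_le /(_ e e0) := qc.
apply: filterS => n; rewrite sub0r normrN ger0_norm// distrC.
exact: le_trans.
Qed.

Lemma sqr_le_norm (x q : R) : `|x| <= q -> x ^+ 2 <= q ^+ 2.
Proof.
move=> h; rewrite -(@real_normK _ x) ?num_real// lerXn2r// nnegrE//.
exact: le_trans h.
Qed.

Definition cvgL2 (f : nat -> R -> R[i]) g :=
  (fun n => msq (fun t => f n t - g t)) @ \oo --> (0 : R).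

(** The majorant is the sum of the series itself: its integral is at most the sum of the 2 pi / 2^n,
    so it is finite almost everywhere. *)
Lemma dominating_series (d : nat -> R -> R) :
  (forall n, rint (d n)) -> (forall n t, 0 <= d n t) ->
  (forall n, Rintegral mu D (d n) <= (2 * pi) / 2 ^+ n) ->
  exists2 S : R -> R, rint S & aeT (fun t => forall n, d n t <= S t).
Proof.
move=> rd d0 dle.
pose E t := (\sum_(0 <= n <oo) (d n t)%:E)%E.
have E0 t : (0 <= E t)%E by apply: nneseries_ge0 => n _ _; rewrite lee_fin.
have mE : measurable_fun D E.
  apply: (@ge0_emeasurable_sum _ _ _ _ (fun n t => (d n t)%:E)) => [n t _ _|n _].
    by rewrite lee_fin.
  by apply/measurable_EFinP; exact: rint_meas.
have IE : (\int[mu]_(t in D) E t < +oo)%E.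
  rewrite integral_nneseries//; last 2 first.
  - by move=> n; apply/measurable_EFinP; exact: rint_meas.
  - by move=> n t _; rewrite lee_fin.
  have le n : (\int[mu]_(t in D) (d n t)%:E <= ((4 * pi) / (2 ^ (n + 1))%:R)%:E)%E.
    rewrite -[X in (X <= _)%E]fineK; last by apply: integrable_fin_num => //; exact: rd.
    rewrite lee_fin (le_trans (dle n))// le_eqVlt; apply/orP; left; apply/eqP.
    by rewrite natrX addn1 exprS; field; rewrite expf_neq0.
  apply: (@le_lt_trans _ _ (\sum_(0 <= n <oo) ((4 * pi) / (2 ^ (n + 1))%:R)%:E)%E).
    by apply: lee_nneseries => n _ //; rewrite integral_ge0// => t _; rewrite lee_fin.
  have := @cvg_geometric_eseries_half R (4 * pi) 0; move/cvg_lim => -> //.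
  exact: ltry.
have iE : mu.-integrable D E.
  apply/integrableP; split => //.
  by under eq_integral do rewrite gee0_abs//.
have fE := integrable_ae (@mD R) iE.
(* [fine] returns 0 where the sum is infinite, which happens only on a null set. *)
exists (fun t => fine (E t)).
  apply: (le_integrable _ _ _ iE) => //.
    by apply/measurable_EFinP; apply: measurableT_comp => //; exact: fine_measurable.
  by move=> t _ /=; case: (E t) => [r| |] //=; rewrite normr0 leey.
apply/aeT_ae; apply: (@filterS _ _ (ae_filter_ringOfSetsType mu)) fE => t h Dt n.
rewrite -lee_fin fineK ?h//.
have := @nneseries_lim_ge R (fun n => (d n t)%:E) xpredT 0 n.+1.
move=> /(_ (fun k _ _ => d0 k t)).
apply: le_trans; rewrite big_nat_recr//= leeDr// sume_ge0// => k _.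
by rewrite lee_fin.
Qed.

(** The rate 8^-n is shared out: weighted by 4^n, the squared increments still have integrals at
    most 2 pi / 2^n, so they have a majorant S finite almost everywhere, and at such a point the
    increments are at most sqrt(1 + S) / 2^n, a geometric sequence. *)
Lemma L2_fast (f : nat -> R -> R[i]) : (forall n, L2 (f n)) ->
  (forall n, msq (fun t => f n.+1 t - f n t) <= (8 ^+ n)^-1) ->
  exists g, [/\ L2 g, cvgL2 f g & aeT (fun t => cvgC (fun n => f n t) (g t))].
Proof.
move=> hf hd.
pose d n t := 4 ^+ n * cabs2 (f n.+1 t - f n t).
have rdf n : rint (fun t => cabs2 (f n.+1 t - f n t)).
  by have /L2P[] := L2B (hf n.+1) (hf n).
have p2 := @pi2_gt0 R.
have [S rS dS] : exists2 S : R -> R, rint S & aeT (fun t => forall n, d n t <= S t).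
  apply: dominating_series => [n|n t|n].
  - exact: rintZ.
  - by rewrite mulr_ge0// ?exprn_ge0// cabs2_ge0.
  - rewrite RintegralZl//; last exact: rdf.
    have := hd n; rewrite /msq ler_pdivrMl// => h.
    rewrite (le_trans (ler_wpM2l _ h)) ?exprn_ge0//.
    rewrite [4 ^+ n * _]mulrCA ler_pM2l//.
    rewrite (_ : (8 : R) = 4 * 2) ?exprMn; last by rewrite -natrM.
    by rewrite invfM mulrA divff ?expf_neq0// mul1r.
have geo t : (forall n, d n t <= S t) -> forall n,
    cabs2 (f n.+1 t - f n t) <= (Num.sqrt (1 + S t) / 2 ^+ n) ^+ 2.
  move=> h n; have := h n; rewrite /d => hn.
  have S0 : 0 <= S t by apply: le_trans (h 0%N); rewrite mulr_ge0// cabs2_ge0.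
  rewrite expr_div_n sqr_sqrtr ?addr_ge0 ?ler01// -[(2 ^+ n) ^+ 2]exprM mulnC exprM (_ : 2 ^+ 2 = 4 :> R); last by rewrite -natrX.
  rewrite ler_pdivlMr ?exprn_gt0// mulrC (le_trans hn)// lerDr ler01 //.
have onem_half (x y : R) : x / (1 - 2^-1) * y = 2 * x * y by field; lra.
have limf t : (forall n, d n t <= S t) -> exists w : R[i],
    cvgC (fun n => f n t) w /\
    forall n, cabs2 (f n t - w) <= 8 * (1 + S t) / 4 ^+ n.
  move=> h; have g := geo _ h.
  have S0 : 0 <= S t by apply: le_trans (h 0%N); rewrite mulr_ge0// cabs2_ge0.
  have K0 n : 0 <= Num.sqrt (1 + S t) / 2 ^+ n by rewrite divr_ge0 ?exprn_ge0// sqrtr_ge0.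
  have [n|x xc xb] := @geom_cvg (fun n => complex.Re (f n t)) (Num.sqrt (1 + S t)) 2^-1 half01.
    rewrite exprVn.
    rewrite -ler_sqr ?nnegrE// real_normK ?num_real// -Re_opp -Re_add.
    by rewrite (le_trans (sqr_Re_le _)).
  have [n|y yc yb] := @geom_cvg (fun n => complex.Im (f n t)) (Num.sqrt (1 + S t)) 2^-1 half01.
    rewrite exprVn.
    rewrite -ler_sqr ?nnegrE// real_normK ?num_real// -Im_opp -Im_add.
    by rewrite (le_trans (sqr_Im_le _)).
  exists (x +i* y); split => // n.
  (* Real and imaginary part each err by at most 2 sqrt(1 + S) / 2^n; adding the two squares gives
     the 8. *)
  have -> : 8 * (1 + S t) / 4 ^+ n = 2 * (2 * Num.sqrt (1 + S t) / 2 ^+ n) ^+ 2.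
    rewrite expr_div_n exprMn sqr_sqrtr ?addr_ge0// -[(2 ^+ n) ^+ 2]exprM mulnC exprM.
    by rewrite (_ : 2 ^+ 2 = 4 :> R) ?mulrA -?natrM// -natrX.
  rewrite /cabs2 !ReImE /= mulr_natl mulr2n lerD//.
    by apply: sqr_le_norm; have := xb n; rewrite exprVn onem_half; apply.
  by apply: sqr_le_norm; have := yb n; rewrite exprVn onem_half; apply.
(* The upper limit is defined for every sequence and depends measurably on the point; it agrees with
   the limit wherever the latter exists. *)
pose L (u : nat -> R) := fine (limn_esup (fun n => (u n)%:E)).
have LE (u : nat -> R) l : u @ \oo --> l -> L u = l.
  move=> ul; have el : (fun n => (u n)%:E) @ \oo --> l%:E by exact: cvg_EFin (nearW _ _) ul.
  rewrite /L is_cvg_limn_esupE; last by apply/cvg_ex; exists l%:E.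
  by rewrite (cvg_lim _ el).
have mL (u : nat -> R -> R) : (forall n, measurable_fun D (u n)) ->
    measurable_fun D (fun t => L (fun n => u n t)).
  move=> mu_; apply: measurableT_comp; first exact: fine_measurable.
  by apply: (@measurable_fun_limn_esup _ _ _ _ (fun n t => (u n t)%:E)) => n;
     apply/measurable_EFinP.
pose g t := L (fun n => complex.Re (f n t)) +i* L (fun n => complex.Im (f n t)).
have gE t w : cvgC (fun n => f n t) w -> g t = w.
  by case: w => x y [/= /LE h1 /LE h2]; rewrite /g h1 h2.
have mg : measC g by split; apply: mL => n; have [[? ?] _] := hf n.
have ge : aeT (fun t => cvgC (fun n => f n t) (g t) /\
    forall n, cabs2 (f n t - g t) <= 8 * (1 + S t) / 4 ^+ n).
  by apply: filterS dS => t /limf[w [h1 h2]]; rewrite (gE _ _ h1).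
have rS1 : rint (fun t => 1 + S t) by apply: rintD => //; exact: rint_cst.
have S1 : aeT (fun t => 0 <= S t).
  by apply: filterS dS => t h; apply: le_trans (h 0%N); rewrite mulr_ge0// cabs2_ge0.
have bnd n : rint (fun t => cabs2 (f n t - g t)) /\
    Rintegral mu D (fun t => cabs2 (f n t - g t)) <=
    (8 * Rintegral mu D (fun t => `|1 + S t|)) / 4 ^+ n.
  have mfg : measC (fun t => f n t - g t).
    by apply: measCD; [have [] := hf n|exact: measCN].
  have [||||r le1] := @rint_ae_le _ _ (fun t => (8 / 4 ^+ n) * `|1 + S t|) (measurable_cabs2 mfg).
  - by apply: rintZ; exact: rint_norm.
  - by move=> t; exact: cabs2_ge0.
  - by move=> t; rewrite mulr_ge0// divr_ge0// exprn_ge0.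
  - apply: filterS2 ge S1 => t [_ /(_ n) h] S0.
    by rewrite ger0_norm ?addr_ge0// mulrAC.
  split => //; move: le1; rewrite RintegralZl//; last exact: rint_norm.
  by rewrite mulrAC.
have L2g : L2 g.
  have h : L2 (fun t => f 0%N t - g t).
    apply/L2P; split; last by have [] := bnd 0%N.
    by apply: measCD; [have [] := hf 0%N|exact: measCN].
  have := L2B (hf 0%N) h; congr L2; apply/funext => t; by rewrite opprB addrC subrK.
exists g; split => //; last by apply: filterS ge => t [].
rewrite /cvgL2.
pose B := (2 * pi)^-1 * (8 * Rintegral mu D (fun t => `|1 + S t|)).
apply: (@squeeze_cvgr _ _ _ _ (fun=> 0) (fun n => B / 2 ^+ n)).
- apply: nearW => n; rewrite msq_ge0 /= /msq /B -mulrA ler_pM2l ?invr_gt0//.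
  have [_ h] := bnd n; rewrite (le_trans h)// ler_wpM2l//.
    by rewrite mulr_ge0// Rintegral_ge0.
  rewrite lef_pV2 ?posrE ?exprn_gt0// lerXn2r ?nnegrE// ler_nat//.
- exact: cvg_cst.
- exact: half_pow_cvg.
Qed.

Lemma L2_complete (f : nat -> R -> R[i]) : (forall n, L2 (f n)) ->
  (forall e, 0 < e -> exists N, forall m n, (N <= m)%N -> (N <= n)%N ->
     msq (fun t => f m t - f n t) <= e) ->
  exists g, L2 g /\ cvgL2 f g.
Proof.
move=> hf hC.
have /choice[N hN] : forall k, exists N, forall m n, (N <= m)%N -> (N <= n)%N ->
    msq (fun t => f m t - f n t) <= (8 ^+ k)^-1.
  by move=> k; apply: hC; rewrite invr_gt0 exprn_gt0.
(* Summing the thresholds makes the indices monotone while keeping [N k <= p k]. *)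
pose p k := (\sum_(i < k.+1) N i)%N.
have Np k : (N k <= p k)%N by rewrite /p big_ord_recr /= leq_addl.
have pS k : (p k <= p k.+1)%N by rewrite /p [leqRHS]big_ord_recr /= leq_addr.
have [g [L2g cg _]] := @L2_fast (fun k => f (p k)) (fun k => hf _)
   (fun k => hN k _ _ (leq_trans (Np k) (pS k)) (Np k)).
exists g; split => //.
apply/cvgrPdist_le => e e0.
have e4 : 0 < e / 4 by rewrite divr_gt0.
have [M hM] := hC _ e4.
have /cvgrPdist_le /(_ _ e4) [K _ hK] := cg.
have e8 : (fun n => 1 / 2 ^+ n) @ \oo --> (0 : R) by exact: half_pow_cvg.
have /cvgrPdist_le /(_ _ e4) [K2 _ hK2] := e8.
pose k := maxn K K2.
have hk : msq (fun t => f (p k) t - g t) <= e / 4.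
  by have := hK k (leq_maxl _ _); rewrite /= sub0r normrN ger0_norm ?msq_ge0.
have h8 : (8 ^+ k)^-1 <= e / 4.
  have := hK2 k (leq_maxr _ _); rewrite /= sub0r normrN ger0_norm ?mul1r ?invr_ge0 ?exprn_ge0//.
  apply: le_trans; rewrite lef_pV2 ?posrE ?exprn_gt0// lerXn2r ?nnegrE// ler_nat//.
exists (N k) => // n /= Nn; rewrite sub0r normrN ger0_norm ?msq_ge0//.
have -> : (fun t => f n t - g t) = (fun t => (f n t - f (p k) t) + (f (p k) t - g t)).
  by apply/funext => t; rewrite addrA subrK.
rewrite (le_trans (msqD_le _ _))//; [exact: L2B..|].
have := hN k n (p k) Nn (Np k); lra.
Qed.

Lemma cvgL2_uniq (f : nat -> R -> R[i]) g h : (forall n, L2 (f n)) -> L2 g -> L2 h ->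
  cvgL2 f g -> cvgL2 f h -> aeT (fun t => g t = h t).
Proof.
move=> hf hg hh cg ch.
have hgh := L2B hg hh.
suff : msq (fun t => g t - h t) = 0.
  by move=> /(msq0_ae hgh); apply: filterS => t /eqP; rewrite subr_eq0 => /eqP.
apply/eqP; rewrite eq_le msq_ge0 andbT.
have lim0 : (fun n => 2 * msq (fun t => f n t - g t) + 2 * msq (fun t => f n t - h t))
    @ \oo --> (0 : R).
  rewrite [X in _ --> X](_ : 0 = 2 * 0 + 2 * 0); last by rewrite mulr0 addr0.
  by apply: cvgD; apply: cvgMr.
rewrite -(cvg_lim _ lim0)//; apply: limr_ge; first by apply/cvg_ex; exists 0.
apply: nearW => n; rewrite [2 * msq _]mulrC.
have -> : (fun t => g t - h t) = (fun t => - (f n t - g t) + (f n t - h t)).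
  by apply/funext => t; ring.
rewrite (le_trans (msqD_le _ _)) ?msqN ?[_ * 2]mulrC//; [|exact: L2B].
by apply: L2N; exact: L2B.
Qed.

Lemma L1_fourier f n : L1 f -> L1 (fun t => f t * expi (- (n%:~R) * t)).
Proof.
move=> hf; have := @L1_bdd _ (fun t => expi (- (n%:~R) * t)) f 1 (measC_expi _) _ hf.
by under eq_fun do rewrite mulrC; apply => t; rewrite cabs2_expi.
Qed.

Lemma fourierD f g n : L1 f -> L1 g ->
  fourier (fun t => f t + g t) n = fourier f n + fourier g n.
Proof.
move=> hf hg; rewrite !fourierE -avgD; [|exact: L1_fourier..].
by congr avg; apply/funext => t; rewrite mulrDl.
Qed.

Lemma fourierB f g n : L1 f -> L1 g ->
  fourier (fun t => f t - g t) n = fourier f n - fourier g n.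
Proof.
move=> hf hg; rewrite !fourierE -avgB; [|exact: L1_fourier..].
by congr avg; apply/funext => t; rewrite mulrBl.
Qed.

Lemma fourierZ c f n : L1 f -> fourier (fun t => c * f t) n = c * fourier f n.
Proof.
move=> hf; rewrite !fourierE -avgZ; last exact: L1_fourier.
by congr avg; apply/funext => t; rewrite mulrA.
Qed.

Lemma fourierJ f n : L1 f -> fourier (fun t => cj (f t)) n = cj (fourier f (- n)).
Proof.
move=> hf; rewrite !fourierE -avgJ; last exact: L1_fourier.
by congr avg; apply/funext => t; rewrite cjM expiJ mulrNz opprK mulNr.
Qed.

Lemma fourier_shift f m n : fourier (fun t => e_ m t * f t) n = fourier f (n - m).
Proof.
rewrite !fourierE; congr avg; apply/funext => t.
by rewrite [e_ _ _ * _]mulrC -mulrA -expiD -mulrDl -!mulrNz -intrD opprB addrC.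
Qed.

Lemma fourier_ae f g n : measC f -> measC g -> aeT (fun t => f t = g t) ->
  fourier f n = fourier g n.
Proof.
move=> mf mg fg; rewrite !fourierE; apply: avg_ae.
- by apply: measCM => //; exact: measC_expi.
- by apply: measCM => //; exact: measC_expi.
- by apply: filterS fg => t ->.
Qed.

Lemma fourier_e m n : fourier (@e_ R m) n = (m == n)%:R.
Proof.
rewrite fourierE -subr_eq0 -[RHS](@avg_e R); congr avg; apply/funext => t.
by rewrite e_D e_N /e_ expiJ mulNr.
Qed.

Lemma fourier_cst c n : fourier (fun=> c) n = if n == 0 then c else 0.
Proof.
have -> : (fun=> c) = (fun t => c * e_ 0 t) by apply/funext => t; rewrite e_0 mulr1.
rewrite fourierZ; last by apply: L2_L1; exact: L2_e.
by rewrite fourier_e eq_sym; case: eqP; rewrite ?mulr1 ?mulr0.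
Qed.

(** A coefficient is bounded by the norm, hence continuous in L^2. *)
Lemma cvgL2_fourier (f : nat -> R -> R[i]) g k c : (forall n, L2 (f n)) -> L2 g ->
  cvgL2 f g -> (\forall n \near \oo, fourier (f n) k = c) -> fourier g k = c.
Proof.
move=> hf hg fg fc.
apply/eqP; rewrite eq_sym -subr_eq0 -cabs2_eq0 eq_le cabs2_ge0 andbT.
rewrite -(cvg_lim _ fg)//; apply: limr_ge; first by apply/cvg_ex; exists 0.
apply: filterS fc => n <-.
rewrite -fourierB; [|exact: L2_L1..].
by apply: fourier_le; exact: L2B.
Qed.

Lemma fourier_sum I (l : seq I) (F : I -> R -> R[i]) n : (forall i, L1 (F i)) ->
  L1 (fun t => \sum_(i <- l) F i t) /\
  fourier (fun t => \sum_(i <- l) F i t) n = \sum_(i <- l) fourier (F i) n.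
Proof.
move=> hF; elim: l => [|i l [IH1 IH2]].
  under eq_fun do rewrite big_nil; rewrite big_nil; split; first exact: L1_cst.
  by rewrite fourier_cst if_same.
under eq_fun do rewrite big_cons; split; first exact: L1D.
by rewrite fourierD// big_cons IH2.
Qed.

Lemma L2_sum I (l : seq I) (F : I -> R -> R[i]) : (forall i, L2 (F i)) ->
  L2 (fun t => \sum_(i <- l) F i t).
Proof.
move=> hF; elim: l => [|i l IH].
  by under eq_fun do rewrite big_nil; exact: L2_cst.
by under eq_fun do rewrite big_cons; exact: L2D.
Qed.

End Completeness.

(** * Uniqueness of Fourier coefficients *)

Section FourierUniqueness.
Variable R : realType.
Local Notation mu := (@lebesgue_measure R).
Local Notation D := (@Tdom R).
Local Hint Extern 0 (measurable _) => solve [exact: mD] : core.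

Lemma bernoulli_lower (x : R) m : 0 <= x <= 1 -> 1 - m%:R * x <= (1 - x) ^+ m.
Proof.
move=> /andP[x0 x1]; elim: m => [|m IH]; first by rewrite mul0r subr0 expr0.
rewrite exprS -natr1; have m0 : 0 <= m%:R :> R by [].
have : (1 - x) * (1 - m%:R * x) <= (1 - x) * (1 - x) ^+ m by rewrite ler_wpM2l// subr_ge0.
by apply: le_trans; nra.
Qed.

Lemma bernoulli_upper (x : R) m : 0 <= x <= 1 -> (1 - x) ^+ m * (1 + m%:R * x) <= 1.
Proof.
move=> /andP[x0 x1]; elim: m => [|m IH]; first by rewrite mul0r addr0 mulr1.
apply: le_trans IH; rewrite exprSr -mulrA ler_wpM2l ?exprn_ge0 ?subr_ge0//.
rewrite -natr1; have m0 : 0 <= m%:R :> R by [].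
nra.
Qed.

(* A sequence of polynomials converging boundedly to the indicator of [0, 1/2[ on [0, 1]. *)
Definition step_pol (n : nat) (s : R) : R := (1 - s ^+ n) ^+ (2 ^ n).

Lemma step_pol_itv n s : 0 <= s <= 1 -> 0 <= step_pol n s <= 1.
Proof.
move=> /andP[s0 s1]; have s01 : 0 <= s ^+ n <= 1 by rewrite exprn_ge0//= exprn_ile1.
case/andP: s01 => h0 h1.
by rewrite exprn_ge0 ?subr_ge0//= exprn_ile1 ?subr_ge0// gerBl.
Qed.

(** Bernoulli's inequality with exponent 2^n bounds the value below by 1 - (2 s)^n. *)
Lemma step_pol_lt s : 0 <= s <= 1 -> s < 2^-1 -> (fun n => step_pol n s) @ \oo --> (1 : R).
Proof.
move=> s01 sh; case/andP: (s01) => s0 s1.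
apply: (@squeeze_cvgr _ _ _ _ (fun n => 1 - (2 * s) ^+ n) (fun=> 1)).
- apply: nearW => n; have /andP[_ ->] := step_pol_itv n s01; rewrite andbT.
  have := @bernoulli_lower (s ^+ n) (2 ^ n); rewrite exprn_ge0//= exprn_ile1//.
  by rewrite natrX -exprMn; apply.
- rewrite -[X in _ --> X]subr0; apply: cvgB; first exact: cvg_cst.
  by apply: cvg_expr; rewrite ger0_norm ?mulr_ge0//; lra.
- exact: cvg_cst.
Qed.

(** The inequality (1 - x)^m (1 + m x) <= 1 with x = s^n and m = 2^n bounds the value above by (2
    s)^-n. *)
Lemma step_pol_gt s : 0 <= s <= 1 -> 2^-1 < s -> (fun n => step_pol n s) @ \oo --> (0 : R).
Proof.
move=> s01 sh; case/andP: (s01) => s0 s1.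
have s2 : 1 < 2 * s by lra.
apply: (@squeeze_cvgr _ _ _ _ (fun=> 0) (fun n => ((2 * s)^-1) ^+ n)).
- apply: nearW => n; have /andP[-> _] := step_pol_itv n s01; rewrite /=.
  have := @bernoulli_upper (s ^+ n) (2 ^ n); rewrite exprn_ge0//= exprn_ile1//.
  rewrite natrX -exprMn -/(step_pol n s) => /(_ isT) h.
  have p0 : 0 < (2 * s) ^+ n by rewrite exprn_gt0//; lra.
  rewrite exprVn -[X in _ <= X]mul1r ler_pdivlMr//.
  by have /andP[? _] := step_pol_itv n s01; nra.
- exact: cvg_cst.
- apply: cvg_expr; rewrite ger0_norm ?invr_ge0 ?invf_lt1//; lra.
Qed.

Definition trig (p : R -> R[i]) :=
  exists l : seq (int * R[i]), forall t, p t = \sum_(x <- l) x.2 * e_ x.1 t.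

Lemma trig_e c n : trig (fun t => c * e_ n t).
Proof. by exists [:: (n, c)] => t; rewrite big_seq1. Qed.

Lemma trigD p q : trig p -> trig q -> trig (fun t => p t + q t).
Proof. by move=> [l hl] [k hk]; exists (l ++ k) => t; rewrite big_cat /= hl hk. Qed.

Lemma trig_cst c : trig (fun=> c).
Proof. by exists [:: (0, c)] => t; rewrite big_seq1 /= e_0 mulr1. Qed.

Lemma trigM p q : trig p -> trig q -> trig (fun t => p t * q t).
Proof.
move=> [l hl] [k hk].
have -> : p = fun t => \sum_(x <- l) x.2 * e_ x.1 t by exact/funext.
elim: l {p hl} => [|x l IH].
  by exists [::] => t; rewrite !big_nil mul0r.
under eq_fun do rewrite big_cons mulrDl; apply: trigD => //.
exists [seq (x.1 + y.1, x.2 * y.2) | y <- k] => t.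
rewrite hk big_map mulr_sumr; apply: eq_bigr => y _ /=.
by rewrite e_D; ring.
Qed.

Lemma trigX p n : trig p -> trig (fun t => p t ^+ n).
Proof.
move=> hp; elim: n => [|n IH].
  by under eq_fun do rewrite expr0; exact: trig_cst.
by under eq_fun do rewrite exprS; exact: trigM.
Qed.

Lemma measC_trig p : trig p -> measC p.
Proof.
move=> [l hl]; have -> : p = fun t => \sum_(x <- l) x.2 * e_ x.1 t by exact/funext.
apply: L2_meas; apply: (@L2_sum _ _ _ (fun x t => x.2 * e_ x.1 t)) => x.
by apply: L2Z; exact: L2_e.
Qed.

Lemma avg_trig (f p : R -> R[i]) : L1 f -> (forall n, fourier f n = 0) -> trig p ->
  L1 (fun t => p t * f t) /\ avg (fun t => p t * f t) = 0.
Proof.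
move=> hf f0 [l hl].
have -> : p = fun t => \sum_(x <- l) x.2 * e_ x.1 t by exact/funext.
elim: l {p hl} => [|x l [IH1 IH2]].
  under eq_fun do rewrite big_nil mul0r.
  by split; [exact: L1_cst|exact: avg_cst].
have h1 : L1 (fun t => x.2 * (e_ x.1 t * f t)).
  apply: L1Z; apply: (@L1_bdd _ _ _ 1) => //; first by apply: L2_meas; exact: L2_e.
  by move=> t; rewrite cabs2_e.
under eq_fun do rewrite big_cons mulrDl -mulrA; split; first exact: L1D.
rewrite avgD// IH2 addr0 avgZ; last first.
  apply: (@L1_bdd _ _ _ 1) => //; first by apply: L2_meas; exact: L2_e.
  by move=> t; rewrite cabs2_e.
have := f0 (- x.1); rewrite fourierE => h.
rewrite -[RHS](mulr0 x.2) -[in RHS]h; congr (_ * avg _); apply/funext => t.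
by rewrite mulrC /e_ mulrNz opprK.
Qed.

(** A trigonometric polynomial with values in [0, 1], below 1/2 exactly on the half circle sin(t +
    a) > 0; composing it with [step_pol] gives trigonometric polynomials that tend to the indicator
    of this half circle. *)
Definition sinA (a t : R) : R := (1 - sin (t + a)) / 2.

Lemma trig_sinA a : trig (fun t => (sinA a t)%:C).
Proof.
have -> : (fun t => (sinA a t)%:C) = (fun t => 2^-1 +
   ((4^-1 * 'i%C * expi a) * e_ 1 t + (- 4^-1 * 'i%C * expi (- a)) * e_ (-1) t)).
  apply/funext => t; rewrite /e_ !mulrNz mulr1z mul1r mulN1r -!mulrA -!expiD.
  have r2 : (2^-1 : R[i]) = (2^-1)%:C by rewrite fmorphV rmorph_nat.
  have r4 : (4^-1 : R[i]) = (4^-1)%:C by rewrite fmorphV rmorph_nat.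
  rewrite r2 r4 /sinA -opprD /expi cosN sinN [a + t]addrC.
  by apply: complex_ext; rewrite !ReImE /=; field.
by apply: trigD; [exact: trig_cst|apply: trigD; exact: trig_e].
Qed.

Lemma sinA_itv a t : 0 <= sinA a t <= 1.
Proof.
rewrite /sinA; have := sin_max (t + a); rewrite ler_norml => /andP[? ?].
by apply/andP; split; lra.
Qed.

Lemma sinA_lt a t : (sinA a t < 2^-1) = (0 < sin (t + a)).
Proof. by rewrite /sinA; apply/idP/idP => ?; lra. Qed.

Lemma sinA_gt a t : (2^-1 < sinA a t) = (sin (t + a) < 0).
Proof. by rewrite /sinA; apply/idP/idP => ?; lra. Qed.

(* Converges boundedly to the indicator of the intersection of two half circles. *)
Definition arc_pol (a b : R) n t : R := step_pol n (sinA a t) * step_pol n (sinA b t).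

Lemma trig_arc_pol a b n : trig (fun t => (arc_pol a b n t)%:C).
Proof.
have st c : trig (fun t => (step_pol n (sinA c t))%:C).
  have -> : (fun t => (step_pol n (sinA c t))%:C) =
      (fun t => (1 + (-1) * ((sinA c t)%:C ^+ n)) ^+ (2 ^ n)).
    by apply/funext => t; rewrite rmorphXn rmorphB rmorph1 rmorphXn mulN1r.
  apply: trigX; apply: trigD; first exact: trig_cst.
  by apply: trigM; [exact: trig_cst|apply: trigX; exact: trig_sinA].
have -> : (fun t => (arc_pol a b n t)%:C) =
   (fun t => (step_pol n (sinA a t))%:C * (step_pol n (sinA b t))%:C).
  by apply/funext => t; rewrite -rmorphM.
exact: trigM.
Qed.

Lemma arc_pol_itv a b n t : 0 <= arc_pol a b n t <= 1.
Proof.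
have /andP[h1 h2] := step_pol_itv n (sinA_itv a t).
have /andP[h3 h4] := step_pol_itv n (sinA_itv b t).
by rewrite /arc_pol mulr_ge0//= mulr_ile1.
Qed.

Lemma arc_pol_in a b t : 0 < sin (t + a) -> 0 < sin (t + b) ->
  (fun n => arc_pol a b n t) @ \oo --> (1 : R).
Proof.
rewrite -!sinA_lt => h1 h2; rewrite -[X in _ --> X]mulr1.
by apply: cvgM; apply: step_pol_lt => //; exact: sinA_itv.
Qed.

Lemma arc_pol_out a b t : sin (t + a) < 0 \/ sin (t + b) < 0 ->
  (fun n => arc_pol a b n t) @ \oo --> (0 : R).
Proof.
rewrite -!sinA_gt => h.
have [c hc le] : exists2 c, 2^-1 < sinA c t &
    forall n, arc_pol a b n t <= step_pol n (sinA c t).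
  case: h => h; [exists a|exists b] => // n; rewrite /arc_pol.
  - have /andP[h1 h2] := step_pol_itv n (sinA_itv a t).
    by have /andP[h3 h4] := step_pol_itv n (sinA_itv b t); rewrite ler_piMr.
  - have /andP[h1 h2] := step_pol_itv n (sinA_itv a t).
    by have /andP[h3 h4] := step_pol_itv n (sinA_itv b t); rewrite ler_piMl.
apply: (@squeeze_cvgr _ _ _ _ (fun=> 0) (fun n => step_pol n (sinA c t))).
- by apply: nearW => n; have /andP[-> _] := arc_pol_itv a b n t; rewrite /= le.
- exact: cvg_cst.
- by apply: step_pol_gt => //; exact: sinA_itv.
Qed.

Lemma aeT_neq (x : R) : aeT (fun t => t != x).
Proof.
exists [set x]; split => //; first exact: lebesgue_measure_set1.
by move=> t [_ /negP]; rewrite negbK => /eqP.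
Qed.

Lemma aeT_neq4 (x y z w : R) : aeT (fun t => D t /\ [/\ t != x, t != y, t != z & t != w]).
Proof.
have hD : aeT (fun t => D t) by exact: aeT_on.
have := aeTI hD (aeTI (aeTI (aeT_neq x) (aeT_neq y)) (aeTI (aeT_neq z) (aeT_neq w))).
by apply: filterS => t [? [[? ?] [? ?]]].
Qed.

(** Dominated convergence with majorant |f|. *)
Lemma bounded_limit (f : R -> R) (P : set R) (p : nat -> R -> R) : rint f ->
  measurable (P : set (measurableTypeR R)) ->
  (forall n, measurable_fun D (p n)) -> (forall n t, 0 <= p n t <= 1) ->
  (forall n, Rintegral mu D (fun t => p n t * f t) = 0) ->
  aeT (fun t => (fun n => p n t) @ \oo --> (\1_P t : R)) ->
  Rintegral mu D (f \_ P) = 0.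
Proof.
move=> rf mP mp p01 ip pc; have mf := rint_meas rf.
have [] := @dominated_convergence _ _ R mu D (@mD R)
  (fun n t => (p n t * f t)%:E) (fun t => ((f \_ P) t)%:E) (fun t => `|f t|%:E).
- by move=> n; apply/measurable_EFinP; apply: measurable_funM; [exact: mp|exact: mf].
- apply/measurable_EFinP.
  have -> : f \_ P = (fun t => \1_P t * f t).
    by apply/funext => t; rewrite patchE indicE; case: (t \in P); rewrite ?mul1r ?mul0r.
  by apply: measurable_funM => //; apply: measurable_indic.
- have := (aeT_ae _).1 pc; apply: (@filterS _ _ (ae_filter_ringOfSetsType mu)).
  move=> t h Dt; apply: cvg_EFin; first exact: nearW.
  have -> : (f \_ P) t = \1_P t * f t.
    by rewrite patchE indicE; case: (t \in P); rewrite ?mul1r ?mul0r.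
  by apply: cvgMl; exact: h.
- exact: rint_norm.
- apply: aeW => t n Dt; rewrite /= lee_fin normrM ger0_norm; last by have /andP[] := p01 n t.
  by rewrite ler_piMl//; have /andP[] := p01 n t.
move=> _ _; rewrite (_ : [sequence _]_n = fun=> 0%E); last first.
  apply/funext => n; rewrite -[LHS]fineK; last first.
    apply: integrable_fin_num => //; apply: (le_integrable _ _ _ (rint_norm rf)) => //.
      by apply/measurable_EFinP; apply: measurable_funM; [exact: mp|exact: mf].
    move=> t _ /=; rewrite lee_fin normr_id normrM ger0_norm; last by have /andP[] := p01 n t.
    by rewrite ler_piMl//; have /andP[] := p01 n t.
  by have := ip n; rewrite /Rintegral => ->.
move=> h; rewrite /Rintegral; have := cvg_lim (@ereal_hausdorff R) h.
by rewrite lim_cst// => <-.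
Qed.

(** Trigonometric polynomials tending to indicators of arcs show that the primitive F of f vanishes
    on (0, pi) and on (pi, 2 pi); by Lebesgue differentiation f = F' = 0 almost everywhere. *)
Lemma Rintegral_uniq (f : R -> R) : rint f ->
  (forall p : R -> R, trig (fun t => (p t)%:C) -> Rintegral mu D (fun t => p t * f t) = 0) ->
  aeT (fun t => f t = 0).
Proof.
move=> rf h0; have pi0 := @pi_gt0 R.
have mp p : trig (fun t => (p t)%:C) -> measurable_fun D p.
  by move=> /measC_trig[].
pose F x := Rintegral mu `]-oo, x] (f \_ D).
have FE x : F x = Rintegral mu D (f \_ `]-oo, x]).
  by rewrite /F -Rintegral_mkcondr setIC Rintegral_mkcondr.
have F_low x : 0 < x < pi -> F x = 0.
  move=> /andP[x0 xpi]; rewrite FE.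
  (* The half circles sin t > 0 and sin(t + pi - x) > 0 meet in the arc (0, x). *)
  apply: (@bounded_limit _ _ (arc_pol 0 (pi - x))) => //.
  - by move=> n; apply: mp; exact: trig_arc_pol.
  - exact: arc_pol_itv.
  - by move=> n; apply: h0; exact: trig_arc_pol.
  (* At these four points one of the sines vanishes, where [step_pol] is evaluated at 1/2 and the
     limit lemmas say nothing. *)
  - apply: filterS (aeT_neq4 0 x pi (2 * pi)) => t.
    rewrite /Tdom /= in_itv /= => -[/andP[t0 t2] [n0 nx np n2]].
    have tp : 0 < t by rewrite lt_neqAle eq_sym n0.
    have t2' : t < 2 * pi by rewrite lt_neqAle n2.
    rewrite indicE; case: (leP t x) => tx.
      rewrite mem_set /=; last by rewrite in_itv.
      have tx' : t < x by rewrite lt_neqAle nx.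
      by apply: arc_pol_in; apply: sin_gt0_pi; apply/andP; split; lra.
    rewrite memNset /=; last by rewrite in_itv /= => ?; lra.
    apply: arc_pol_out; have [tpi|tpi] := ltP t pi.
      right; have -> : t + (pi - x) = (t - x) + pi by ring.
      by rewrite sinDpi oppr_lt0; apply: sin_gt0_pi; apply/andP; split; lra.
    have tpi' : pi < t by rewrite lt_neqAle eq_sym np.
    left; rewrite addr0; have -> : t = (t - pi) + pi by rewrite subrK.
    by rewrite sinDpi oppr_lt0; apply: sin_gt0_pi; apply/andP; split; lra.
have sinNlt (u : R) : - pi < u < 0 -> sin u < 0.
  move=> /andP[u1 u2]; rewrite -[u]opprK sinN oppr_lt0; apply: sin_gt0_pi.
  by apply/andP; split; lra.
have F_high x : pi < x < 2 * pi -> F x = 0.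
  move=> /andP[x0 xpi]; rewrite FE.
  (* An arc (0, x) longer than a half circle is no intersection of two half circles, but its
     complement (x, 2 pi) is one. *)
  pose q n t := 1 - arc_pol (- pi) (- x) n t.
  have tq n : trig (fun t => (q n t)%:C).
    have -> : (fun t => (q n t)%:C) = fun t => 1 + (-1) * (arc_pol (- pi) (- x) n t)%:C.
      by apply/funext => t; rewrite /q rmorphB rmorph1 mulN1r.
    apply: trigD; first exact: trig_cst.
    by apply: trigM; [exact: trig_cst|exact: trig_arc_pol].
  apply: (@bounded_limit _ _ q) => //.
  - by move=> n; exact: mp.
  - by move=> n t; rewrite /q; have /andP[? ?] := arc_pol_itv (- pi) (- x) n t; apply/andP; split; lra.
  - by move=> n; exact: h0.
  - apply: filterS (aeT_neq4 0 x pi (2 * pi)) => t.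
    rewrite /Tdom /= in_itv /= => -[/andP[t0 t2] [n0 nx np n2]].
    have tp : 0 < t by rewrite lt_neqAle eq_sym n0.
    have t2' : t < 2 * pi by rewrite lt_neqAle n2.
    rewrite indicE /q; case: (leP t x) => tx.
      rewrite mem_set /=; last by rewrite in_itv.
      have tx' : t < x by rewrite lt_neqAle nx.
      rewrite -[X in _ --> X]subr0; apply: cvgB; first exact: cvg_cst.
      apply: arc_pol_out; have [tpi|tpi] := ltP t pi.
        by left; apply: sinNlt; apply/andP; split; lra.
      by right; apply: sinNlt; apply/andP; split; lra.
    rewrite memNset /=; last by rewrite in_itv /= => ?; lra.
    rewrite -[X in _ --> X](subrr (1 : R)); apply: cvgB; first exact: cvg_cst.
    by apply: arc_pol_in; apply: sin_gt0_pi; apply/andP; split; lra.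
have intf : mu.-integrable setT (EFin \o (f \_ D)).
  by rewrite -restrict_EFin; apply/(integrable_mkcond _ (@mD R)).1.
have intf' (y : R) : mu.-integrable `]-oo, y] (EFin \o (f \_ D)).
  by apply: integrableS intf => //; exact: measurable_itv.
have ftc := @FTC1Ny R (f \_ D) intf' (integrable_locally (@mD R) rf).
have {}ftc : aeT (fun t => derive1 F t = (f \_ D) t).
  apply/aeT_ae; apply: (@filterS _ _ (ae_filter_ringOfSetsType mu)) ftc => t h Dt.
  by case: h.
apply: filterS2 ftc (aeT_neq4 0 0 pi (2 * pi)) => t F't [Dt [n0 _ np n2]].
move: F't; rewrite patchE mem_set// => <-.
have Fn : \forall x \near t, F x = (cst 0 : R -> R) x.
  move: (Dt); rewrite /Tdom /= in_itv /= => /andP[t0 t2].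
  have tp : 0 < t by rewrite lt_neqAle eq_sym n0.
  have t2' : t < 2 * pi by rewrite lt_neqAle n2.
  have [tpi|tpi] := ltP t pi.
    near=> x; apply: F_low; apply/andP; split.
      by near: x; exact: lt_nbhsr.
    by near: x; exact: lt_nbhsl.
  have tpi' : pi < t by rewrite lt_neqAle eq_sym np.
  near=> x; apply: F_high; apply/andP; split.
    by near: x; exact: lt_nbhsr.
  by near: x; exact: lt_nbhsl.
rewrite derive1E (@near_eq_derive R R^o R^o _ _ t 1 Fn); exact: derive_cst.
Unshelve. all: by end_near. Qed.

(** Testing with real-valued polynomials separates the real from the imaginary part. *)
Lemma fourier_L1_uniq (f : R -> R[i]) : L1 f -> (forall n, fourier f n = 0) ->
  aeT (fun t => f t = 0).
Proof.
move=> hf f0; have [hr hi] := hf.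
have hp (p : R -> R) : trig (fun t => (p t)%:C) ->
    Rintegral mu D (fun t => p t * complex.Re (f t)) = 0 /\
    Rintegral mu D (fun t => p t * complex.Im (f t)) = 0.
  move=> hp; have [_] := avg_trig hf f0 hp.
  rewrite /avg => -[] /eqP; rewrite mulf_eq0 invr_eq0 (gt_eqF (@pi2_gt0 R)) => /eqP h1.
  move=> /eqP; rewrite mulf_eq0 invr_eq0 (gt_eqF (@pi2_gt0 R)) => /eqP h2.
  split; [rewrite -[RHS]h1|rewrite -[RHS]h2];
    by apply: eq_Rintegral => t _; rewrite ReImE /= mul0r ?subr0 ?addr0.
have h1 := @Rintegral_uniq _ hr (fun p hq => (hp p hq).1).
have h2 := @Rintegral_uniq _ hi (fun p hq => (hp p hq).2).
by apply: filterS2 h1 h2 => t e1 e2; apply: complex_ext; rewrite ?e1 ?e2.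
Qed.

End FourierUniqueness.

(** * Fourier series in L^2 *)

Section FourierSeries.
Variable R : realType.
Implicit Types (f g h : R -> R[i]) (c : nat -> R[i]) (m n k : int).

(** The enumeration 0, -1, 1, -2, 2, ... of the integers; it turns two-sided Fourier series into
    ordinary sequences of partial sums. *)
Definition znth (i : nat) : int := if odd i then Negz i./2 else Posz i./2.
Definition zidx (n : int) : nat := match n with Posz k => k.*2 | Negz k => k.*2.+1 end.

Lemma zidxK : cancel zidx znth.
Proof. by case=> k; rewrite /znth /= odd_double /= ?uphalf_double ?doubleK. Qed.

Lemma znthK : cancel znth zidx.
Proof.
move=> i; rewrite /znth; have := odd_double_half i; case: (odd i) => /= h; last by rewrite -[RHS]h.
by rewrite -[RHS]h.
Qed.

Definition tsum c (l : seq nat) : R -> R[i] := fun t => \sum_(i <- l) c i * e_ (znth i) t.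

Lemma L2_tsum c l : L2 (tsum c l).
Proof. by apply: (@L2_sum _ _ _ (fun i t => c i * e_ (znth i) t)) => i; apply: L2Z; exact: L2_e. Qed.

Lemma fourier_tsum c l n : uniq l ->
  fourier (tsum c l) n = if zidx n \in l then c (zidx n) else 0.
Proof.
move=> ul; rewrite /tsum.
have hL i : L1 (fun t => c i * @e_ R (znth i) t) by apply: L2_L1; apply: L2Z; exact: L2_e.
rewrite (fourier_sum l n hL).2.
have E i : fourier (fun t => c i * @e_ R (znth i) t) n = if i == zidx n then c i else 0.
  rewrite fourierZ; last by apply: L2_L1; exact: L2_e.
  rewrite fourier_e -(can_eq znthK i) zidxK.
  by case: eqP; rewrite ?mulr1 ?mulr0.
under eq_bigr do rewrite E.
rewrite -big_mkcond /=.
case: ifP => nl; first by rewrite -big_filter (filter_pred1_uniq ul nl) big_seq1.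
rewrite big_seq_cond big_pred0// => i; apply/negP => /andP[il /eqP e].
by rewrite -e il in nl.
Qed.

Lemma msqD_orth f g : L2 f -> L2 g -> inp f g = 0 ->
  msq (fun t => f t + g t) = msq f + msq g.
Proof.
move=> hf hg o; have := msqB hf (L2N hg); rewrite msqN.
have -> : inp f (fun t => - g t) = 0.
  have := inpZr (-1) hf hg; rewrite o mulr0 => <-; congr inp.
  by apply/funext => t; rewrite mulN1r.
by rewrite mulr0 subr0 => <-; congr msq; apply/funext => t; rewrite opprK.
Qed.

Lemma inp_e f n : L2 f -> inp (@e_ R n) f = cj (fourier f n).
Proof. by move=> hf; rewrite fourier_inp -inpJ//; exact: L2_e. Qed.

Lemma msq_tsum c l : uniq l -> msq (tsum c l) = \sum_(i <- l) cabs2 (c i).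
Proof.
elim: l => [_|i l IH /= /andP[il ul]].
  rewrite /tsum big_nil; under [X in msq X]eq_fun do rewrite big_nil.
  have := inp_self (fun _ : R => (0 : R[i])); rewrite /inp.
  under [X in avg X]eq_fun do rewrite mul0r.
  by rewrite avg_cst => -[] <-.
rewrite big_cons -IH// /tsum; under [X in msq X]eq_fun do rewrite big_cons.
have hl := L2_tsum c l.
rewrite msqD_orth//; last 2 first.
- by apply: L2Z; exact: L2_e.
- rewrite inpZl//; last exact: L2_e.
  by rewrite inp_e// fourier_tsum// znthK (negbTE il) cj0 mulr0.
by rewrite msqZ ?msq_e ?mulr1//; exact: L2_e.
Qed.

Lemma tsumB c (l k : nat) : (k <= l)%N ->
  (fun t => tsum c (iota 0 l) t - tsum c (iota 0 k) t) = tsum c (iota k (l - k)).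
Proof.
move=> kl; apply/funext => t; rewrite /tsum.
by rewrite -{1}(subnKC kl) iotaD big_cat /= add0n [LHS]addrC addKr.
Qed.

Lemma riesz_fischer c (M : R) : (forall N, \sum_(i <- iota 0 N) cabs2 (c i) <= M) ->
  exists g, [/\ L2 g, cvgL2 (fun N => tsum c (iota 0 N)) g &
     forall n, fourier g n = c (zidx n)].
Proof.
move=> bM.
pose s N := \sum_(i <- iota 0 N) cabs2 (c i).
have sS (k l : nat) : s (k + l)%N = s k + \sum_(i <- iota k l) cabs2 (c i).
  by rewrite /s iotaD big_cat.
have smono : nondecreasing_seq s.
  apply/nondecreasing_seqP => N; rewrite -addn1 sS lerDl.
  by apply: sumr_ge0 => i _; exact: cabs2_ge0.
have cs : cvgn s.
  by apply: nondecreasing_is_cvgn => //; exists M => _ [N _ <-]; exact: bM.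
have hL N : L2 (tsum c (iota 0 N)) by exact: L2_tsum.
have [|g [L2g cg]] := L2_complete hL.
  move=> e e0.
  have /cvgrPdist_le /(_ _ e0) [N _ hN] := cs.
  have sl N' : s N' <= limn s by exact: nondecreasing_cvgn_le.
  have key (k l : nat) : (N <= k)%N -> (k <= l)%N ->
      msq (fun t => tsum c (iota 0 l) t - tsum c (iota 0 k) t) <= e.
    move=> Nk kl; rewrite tsumB// msq_tsum ?iota_uniq//.
    have := sS k (l - k)%N; rewrite subnKC// => h.
    have := hN k Nk; rewrite /= ger0_norm ?subr_ge0//.
    have := sl l; rewrite h; lra.
  exists N => k l Nk Nl; have [kl|lk] := leqP k l; last exact: key (ltnW _).
  by rewrite msqBC; exact: key.
exists g; split => // n; apply: (cvgL2_fourier hL L2g cg).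
exists (zidx n).+1 => // N /= hN; rewrite fourier_tsum ?iota_uniq//.
by rewrite mem_iota /= add0n hN.
Qed.

Definition coefs f (i : nat) : R[i] := fourier f (znth i).

Lemma msq_tail f N : L2 f -> msq (fun t => f t - tsum (coefs f) (iota 0 N) t) =
  msq f - \sum_(i <- iota 0 N) cabs2 (coefs f i).
Proof.
move=> hf; have hT := L2_tsum (coefs f) (iota 0 N).
rewrite msqB// msq_tsum ?iota_uniq//.
suff -> : complex.Re (inp f (tsum (coefs f) (iota 0 N))) =
   \sum_(i <- iota 0 N) cabs2 (coefs f i) by ring.
rewrite inpJ// Re_conj; elim: (iota 0 N) => [|i l IH].
  rewrite big_nil /tsum; under [X in inp X]eq_fun do rewrite big_nil.
  by rewrite /inp; under [X in avg X]eq_fun do rewrite mul0r; rewrite avg_cst.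
rewrite big_cons /tsum; under [X in inp X]eq_fun do rewrite big_cons.
rewrite inpDl//; [|by apply: L2Z; exact: L2_e|exact: L2_tsum].
rewrite Re_add IH; congr (_ + _).
by rewrite inpZl//; [rewrite inp_e// Re_mulJ|exact: L2_e].
Qed.

Lemma bessel f N : L2 f -> \sum_(i <- iota 0 N) cabs2 (coefs f i) <= msq f.
Proof. by move=> hf; rewrite -subr_ge0 -msq_tail// msq_ge0. Qed.

(** Riesz-Fischer produces some limit having the coefficients of f; uniqueness of coefficients
    identifies it with f. *)
Lemma cvg_tsum f : L2 f -> cvgL2 (fun N => tsum (coefs f) (iota 0 N)) f.
Proof.
move=> hf; have [g [L2g cg fg]] := riesz_fischer (fun N => bessel N hf).
have hd := L2B L2g hf.
have gf : aeT (fun t => g t - f t = 0).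
  apply: fourier_L1_uniq; first exact: L2_L1.
  by move=> n; rewrite fourierB ?fg /coefs ?zidxK ?subrr//; exact: L2_L1.
rewrite /cvgL2 (_ : (fun N => _) = (fun N : nat => msq (fun t => tsum (coefs f) (iota 0 N) t - g t)))//.
apply/funext => N; have hT := L2_tsum (coefs f) (iota 0 N).
apply: msq_ae; [by apply: L2_meas; exact: L2B..|].
by apply: filterS gf => t /eqP; rewrite subr_eq0 => /eqP ->.
Qed.

Lemma parseval f : L2 f ->
  (fun N => \sum_(i <- iota 0 N) cabs2 (coefs f i)) @ \oo --> msq f.
Proof.
move=> hf; have h := cvg_tsum hf.
have -> : (fun N => \sum_(i <- iota 0 N) cabs2 (coefs f i)) =
   (fun N => msq f - msq (fun t => tsum (coefs f) (iota 0 N) t - f t)).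
  by apply/funext => N; rewrite msqBC msq_tail// opprB addrC subrK.
by rewrite -[X in _ --> X]subr0; apply: cvgB h; exact: cvg_cst.
Qed.

(** By Bessel's inequality the coefficients cut down to S are square summable, so Riesz-Fischer
    applies. *)
Lemma projection (S : pred int) f : L2 f -> exists g, [/\ L2 g,
  forall n, fourier g n = if S n then fourier f n else 0 & msq g <= msq f].
Proof.
move=> hf; pose c i := if S (znth i) then coefs f i else 0.
have cle i : cabs2 (c i) <= cabs2 (coefs f i).
  by rewrite /c; case: ifP => // _; rewrite cabs20 cabs2_ge0.
have [|g [L2g cg fg]] := @riesz_fischer c (msq f).
  by move=> N; rewrite (le_trans _ (bessel N hf))//; apply: ler_sum.
have fgE n : fourier g n = if S n then fourier f n else 0.
  by rewrite fg /c /coefs zidxK.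
exists g; split => //.
apply: (ler_cvg_to (parseval L2g) (parseval hf)); apply: nearW => N.
by apply: ler_sum => i _; rewrite {1}/coefs fgE; exact: cle.
Qed.

(** Only f is truncated: multiplying by a trigonometric polynomial shifts coefficients explicitly,
    and Cauchy-Schwarz controls the remainder although f g is merely integrable. *)
Lemma fourierM_limit f g (j : int) N : L2 f -> L2 g ->
  cabs2 (fourier (fun t => f t * g t) j -
    \sum_(i <- iota 0 N) coefs f i * fourier g (j - znth i)) <=
  msq (fun t => f t - tsum (coefs f) (iota 0 N) t) * msq g.
Proof.
move=> hf hg; set T := tsum _ _; have hT : L2 T by exact: L2_tsum.
have -> : \sum_(i <- iota 0 N) coefs f i * fourier g (j - znth i) =
    fourier (fun t => T t * g t) j.
  rewrite /T /tsum; under [X in _ = fourier X _]eq_fun do rewrite mulr_suml.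
  have hL i : L1 (fun t => coefs f i * e_ (znth i) t * g t).
    by apply: L2M => //; apply: L2Z; exact: L2_e.
  rewrite (fourier_sum _ _ hL).2; apply: eq_bigr => i _.
  under [X in _ = fourier X _]eq_fun do rewrite -mulrA.
  by rewrite fourierZ ?fourier_shift//; apply: L2M => //; exact: L2_e.
rewrite -fourierB; [|exact: L2M..].
pose h := fun t => cj (g t) * e_ j t.
have hh : L2 h.
  under [h]eq_fun do rewrite mulrC.
  apply: (@L2_bdd _ 1); [exact: measC_expi| |exact: L2J].
  by apply: aeT_on => t _; rewrite cabs2_e.
have -> : fourier (fun t => f t * g t - T t * g t) j = inp (fun t => f t - T t) h.
  rewrite fourierE; congr avg; apply/funext => t.
  by rewrite -mulrBl -mulrA /h cjM cjK /e_ expiJ mulNr.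
have hfT := L2B hf hT.
rewrite (le_trans (cauchy_schwarz hfT hh))// ler_wpM2l ?msq_ge0//.
rewrite -[leRHS]mul1r -(msqJ g) /h; under [X in msq X]eq_fun do rewrite mulrC.
apply: msq_bdd; [exact: measC_expi| |exact: L2J].
by apply: aeT_on => t _; rewrite cabs2_e.
Qed.

(** A single term of the convolution survives, so its partial sums are constant once the index of m
    is passed. *)
Lemma fourierM_single f g (j m : int) : L2 f -> L2 g ->
  (forall k, k != m -> fourier f k * fourier g (j - k) = 0) ->
  fourier (fun t => f t * g t) j = fourier f m * fourier g (j - m).
Proof.
move=> hf hg h0; apply/eqP; rewrite -subr_eq0 -cabs2_eq0 eq_le cabs2_ge0 andbT.
have lim0 : (fun N => msq (fun t => f t - tsum (coefs f) (iota 0 N) t) * msq g) @ \oo --> (0 : R).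
  rewrite -[X in _ --> X](mul0r (msq g)); apply: cvgMl.
  by have := cvg_tsum hf; rewrite /cvgL2; under eq_fun do rewrite msqBC.
rewrite -(cvg_lim _ lim0)//; apply: limr_ge; first by apply/cvg_ex; exists 0.
exists (zidx m).+1 => // N /= mN; have := fourierM_limit j N hf hg.
rewrite (bigD1_seq (zidx m)) ?iota_uniq ?mem_iota//= big1 ?addr0 /coefs ?zidxK// => i im.
by apply: h0; apply: contra_neq im => <-; rewrite znthK.
Qed.

End FourierSeries.

(** * Hardy spaces and the reciprocal of [a] *)

Lemma absz_znth_le (i : nat) : (`|znth i| <= i)%N.
Proof. by rewrite /znth; case: (odd i) (odd_double_half i) => /=; lia. Qed.

Section Hardy.
Variable R : realType.
Implicit Types (f g h : R -> R[i]) (c : R[i]) (m n k : int).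

(** One predicate for all spectral conditions: linearity and closedness are proved once for both
    Hardy spaces and their shifts. *)
Definition Supp (S : int -> bool) f := L2 f /\ forall n, ~~ S n -> fourier f n = 0.
Definition Hle m f := Supp (fun n => n <= m) f.
Definition Hge m f := Supp (fun n => m <= n) f.

Lemma H2D_Hge f : H2D f <-> Hge 0 f.
Proof. by split=> -[hf h]; split=> // n; [rewrite -ltNge|rewrite ltNge]; exact: h. Qed.

Lemma H2Dstar_Hle f : H2Dstar f <-> Hle 0 f.
Proof. by split=> -[hf h]; split=> // n; [rewrite -ltNge|rewrite ltNge]; exact: h. Qed.

Lemma SuppD S f g : Supp S f -> Supp S g -> Supp S (fun t => f t + g t).
Proof.
move=> [hf f0] [hg g0]; split; first exact: L2D.
by move=> n Sn; rewrite fourierD ?f0 ?g0 ?addr0//; exact: L2_L1.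
Qed.

Lemma SuppZ S c f : Supp S f -> Supp S (fun t => c * f t).
Proof.
move=> [hf f0]; split; first exact: L2Z.
by move=> n Sn; rewrite fourierZ ?f0 ?mulr0//; exact: L2_L1.
Qed.

Lemma SuppN S f : Supp S f -> Supp S (fun t => - f t).
Proof. by move=> /(SuppZ (-1)); under eq_fun do rewrite mulN1r. Qed.

Lemma SuppB S f g : Supp S f -> Supp S g -> Supp S (fun t => f t - g t).
Proof. by move=> hf /SuppN; exact: SuppD. Qed.

Lemma Supp_ae S f g : measC g -> aeT (fun t => f t = g t) -> Supp S f -> Supp S g.
Proof.
move=> mg fg [hf f0]; split; first exact: L2_ae fg.
by move=> n /f0 <-; apply/esym; apply: fourier_ae => //; exact: L2_meas.
Qed.

Lemma Supp_sub (S S' : int -> bool) f : (forall n, S n -> S' n) -> Supp S f -> Supp S' f.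
Proof.
move=> SS' [hf f0]; split => // n Sn; apply: f0; apply: contra Sn; exact: SS'.
Qed.

Lemma Supp_cvg S (f : nat -> R -> R[i]) g : (forall i, Supp S (f i)) -> L2 g ->
  cvgL2 f g -> Supp S g.
Proof.
move=> hf hg fg; split => // n Sn.
apply: (cvgL2_fourier _ hg fg) => [i|]; first by have [] := hf i.
by apply: nearW => i; have [_ ->] := hf i.
Qed.

Lemma Supp_cst c : Supp (fun n => n == 0) (fun=> c).
Proof. by split; [exact: L2_cst|move=> n /negbTE n0; rewrite fourier_cst n0]. Qed.

Lemma Supp_sum S I (l : seq I) (F : I -> R -> R[i]) : (forall i, Supp S (F i)) ->
  Supp S (fun t => \sum_(i <- l) F i t).
Proof.
move=> hF; split; first by apply: L2_sum => i; have [] := hF i.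
move=> n Sn; rewrite (fourier_sum l n (fun i => L2_L1 (hF i).1)).2.
by rewrite big1// => i _; exact: (hF i).2.
Qed.

Lemma e_X (k : nat) (t : R) : e_ (- k%:Z) t = e_ (-1) t ^+ k.
Proof.
elim: k => [|k IH]; first by rewrite oppr0 e_0 expr0.
by rewrite exprS -IH -e_D; congr e_; lia.
Qed.

Lemma Supp_e n : Supp (fun k => k == n) (@e_ R n).
Proof. by split; [exact: L2_e|move=> k /negbTE kn; rewrite fourier_e eq_sym kn]. Qed.

Lemma Hle_e n m : n <= m -> Hle m (@e_ R n).
Proof. by move=> nm; apply: Supp_sub (Supp_e n) => k /eqP ->. Qed.

Lemma Hle_cst c m : 0 <= m -> Hle m (fun=> c).
Proof. by move=> m0; apply: Supp_sub (Supp_cst c) => n /eqP ->. Qed.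

Lemma HleW m n f : m <= n -> Hle m f -> Hle n f.
Proof. by move=> mn; apply: Supp_sub => k km; exact: le_trans mn. Qed.

Lemma HgeW m n f : n <= m -> Hge m f -> Hge n f.
Proof. by move=> mn; apply: Supp_sub => k km; exact: le_trans km. Qed.

Lemma HleJ m f : Hle m f -> Hge (- m) (fun t => cj (f t)).
Proof.
move=> [hf f0]; split; first exact: L2J.
move=> n nm; rewrite fourierJ; last exact: L2_L1.
by rewrite f0 ?cj0// -ltNge; move: nm; rewrite -ltNge ltrNr.
Qed.

Lemma HgeJ m f : Hge m f -> Hle (- m) (fun t => cj (f t)).
Proof.
move=> [hf f0]; split; first exact: L2J.
move=> n nm; rewrite fourierJ; last exact: L2_L1.
by rewrite f0 ?cj0// -ltNge; move: nm; rewrite -ltNge ltrNl.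
Qed.

Lemma L2_shift k f : L2 f -> L2 (fun t => e_ k t * f t).
Proof.
apply: (@L2_bdd _ 1); first exact: measC_expi.
by apply: aeT_on => t _; rewrite cabs2_e.
Qed.

Lemma Hle_shift k m f : Hle m f -> Hle (k + m) (fun t => e_ k t * f t).
Proof.
move=> [hf f0]; split; first exact: L2_shift.
by move=> n nm; rewrite fourier_shift f0// -ltNge ltrBrDl ltNge.
Qed.

Lemma Hge_shift k m f : Hge m f -> Hge (k + m) (fun t => e_ k t * f t).
Proof.
move=> [hf f0]; split; first exact: L2_shift.
by move=> n nm; rewrite fourier_shift f0// -ltNge ltrBlDl ltNge.
Qed.

Lemma Hle_fourier0 m f n : Hle m f -> m < n -> fourier f n = 0.
Proof. by move=> [_ h] mn; apply: h; rewrite -ltNge. Qed.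

Lemma Hge_fourier0 m f n : Hge m f -> n < m -> fourier f n = 0.
Proof. by move=> [_ h] mn; apply: h; rewrite -ltNge. Qed.

(** The product is only known to be integrable, so the support condition is stated for its
    coefficients instead of as membership in [Hle]; at the top frequency one term of the convolution
    remains. *)
Lemma HleM_fourier m n f g : Hle m f -> Hle n g ->
  (forall j, m + n < j -> fourier (fun t => f t * g t) j = 0) /\
  fourier (fun t => f t * g t) (m + n) = fourier f m * fourier g n.
Proof.
move=> hf hg; have [L2f _] := hf; have [L2g _] := hg; split=> [j jmn|].
  rewrite (@fourierM_single _ _ _ _ m)//.
    by rewrite (Hle_fourier0 hg) ?mulr0// ltrBrDl.
  move=> k _; have [km|km] := leP k m; last by rewrite (Hle_fourier0 hf)// mul0r.
  rewrite (Hle_fourier0 hg) ?mulr0// ltrBrDl (le_lt_trans _ jmn)//.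
  by rewrite lerD2r.
rewrite (@fourierM_single _ _ _ _ m)//; first by rewrite [m + n]addrC addrK.
move=> k; rewrite neq_lt => /orP[km|km]; last by rewrite (Hle_fourier0 hf)// mul0r.
by rewrite (Hle_fourier0 hg) ?mulr0// ltrBrDl ltrD2r.
Qed.

Lemma HleM m n f g : Hle m f -> Hle n g -> L2 (fun t => f t * g t) ->
  Hle (m + n) (fun t => f t * g t).
Proof.
move=> hf hg hfg; split=> // j; rewrite -ltNge; exact: (HleM_fourier hf hg).1.
Qed.

Lemma inp_single f g (m : int) : L2 f -> L2 g ->
  (forall k, k != m -> fourier f k * cj (fourier g k) = 0) ->
  inp f g = fourier f m * cj (fourier g m).
Proof.
move=> hf hg h0; have := @fourierM_single _ f _ 0 m hf (L2J hg).
rewrite sub0r fourierJ ?opprK; last exact: L2_L1.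
move=> <-; last first.
  move=> k km; rewrite sub0r fourierJ ?opprK; [exact: h0|exact: L2_L1].
rewrite fourierE; congr avg; apply/funext => t.
by rewrite oppr0 mul0r expi0 mulr1.
Qed.

Lemma inp_disj f g : L2 f -> L2 g ->
  (forall k, fourier f k * cj (fourier g k) = 0) -> inp f g = 0.
Proof. by move=> hf hg h0; rewrite (@inp_single _ _ 0)// h0. Qed.

Lemma L1_const f : L1 f -> (forall n, n != 0 -> fourier f n = 0) ->
  aeT (fun t => f t = fourier f 0).
Proof.
move=> hf f0.
have h : aeT (fun t => f t - fourier f 0 = 0).
  apply: fourier_L1_uniq; first by apply: L1B => //; exact: L1_cst.
  move=> n; rewrite fourierB//; last exact: L1_cst.
  rewrite fourier_cst; have [->|n0] := eqVneq n 0; first by rewrite subrr.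
  by rewrite f0// subr0.
by apply: filterS h => t /eqP; rewrite subr_eq0 => /eqP.
Qed.

(** The coefficients of a real function at n and -n are conjugate, so a one-sided condition acts on
    both sides. *)
Lemma real_L1_const f : L1 f -> (forall t, cj (f t) = f t) ->
  (forall n, 0 < n -> fourier f n = 0) -> aeT (fun t => f t = fourier f 0).
Proof.
move=> hf rf f0; apply: L1_const => // n; rewrite neq_lt => /orP[n0|]; last exact: f0.
have := fourierJ n hf; under eq_fun do rewrite rf.
by move=> ->; rewrite f0 ?cj0// ltrNr oppr0.
Qed.

End Hardy.

(** * Reciprocals of functions bounded below outside the disc *)

Section BoundedBelow.
Variable R : realType.
Implicit Types (f g h : R -> R[i]) (c : R[i]).

(** The bound makes this class closed under products, which H^2 is not. *)
Definition BH g := Hle 0 g /\ exists M : R, forall t, cabs2 (g t) <= M.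

Lemma BH_cst c : BH (fun=> c).
Proof. by split; [exact: Hle_cst|exists (cabs2 c)]. Qed.

Lemma BHM f g : BH f -> BH g -> BH (fun t => f t * g t).
Proof.
move=> [hf [M hM]] [hg [M' hM']]; split.
  rewrite -[X in Hle X](addr0 0); apply: HleM => //.
  apply: (@L2_bdd _ M); [by have [/L2_meas] := hf|exact: aeT_on|by have [] := hg].
exists (M * M') => t; rewrite cabs2M ler_pM ?cabs2_ge0//.
Qed.

(* [1 / (s e^{-it} - x)] for [s < |x|], by the geometric series. *)
Lemma BH_linear (s : R) (x : R[i]) : s ^+ 2 < cabs2 x ->
  BH (fun t => (s%:C * e_ (-1) t - x)^-1).
Proof.
move=> sx.
have x0 : x != 0 by rewrite -cabs2_gt0 (le_lt_trans _ sx)// sqr_ge0.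
pose y := s%:C / x.
pose th := cabs2 y.
have th0 : 0 <= th by exact: cabs2_ge0.
have th1 : th < 1.
  by rewrite /th cabs2M cabs2V cabs2_real ltr_pdivrMr ?mul1r// cabs2_gt0.
have th01 : 0 <= th < 1 by rewrite th0.
pose w t := y * e_ (-1) t.
have cw t : cabs2 (w t) = th by rewrite cabs2M cabs2_e mulr1.
have w1 t : 1 - w t != 0.
  apply/eqP => /eqP; rewrite subr_eq0 => /eqP h; have := cw t.
  by rewrite -h cabs21 => h1; rewrite h1 ltxx in th1.
pose G t := (1 - w t)^-1.
have mG : measC G.
  apply: measCV; apply: measCD; first exact: measC_cst.
  by apply: measCN; apply: measCM; [exact: measC_cst|exact: measC_expi].
have GM : exists M : R, forall t, cabs2 (G t) <= M.
  (* From |v|^2 = th follows 2 Re v <= 1 + th, hence |1 - v| >= d, without square roots. *)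
  pose d := 1 - (1 + th) / 2.
  have d0 : 0 < d by rewrite /d; lra.
  exists (d ^+ 2)^-1 => t; rewrite cabs2V lef_pV2 ?posrE ?exprn_gt0//; last first.
    by rewrite cabs2_gt0.
  suff key (v : R[i]) : cabs2 v = th -> d ^+ 2 <= cabs2 (1 - v) by exact/key/cw.
  rewrite /cabs2 !ReImE; case: v => [p q] /= h2.
  have p2 : p <= (1 + th) / 2 by have := sqr_ge0 q; have := sqr_ge0 (p - 1); nra.
  have : d <= 1 - p by rewrite /d; lra.
  by have := sqr_ge0 (0 - q); nra.
pose S N t := \sum_(i < N) w t ^+ i.
have SE N t : S N t = G t - w t ^+ N * G t.
  have h : S N t * (1 - w t) = 1 - w t ^+ N.
    by rewrite /S; move: (w t) => v; rewrite -(opprB (v ^+ N) 1) subrX1 -mulNr opprB mulrC.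
  by rewrite -[X in X - _]mul1r -mulrBl -h /G mulfK.
have HS N : Hle 0 (S N).
  apply: (@Supp_sum _ _ _ _ (fun (i : 'I_N) t => w t ^+ i)) => i.
  have -> : (fun t => w t ^+ i) = (fun t => y ^+ i * e_ (- i%:Z) t).
    by apply/funext => t; rewrite exprMn e_X.
  by apply: SuppZ; apply: Hle_e; rewrite oppr_le0.
have L2G : L2 G.
  have [M hM] := GM.
  have := @L2_bdd _ M G (fun=> 1) mG (aeT_on (fun t _ => hM t)) (L2_cst _).
  by under eq_fun do rewrite mulr1.
have HG : Hle 0 G.
  apply: (Supp_cvg HS L2G); rewrite /cvgL2.
  have lim0 : (fun N => msq G * th ^+ N) @ \oo --> (0 : R) by exact: geom_pow_cvg.
  apply: (squeeze_cvgr _ (cvg_cst 0) lim0); apply: nearW => N; rewrite msq_ge0 /=.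
  have -> : (fun t => S N t - G t) = (fun t => - (w t ^+ N) * G t).
    by apply/funext => t; rewrite SE addrC addKr mulNr.
  rewrite mulrC; apply: msq_bdd => //.
  - apply: measCN; have : trig (fun t => w t ^+ N) by apply: trigX; exact: trig_e.
    exact: measC_trig.
  - by apply: aeT_on => t _; rewrite cabs2N cabs2X cw.
have -> : (fun t => (s%:C * e_ (-1) t - x)^-1) = (fun t => - x^-1 * G t).
  apply/funext => t; rewrite /G -invrN -invfM; congr (_^-1).
  by rewrite /w /y; field.
by apply: BHM; [exact: BH_cst|split].
Qed.

(** The polynomial splits into linear factors, each inverted by [BH_linear]; boundedness lets the
    reciprocals be multiplied. *)
Lemma BH_polyV (p : {poly R[i]}) (s : R) : p != 0 ->
  (forall x, root p x -> s ^+ 2 < cabs2 x) -> BH (fun t => (p.[s%:C * e_ (-1) t])^-1).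
Proof.
move=> p0 rp; have [l pl] := closed_field_poly_normal p.
have lc : lead_coef p != 0 by rewrite lead_coef_eq0.
have {}rp x : x \in l -> s ^+ 2 < cabs2 x.
  move=> xl; apply: rp; rewrite pl rootZ//.
  by rewrite root_prod_XsubC.
have -> : (fun t => (p.[s%:C * e_ (-1) t])^-1) = (fun t => (lead_coef p)^-1 *
    \prod_(x <- l) (s%:C * e_ (-1) t - x)^-1).
  apply/funext => t; rewrite {1}pl hornerZ invfM; congr (_ * _).
  rewrite horner_prod -prodfV; apply: eq_bigr => x _.
  by rewrite hornerXsubC.
apply: BHM; first exact: BH_cst.
elim: l rp {pl} => [|x l IH] rp.
  by under eq_fun do rewrite big_nil; exact: BH_cst.
under eq_fun do rewrite big_cons; apply: BHM.
  by apply: BH_linear; apply: rp; rewrite mem_head.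
by apply: IH => y yl; apply: rp; rewrite in_cons yl orbT.
Qed.

Section Reciprocal.
Variables (a : R -> R[i]) (c : R).
Hypotheses (ha : Hle 0 a) (c0 : 0 < c) (cinf : c <= cabs2 (fourier a 0)).
Hypothesis cext : forall z w : R[i], 1 < cabs2 z -> ext_Dstar a z w -> c <= cabs2 w.

Let ak (k : nat) := fourier a (- k%:Z).
Let pN N : {poly R[i]} := \poly_(k < N) ak k.

(** In the variable x = 1 / z the extension is the power series with coefficients [ak]; these are
    bounded by sqrt([msq a]), so its tails are geometric, uniformly for |x| <= s. The witness w is
    the value of the extension, for x = 0 the value at infinity. *)
Let ext_tail (s : R) : 0 <= s < 1 -> exists K : R, forall (x : R[i]) N, cabs2 x <= s ^+ 2 ->
  exists w, c <= cabs2 w /\ cabs2 ((pN N.+1).[x] - w) <= K * (s ^+ 2) ^+ N.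
Proof.
move=> s01; case/andP: (s01) => s0 s1.
pose M := msq a; have M0 : 0 <= M by exact: msq_ge0.
have akM k : cabs2 (ak k) <= M by apply: fourier_le; have [] := ha.
pose K0 := Num.sqrt M / (1 - s).
exists (2 * K0 ^+ 2) => x N xs.
have [x0|x0] := eqVneq x 0.
  exists (ak 0%N); split; first by rewrite /ak oppr0.
  rewrite x0 /pN horner_poly big_ord_recl expr0 mulr1 big1 ?addr0 ?subrr ?cabs20//.
    by rewrite mulr_ge0 ?exprn_ge0 ?sqr_ge0// mulr_ge0// sqr_ge0.
  by move=> i _; rewrite lift0 exprS mul0r mulr0.
pose u (N : nat) := \sum_(k < N) ak k * x ^+ k.
have uS n : cabs2 (u n.+1 - u n) <= (Num.sqrt M * s ^+ n) ^+ 2.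
  rewrite /u big_ord_recr /= [X in cabs2 (X - _)]addrC addrK cabs2M exprMn sqr_sqrtr//.
  rewrite ler_pM ?cabs2_ge0// cabs2X -exprM mulnC exprM.
  by rewrite lerXn2r// ?nnegrE ?cabs2_ge0// sqr_ge0.
have Q0 n : 0 <= Num.sqrt M * s ^+ n by rewrite mulr_ge0 ?sqrtr_ge0 ?exprn_ge0.
have [n|v vc vb] := @geom_cvg _ (fun n => complex.Re (u n)) (Num.sqrt M) s s01.
  rewrite -ler_sqr ?nnegrE// real_normK ?num_real// -Re_opp -Re_add.
  by rewrite (le_trans (sqr_Re_le _)).
have [n|v' vc' vb'] := @geom_cvg _ (fun n => complex.Im (u n)) (Num.sqrt M) s s01.
  rewrite -ler_sqr ?nnegrE// real_normK ?num_real// -Im_opp -Im_add.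
  by rewrite (le_trans (sqr_Im_le _)).
exists (v +i* v'); split.
  apply: (cext (z := x^-1)).
    rewrite cabs2V invf_gt1 ?cabs2_gt0// (le_lt_trans xs)// expr_lt1//.
  have uE : (fun N => \sum_(k < N) fourier a (- k%:Z) * x^-1 ^- k) = u.
    by apply/funext => n; apply: eq_bigr => k _; rewrite exprVn invrK.
  by rewrite /ext_Dstar uE; split.
rewrite /pN horner_poly -/(u N.+1) -mulrA mulr_natl mulr2n.
have -> : K0 ^+ 2 * (s ^+ 2) ^+ N = (K0 * s ^+ N) ^+ 2.
  by rewrite [RHS]exprMn -[(s ^+ 2) ^+ N]exprM -[(s ^+ N) ^+ 2]exprM mulnC.
have sle : K0 * s ^+ N.+1 <= K0 * s ^+ N.
  rewrite ler_wpM2l ?divr_ge0 ?sqrtr_ge0 ?subr_ge0 ?(ltW s1)//.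
  by rewrite exprS ler_piMl ?exprn_ge0// ltW.
rewrite /cabs2 !ReImE /= lerD//; apply: sqr_le_norm; apply: le_trans sle; [exact: vb|exact: vb'].
Qed.

Let q N (s : R) t := (pN N).[s%:C * e_ (-1) t].

Let qE N s t : q N s t = \sum_(k < N) (ak k * (s ^+ k)%:C) * e_ (- k%:Z) t.
Proof.
rewrite /q /pN horner_poly; apply: eq_bigr => k _.
by rewrite exprMn -rmorphXn mulrA e_X.
Qed.

Let L2_q N s : L2 (q N s).
Proof.
have -> : q N s = (fun t => \sum_(k < N) (ak k * (s ^+ k)%:C) * e_ (- k%:Z) t).
  by apply/funext => t; exact: qE.
apply: (@L2_sum _ _ _ (fun (k : 'I_N) t => (ak k * (s ^+ k)%:C) * e_ (- k%:Z) t)) => k.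
by apply: L2Z; exact: L2_e.
Qed.

Let fourier_q N s n : fourier (q N s) n =
  if n <= 0 then (if (`|n| < N)%N then fourier a n * (s ^+ `|n|)%:C else 0) else 0.
Proof.
have -> : q N s = (fun t => \sum_(k < N) (ak k * (s ^+ k)%:C) * e_ (- k%:Z) t).
  by apply/funext => t; exact: qE.
have hL (k : 'I_N) : L1 (fun t => (ak k * (s ^+ k)%:C) * @e_ R (- k%:Z) t).
  by apply: L2_L1; apply: L2Z; exact: L2_e.
rewrite (fourier_sum _ n hL).2.
have E (k : 'I_N) : fourier (fun t => (ak k * (s ^+ k)%:C) * @e_ R (- k%:Z) t) n =
    if - k%:Z == n then ak k * (s ^+ k)%:C else 0.
  rewrite fourierZ; last by apply: L2_L1; exact: L2_e.
  by rewrite fourier_e; case: eqP; rewrite ?mulr1 ?mulr0.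
under eq_bigr do rewrite E.
case: (leP n 0) => n0; last first.
  rewrite big1// => k _; case: eqP => // kn; move: n0; rewrite -kn; lia.
case: ltnP => nN.
  rewrite (bigD1 (Ordinal nN)) //= big1 ?addr0.
    have -> : - `|n|%N%:Z = n by lia.
    by rewrite eqxx /ak; congr (fourier a _ * _); lia.
  move=> k kn; case: eqP => // e; case/eqP: kn; apply: val_inj => /=; lia.
rewrite big1// => k _; case: eqP => // e; have := ltn_ord k; lia.
Qed.

(** Dilating by s < 1 makes the series converge uniformly on the closed disc, so that a truncation
    inherits a lower bound; s close to 1 keeps the result close to a in L^2. *)
Let approx e : 0 < e -> exists N s, [/\ 0 <= s < 1, msq (fun t => q N s t - a t) <= e,
  forall x, cabs2 x <= s ^+ 2 -> exists w, c <= cabs2 w /\ cabs2 ((pN N).[x] - w) <= e &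
  forall x, cabs2 x <= s ^+ 2 -> c / 4 <= cabs2 ((pN N).[x])].
Proof.
move=> e0; have [L2a a0] := ha; set M := msq a; have M0 : 0 <= M by exact: msq_ge0.
have [I0 hI0] : exists I0, M - \sum_(i <- iota 0 I0) cabs2 (coefs a i) <= e / 2.
  have e2 : 0 < e / 2 by lra.
  have /cvgrPdist_le /(_ _ e2) [I0 _ h] := parseval L2a.
  by exists I0; have := h I0 (leqnn _); rewrite ler_norml => /andP[].
pose A := I0%:R ^+ 2 * M.
have A0 : 0 <= A by rewrite mulr_ge0// sqr_ge0.
(* Chosen so that tau <= 1 and A tau <= e / 2. A coefficient of index below I0 changes by a relative
   amount of at most I0 tau, whose square is at most I0^2 tau; the later ones change by at most
   their own size and contribute e / 2. *)
pose tau := (e / 2) / (1 + e / 2 + A).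
have den : 0 < 1 + e / 2 + A by lra.
have tau0 : 0 < tau by rewrite divr_gt0//; lra.
have tau1 : tau <= 1 by rewrite ler_pdivrMr//; lra.
have tauA : A * tau <= e / 2.
  rewrite /tau mulrCA -[leRHS]mulr1 ler_wpM2l//; first by lra.
  by rewrite ler_pdivrMr//; lra.
pose s := 1 - tau.
have s01 : 0 <= s < 1 by rewrite /s; apply/andP; split; lra.
case/andP: (s01) => s0 s1.
have [K hK] := ext_tail s01.
have s201 : 0 <= s ^+ 2 < 1 by rewrite sqr_ge0 expr_lt1.
have tail := geom_pow_cvg K s201.
have ec : 0 < Num.min e (c / 4) by rewrite lt_min e0 divr_gt0.
have /cvgrPdist_le /(_ _ ec) [N0 _ hN0] := tail.
pose N := maxn N0 I0.
have KN : K * (s ^+ 2) ^+ N <= Num.min e (c / 4).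
  have := hN0 N (leq_maxl _ _); rewrite /= sub0r normrN; exact: le_trans (ler_norm _).
exists N.+1, s; split => //.
- have hqa := L2B (L2_q N.+1 s) L2a.
  have dle i : cabs2 (coefs (fun t => q N.+1 s t - a t) i) <=
      (if (i < I0)%N then I0%:R ^+ 2 * tau else 1) * cabs2 (coefs a i).
    rewrite /coefs fourierB; [|exact: L2_L1..]; rewrite fourier_q.
    have [n0|n0] := leP (znth i) 0; last first.
      by rewrite (Hle_fourier0 ha)// subrr cabs20 mulr0.
    set n := znth i in n0 *.
    have sn1 : 0 <= s ^+ `|n| <= 1 by rewrite exprn_ge0//= exprn_ile1// ltW.
    case: ltnP => nN; last first.
      rewrite sub0r cabs2N; case: ifPn; rewrite ?mul1r// => iI.
      have : (`|n| <= i)%N by exact: absz_znth_le.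
      have I0N : (I0 <= N)%N := leq_maxr _ _.
      by move=> ni; have := leq_ltn_trans (leq_trans I0N (ltnW (leq_trans nN ni))) iI; rewrite ltnn.
    have -> : fourier a n * (s ^+ `|n|)%:C - fourier a n =
        fourier a n * ((s ^+ `|n| - 1)%:C) by rewrite rmorphB rmorph1 mulrBr mulr1.
    rewrite cabs2M cabs2_real [leLHS]mulrC.
    case: ifPn => iI; last first.
      rewrite ler_wpM2r ?cabs2_ge0// -(expr1n _ 2).
      by apply: sqr_le_norm; rewrite ler_norml; case/andP: sn1 => h1 h2; apply/andP; split; lra.
    have ni : (`|n| <= I0)%N.
      have : (`|n| <= i)%N by exact: absz_znth_le.
      by move=> ni; rewrite (leq_trans ni)// ltnW.
    have b : 1 - I0%:R * tau <= s ^+ `|n|.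
      have := @bernoulli_lower _ tau `|n|; rewrite tau1 (ltW tau0) => /(_ isT).
      by apply: le_trans; rewrite lerD2l lerN2 ler_wpM2r ?(ltW tau0)// ler_nat.
    have It0 : 0 <= I0%:R * tau :> R by rewrite mulr_ge0// ltW.
    case/andP: sn1 => h1 h2.
    have : (s ^+ `|n| - 1) ^+ 2 <= (I0%:R * tau) ^+ 2.
      by apply: sqr_le_norm; rewrite ler_norml; apply/andP; split; lra.
    move=> h; rewrite ler_wpM2r ?cabs2_ge0//.
    apply: le_trans h _; rewrite exprMn ler_wpM2l ?sqr_ge0//.
    by rewrite expr2 ler_piMl// ltW.
  rewrite -(cvg_lim _ (parseval hqa))//; apply: limr_le.
    by apply/cvg_ex; eexists; exact: parseval hqa.
  apply: nearW => L.
  apply: (@le_trans _ _ (\sum_(i <- iota 0 (I0 + L)) cabs2 (coefs (fun t => q N.+1 s t - a t) i))).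
    rewrite addnC iotaD big_cat /= lerDl; apply: sumr_ge0 => i _; exact: cabs2_ge0.
  rewrite iotaD big_cat /=.
  have := bessel (I0 + L) L2a; rewrite iotaD big_cat /= -/M => bM.
  have p1 : \sum_(i <- iota 0 I0) cabs2 (coefs (fun t => q N.+1 s t - a t) i) <=
      I0%:R ^+ 2 * tau * \sum_(i <- iota 0 I0) cabs2 (coefs a i).
    rewrite mulr_sumr big_seq [leRHS]big_seq; apply: ler_sum => i.
    by rewrite mem_iota add0n => /andP[_ iI]; have := dle i; rewrite iI.
  have p2 : \sum_(i <- iota (0 + I0) L) cabs2 (coefs (fun t => q N.+1 s t - a t) i) <=
      \sum_(i <- iota (0 + I0) L) cabs2 (coefs a i).
    rewrite big_seq [leRHS]big_seq; apply: ler_sum => i.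
    rewrite mem_iota add0n => /andP[iI _]; have := dle i.
    by rewrite ltnNge iI /= mul1r.
  have b0 := bessel I0 L2a.
  have : I0%:R ^+ 2 * tau * \sum_(i <- iota 0 I0) cabs2 (coefs a i) <= A * tau.
    by rewrite /A mulrAC ler_wpM2r ?(ltW tau0)// ler_wpM2l// sqr_ge0.
  by move: p1 p2 bM hI0 tauA; lra.
- move=> x xs; have [w [w1 w2]] := hK x N xs; exists w; split => //.
  by rewrite (le_trans w2)// (le_trans KN)// ge_min lexx.
(* c <= |w|^2 <= 2 |p|^2 + 2 |p - w|^2 with |p - w|^2 <= c / 4 leaves |p|^2 >= c / 4. *)
- move=> x xs; have [w [w1 w2]] := hK x N xs.
  have : cabs2 ((pN N.+1).[x] - w) <= c / 4.
    by rewrite (le_trans w2)// (le_trans KN)// ge_min lexx orbT.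
  have := cabs2B_le ((pN N.+1).[x]) ((pN N.+1).[x] - w).
  by rewrite opprB addrC subrK; lra.
Qed.

(* The dilated Taylor polynomials of a have no zeros in the closed disc, so
   their reciprocals lie in H^2(D^* ); the lower bound passes to the limit. *)
Lemma reciprocal : aeT (fun t => c <= cabs2 (a t)) /\ Hle 0 (fun t => (a t)^-1).
Proof.
have [L2a a0] := ha.
(* With errors 8^-j / 4 consecutive approximants differ by at most 8^-j in mean square, the rate at
   which [L2_fast] gives pointwise convergence. *)
have /choice[Ns hNs] : forall j : nat, exists Ns : nat * R, [/\ 0 <= Ns.2 < 1,
  msq (fun t => q Ns.1 Ns.2 t - a t) <= (8 ^+ j)^-1 / 4,
  forall x, cabs2 x <= Ns.2 ^+ 2 ->
    exists w, c <= cabs2 w /\ cabs2 ((pN Ns.1).[x] - w) <= (8 ^+ j)^-1 / 4 &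
  forall x, cabs2 x <= Ns.2 ^+ 2 -> c / 4 <= cabs2 ((pN Ns.1).[x])].
  move=> j; have [|N [s h]] := @approx ((8 ^+ j)^-1 / 4).
    by rewrite divr_gt0// invr_gt0 exprn_gt0.
  by exists (N, s).
pose f j := q (Ns j).1 (Ns j).2.
have L2f j : L2 (f j) by exact: L2_q.
have fa j : msq (fun t => f j t - a t) <= (8 ^+ j)^-1 / 4 by have [] := hNs j.
have xs j t : cabs2 ((Ns j).2%:C * e_ (-1) t) <= (Ns j).2 ^+ 2.
  by rewrite cabs2M cabs2_e mulr1 cabs2_real.
have i8 j : 0 <= (8 ^+ j)^-1 :> R by rewrite invr_ge0 exprn_ge0.
have i8S j : (8 ^+ j.+1)^-1 <= (8 ^+ j)^-1 :> R.
  by rewrite lef_pV2 ?posrE ?exprn_gt0// exprS ler_peMl ?exprn_ge0// ler1n.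
have c8 : (fun j => (8 ^+ j)^-1 / 4) @ \oo --> (0 : R).
  have h18 : 0 <= (8^-1 : R) < 1 by apply/andP; split; lra.
  have := geom_pow_cvg 4^-1 h18.
  by under eq_fun do rewrite exprVn mulrC.
have cfa : cvgL2 f a.
  by apply: (squeeze_cvgr _ (cvg_cst 0) c8); apply: nearW => j; rewrite msq_ge0 fa.
have [|g [L2g cfg aeg]] := L2_fast L2f.
  move=> j.
  have -> : (fun t => f j.+1 t - f j t) = (fun t => (f j.+1 t - a t) - (f j t - a t)).
    by apply/funext => t; ring.
  rewrite (le_trans (msqB_le _ _))//; [exact: L2B..|].
  by have := fa j; have := fa j.+1; have := i8S j; lra.
have ga := cvgL2_uniq L2f L2g L2a cfg cfa.
have ca : aeT (fun t => c <= cabs2 (a t)).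
  apply: filterS2 aeg ga => t h <-.
  (* W j is a value of the extension close to [f j t]: it has the same limit, and its squared
     modulus is at least c, where for [f j t] only c / 4 is available. *)
  have /choice[W hW] : forall j, exists w, c <= cabs2 w /\
      cabs2 (f j t - w) <= (8 ^+ j)^-1 / 4.
    by move=> j; have [_ _ + _] := hNs j; apply; exact: xs.
  have sq0 (u : nat -> R) : (forall j, u j ^+ 2 <= (8 ^+ j)^-1 / 4) -> u @ \oo --> (0 : R).
    move=> hu; have u2 : (fun j => u j ^+ 2) @ \oo --> (0 : R).
      by apply: (squeeze_cvgr _ (cvg_cst 0) c8); apply: nearW => j; rewrite sqr_ge0 hu.
    apply/cvgrPdist_le => e e0; have e2 : 0 < e ^+ 2 by rewrite exprn_gt0.
    have /cvgrPdist_le /(_ _ e2) := u2; apply: filterS => j /=.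
    rewrite !sub0r !normrN ger0_norm ?sqr_ge0//.
    by rewrite -(@real_normK _ (u j)) ?num_real// ler_sqr ?nnegrE// ltW.
  have [hr hi] := h.
  have Wr : (fun j => complex.Re (W j)) @ \oo --> complex.Re (g t).
    have h1 := sq0 (fun j => complex.Re (f j t - W j)) (fun j => le_trans (sqr_Re_le _) (hW j).2).
    rewrite -[X in _ --> X]subr0.
    have -> : (fun j => complex.Re (W j)) = (fun j => complex.Re (f j t) - complex.Re (f j t - W j)).
      by apply/funext => j; rewrite !ReImE; ring.
    by apply: cvgB.
  have Wi : (fun j => complex.Im (W j)) @ \oo --> complex.Im (g t).
    have h1 := sq0 (fun j => complex.Im (f j t - W j)) (fun j => le_trans (sqr_Im_le _) (hW j).2).
    rewrite -[X in _ --> X]subr0.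
    have -> : (fun j => complex.Im (W j)) = (fun j => complex.Im (f j t) - complex.Im (f j t - W j)).
      by apply/funext => j; rewrite !ReImE; ring.
    by apply: cvgB.
  have W2 : (fun j => cabs2 (W j)) @ \oo --> cabs2 (g t).
    by apply: cvgD; rewrite !expr2; apply: cvgM.
  rewrite -(cvg_lim _ W2)//; apply: limr_ge; first by apply/cvg_ex; exists (cabs2 (g t)).
  by apply: nearW => j; have [] := hW j.
split => //.
have mf j : measC (fun t => (f j t)^-1) by apply: measCV; exact: L2_meas.
have ma : measC (fun t => (a t)^-1) by apply: measCV; exact: L2_meas.
have L2i : L2 (fun t => (a t)^-1).
  have -> : (fun t => (a t)^-1) = (fun t => (a t)^-1 * 1) by apply/funext => t; rewrite mulr1.
  apply: (@L2_bdd _ c^-1) ma _ (L2_cst _).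
  by apply: filterS ca => t h; rewrite cabs2V lef_pV2 ?posrE// (lt_le_trans c0).
have Hf j : Hle 0 (fun t => (f j t)^-1).
  have [s01 _ _ lb] := hNs j.
  have [|x|] := @BH_polyV (pN (Ns j).1) (Ns j).2; last by [].
  - apply/eqP => p0; have := lb 0; rewrite p0 horner0 cabs20 sqr_ge0 => /(_ isT); by rewrite leNgt divr_gt0.
  - move=> rx; rewrite ltNge; apply/negP => xs'; have := lb _ xs'.
    by move/rootP: rx => ->; rewrite cabs20 leNgt divr_gt0.
apply: (Supp_cvg Hf L2i); rewrite /cvgL2.
(* 4 / c and 1 / c bound |1 / f|^2 and |1 / a|^2 in 1 / f - 1 / a = (a - f) / (f a). *)
have lim0 : (fun j => (4 / c * c^-1) * msq (fun t => f j t - a t)) @ \oo --> (0 : R).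
  by rewrite -[X in _ --> X](mulr0 (4 / c * c^-1)); apply: cvgMr.
apply: (squeeze_cvgr _ (cvg_cst 0) lim0); apply: nearW => j; rewrite msq_ge0 /=.
have [_ _ _ lb] := hNs j.
have K0 : 0 <= 4 / c * c^-1 by rewrite !mulr_ge0// invr_ge0 ltW.
have [] // := @msq_ae_le _ (4 / c * c^-1) (fun t => (f j t)^-1 - (a t)^-1) (fun t => f j t - a t) K0.
- by apply: measCD => //; exact: measCN.
- exact: L2B.
- apply: filterS ca => t cat.
  have f4 : c / 4 <= cabs2 (f j t) by apply: lb; exact: xs.
  have c4 : 0 < c / 4 by rewrite divr_gt0.
  have f0 : f j t != 0 by rewrite -cabs2_gt0 (lt_le_trans c4).
  have at0 : a t != 0 by rewrite -cabs2_gt0 (lt_le_trans c0).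
  have -> : (f j t)^-1 - (a t)^-1 = ((f j t)^-1 * (a t)^-1) * (- (f j t - a t)).
    by field; rewrite f0 at0.
  rewrite cabs2M cabs2N ler_wpM2r ?cabs2_ge0// cabs2M !cabs2V.
  rewrite ler_pM ?invr_ge0 ?cabs2_ge0//.
    by rewrite -[4 / c]invrK invf_div lef_pV2 ?posrE// (lt_le_trans c4).
  by rewrite lef_pV2 ?posrE// (lt_le_trans c0).
Qed.

End Reciprocal.

End BoundedBelow.

(** * The L^2 norm and geometric convergence *)

Section L2Norm.
Variable R : realType.
Implicit Types (f g h : R -> R[i]).

Definition nrm f : R := Num.sqrt (msq f).

Lemma nrm_ge0 f : 0 <= nrm f. Proof. exact: sqrtr_ge0. Qed.

Lemma sqr_nrm f : nrm f ^+ 2 = msq f.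
Proof. by rewrite sqr_sqrtr// msq_ge0. Qed.

Lemma Re_inp_le f g : L2 f -> L2 g -> `|complex.Re (inp f g)| <= nrm f * nrm g.
Proof.
move=> hf hg; rewrite -ler_sqr ?nnegrE ?mulr_ge0 ?nrm_ge0// real_normK ?num_real//.
by rewrite (le_trans (sqr_Re_le _))// exprMn !sqr_nrm cauchy_schwarz.
Qed.

Lemma nrmD f g : L2 f -> L2 g -> nrm (fun t => f t + g t) <= nrm f + nrm g.
Proof.
move=> hf hg; rewrite -ler_sqr ?nnegrE ?addr_ge0 ?nrm_ge0//.
have := msqB hf (L2N hg); under [X in msq X]eq_fun do rewrite opprK.
rewrite sqr_nrm => ->; rewrite msqN sqrrD !sqr_nrm.
have := Re_inp_le hf (L2N hg); rewrite {2}/nrm msqN -/(nrm g) ler_norml => /andP[h _].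
by rewrite mulr2n; lra.
Qed.

Lemma msq_le_coefs f g : L2 f -> L2 g ->
  (forall n, cabs2 (fourier f n) <= cabs2 (fourier g n)) -> msq f <= msq g.
Proof.
move=> hf hg h; rewrite -(cvg_lim _ (parseval hf))//; apply: limr_le.
  by apply/cvg_ex; eexists; exact: parseval hf.
by apply: nearW => N; apply: le_trans (bessel N hg); apply: ler_sum => i _; exact: h.
Qed.

(** Unlike its square [msq], the norm [nrm] obeys the triangle inequality, so geometric increments
    sum up to a Cauchy estimate. *)
Lemma L2_geometric (f : nat -> R -> R[i]) (C q : R) : 0 <= q < 1 -> (forall n, L2 (f n)) ->
  (forall n, nrm (fun t => f n.+1 t - f n t) <= C * q ^+ n) ->
  exists g, L2 g /\ cvgL2 f g.
Proof.
move=> q01 hf hd; case/andP: (q01) => q0 q1.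
have q1' : 0 < 1 - q by lra.
have C0 : 0 <= C by have := le_trans (nrm_ge0 _) (hd 0%N); rewrite expr0 mulr1.
have key n k : nrm (fun t => f (n + k)%N t - f n t) <= C / (1 - q) * (q ^+ n - q ^+ (n + k)).
  elim: k => [|k IH].
    rewrite addn0 subrr mulr0 /nrm (_ : msq _ = 0) ?sqrtr0//.
    rewrite (_ : (fun t => _) = (fun=> 0)).
      by have := msq_tsum (fun=> 0 : R[i]) (l := [::]) isT; rewrite big_nil /tsum;
         under [X in msq X]eq_fun do rewrite big_nil.
    by apply/funext => t; rewrite subrr.
  have -> : (fun t => f (n + k.+1)%N t - f n t) =
      (fun t => (f (n + k).+1 t - f (n + k)%N t) + (f (n + k)%N t - f n t)).
    by apply/funext => t; rewrite addnS; ring.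
  rewrite (le_trans (nrmD _ _))//; [exact: L2B..|].
  rewrite (le_trans (lerD (hd _) IH))// addnS exprS le_eqVlt; apply/orP; left; apply/eqP.
  by field; rewrite gt_eqF.
apply: L2_complete => // e e0.
have c0 := geom_pow_cvg (C / (1 - q)) q01.
have [N hN] : exists N, forall n, (N <= n)%N -> C / (1 - q) * q ^+ n <= Num.sqrt e.
  have /cvgrPdist_le /(_ (Num.sqrt e)) := c0; rewrite sqrtr_gt0 e0 => /(_ isT)[N _ h].
  exists N => n Nn; have := h n Nn; rewrite /= sub0r normrN; exact: le_trans (ler_norm _).
have key2 n k : (N <= n)%N -> (n <= k)%N -> msq (fun t => f k t - f n t) <= e.
  move=> Nn nk; rewrite -sqr_nrm -[leRHS](sqr_sqrtr (ltW e0)) lerXn2r ?nnegrE ?nrm_ge0 ?sqrtr_ge0//.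
  have := key n (k - n)%N; rewrite subnKC// => h; rewrite (le_trans h)//.
  rewrite (le_trans _ (hN n Nn))// ler_wpM2l ?divr_ge0 ?(ltW q1')// lerBlDr lerDl.
  by rewrite exprn_ge0.
exists N => m n Nm Nn; have [mn|nm] := leqP m n; last exact: key2 (ltnW nm).
by rewrite msqBC; exact: key2.
Qed.

End L2Norm.

(** * The linear system: existence, uniqueness, constant modulus *)

Section Solution.
Variables (R : realType) (r : R -> R[i]) (q : R).
Hypotheses (mr : measC r) (q01 : 0 <= q < 1) (rq : aeT (fun t => cabs2 (r t) <= q)).
Implicit Types (f g h A B : R -> R[i]) (n k : int).

Let mrJ : measC (fun t => cj (r t)). Proof. exact: measCJ. Qed.
Let rqJ : aeT (fun t => cabs2 (cj (r t)) <= q).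
Proof. by apply: filterS rq => t; rewrite cabs2J. Qed.

Lemma L2_r f : L2 f -> L2 (fun t => r t * f t).
Proof. exact: L2_bdd rq. Qed.

Lemma L2_rJ f : L2 f -> L2 (fun t => cj (r t) * f t).
Proof. exact: L2_bdd rqJ. Qed.

(** If (A, B) is a real multiple of a right factor, then [cj (Uf A B)] and [Vf A B] are the same
    multiple of the left factor divided by a. *)
Definition Uf A B t := A t + cj (r t) * B t.
Definition Vf A B t := r t * A t - B t.

Lemma L2_U A B : L2 A -> L2 B -> L2 (Uf A B).
Proof. by move=> hA hB; apply: L2D => //; exact: L2_rJ. Qed.

Lemma L2_V A B : L2 A -> L2 B -> L2 (Vf A B).
Proof. by move=> hA hB; apply: L2B => //; exact: L2_r. Qed.

(** The mean 1 of [Uf A B] fixes the scaling and keeps the system linear; that (A, B) is unitary up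
    to a constant is a consequence. *)
Definition Sol n A B := [/\ Hle 0 A, Hge n B, Hge 0 (Uf A B),
  fourier (Uf A B) 0 = 1 & Hle (n - 1) (Vf A B)].

(* The cross terms of the two inner products are conjugate to each other and of opposite sign. *)
Lemma energy A B : L2 A -> L2 B ->
  msq A + msq B = complex.Re (inp (Uf A B) A) - complex.Re (inp (Vf A B) B).
Proof.
move=> hA hB; rewrite /Uf /Vf inpDl ?inpBl//; [|exact: L2_r|exact: L2_rJ].
rewrite !inp_self.
have -> : inp (fun t => cj (r t) * B t) A = cj (inp (fun t => r t * A t) B).
  rewrite /inp -avgJ; last by apply: L2_inp => //; exact: L2_r.
  congr avg; apply/funext => t; rewrite !cjM cjK; ring.
by rewrite !ReImE /=; ring.
Qed.

(** The condition on [Vf] makes B the projection of r A to frequencies >= n; the conditions on [Uf]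
    then read A = 1 - P(cj(r) B), with P the projection to frequencies <= 0. Each multiplication by
    r or cj(r) scales [msq] by at most q, so A is the fixed point of a contraction. *)
Lemma sol_exists n : exists A B, Sol n A B.
Proof.
(* [choice] asks for a value at every function, so outside L^2 the projection gets the default f. *)
have /choice[P hP] : forall Sf : (pred int) * (R -> R[i]), exists g, L2 Sf.2 ->
    L2 g /\ forall k, fourier g k = if Sf.1 k then fourier Sf.2 k else 0.
  move=> [S f] /=; have [hf|nf] := pselect (L2 f); last by exists f.
  by have [g [h1 h2 _]] := projection S hf; exists g.
have PL2 S f : L2 f -> L2 (P (S, f)) by move=> /(hP (S, f))[].
have Pf S f k : L2 f -> fourier (P (S, f)) k = if S k then fourier f k else 0.
  by move=> /(hP (S, f))[].
have PB S f g : L2 f -> L2 g ->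
    msq (fun t => P (S, f) t - P (S, g) t) <= msq (fun t => f t - g t).
  move=> hf hg; have hPf := PL2 S _ hf; have hPg := PL2 S _ hg.
  apply: msq_le_coefs; [exact: L2B..|] => k.
  rewrite !fourierB; try exact: L2_L1.
  by rewrite !Pf//; case: (S k) => //; rewrite subrr cabs20 cabs2_ge0.
pose Bf A := P ((fun k => n <= k), fun t => r t * A t).
pose Tf A := P ((fun k => k <= 0), fun t => cj (r t) * Bf A t).
have L2Bf A : L2 A -> L2 (Bf A) by move=> hA; apply: PL2; exact: L2_r.
have L2Tf A : L2 A -> L2 (Tf A) by move=> hA; apply: PL2; apply: L2_rJ; exact: L2Bf.
have contr A A' : L2 A -> L2 A' ->
    msq (fun t => Tf A t - Tf A' t) <= q ^+ 2 * msq (fun t => A t - A' t).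
  move=> hA hA'; case/andP: q01 => q0 _; have hB := L2Bf _ hA; have hB' := L2Bf _ hA'.
  apply: (@le_trans _ _ (q * msq (fun t => Bf A t - Bf A' t))).
    apply: le_trans (PB _ _ _ (L2_rJ hB) (L2_rJ hB')) _.
    under [X in msq X <= _]eq_fun do rewrite -mulrBr.
    by apply: msq_bdd rqJ _ => //; exact: L2B.
  rewrite expr2 -mulrA ler_wpM2l//.
  apply: le_trans (PB _ _ _ (L2_r hA) (L2_r hA')) _.
  under [X in msq X <= _]eq_fun do rewrite -mulrBr.
  by apply: msq_bdd rq _ => //; exact: L2B.
pose f (k : nat) : R -> R[i] := iter k (fun A t => 1 - Tf A t) (fun=> 1).
have fS (k : nat) t : f k.+1 t = 1 - Tf (f k) t by [].
have L2f (k : nat) : L2 (f k).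
  elim: k => [|k IH]; first exact: L2_cst.
  by apply: L2B; [exact: L2_cst|exact: (L2Tf (f k) IH)].
case/andP: (q01) => q0 q1.
have dstep (k : nat) : nrm (fun t => f k.+2 t - f k.+1 t) <= q * nrm (fun t => f k.+1 t - f k t).
  rewrite -ler_sqr ?nnegrE ?mulr_ge0 ?nrm_ge0// exprMn !sqr_nrm.
  apply: le_trans (contr _ _ (L2f k.+1) (L2f k)); rewrite msqBC le_eqVlt; apply/orP; left.
  by apply/eqP; congr msq; apply/funext => t; rewrite !fS opprB addrC addrA subrK.
have dgeo (k : nat) : nrm (fun t => f k.+1 t - f k t) <= nrm (fun t => f 1%N t - f 0%N t) * q ^+ k.
  elim: k => [|k IH]; first by rewrite expr0 mulr1.
  by rewrite (le_trans (dstep k))// exprS mulrCA ler_wpM2l.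
have [A [L2A cA]] := L2_geometric q01 L2f dgeo.
have L2B' := L2Bf _ L2A; have L2T := L2Tf _ L2A.
have eqA : aeT (fun t => A t = 1 - Tf A t).
  apply: (@cvgL2_uniq _ (fun k : nat => f k.+1) A (fun t => 1 - Tf A t)) => //.
  - by apply: L2B => //; exact: L2_cst.
  - by have := cA; rewrite /cvgL2 -cvg_shiftS.
  - have lim0 : (fun k : nat => q ^+ 2 * msq (fun t => f k t - A t)) @ \oo --> (0 : R).
      by rewrite -[X in _ --> X](mulr0 (q ^+ 2)); apply: cvgMr.
    apply: (squeeze_cvgr _ (cvg_cst 0) lim0); apply: nearW => k; rewrite msq_ge0 /=.
    apply: le_trans (contr _ _ (L2f k) L2A); rewrite msqBC le_eqVlt; apply/orP; left.
    by apply/eqP; congr msq; apply/funext => t; rewrite opprB addrC addrA subrK.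
have fA k : fourier A k = (k == 0)%:R - fourier (Tf A) k.
  rewrite (fourier_ae k (L2_meas L2A) _ eqA); last first.
    by apply: L2_meas; apply: L2B => //; exact: L2_cst.
  rewrite fourierB; [|exact: L1_cst|exact: L2_L1].
  by rewrite fourier_cst; case: (k == 0).
have fU k : k <= 0 -> fourier (Uf A (Bf A)) k = (k == 0)%:R.
  move=> k0; rewrite fourierD; [|exact: L2_L1|by apply: L2_L1; exact: L2_rJ].
  rewrite fA /Tf Pf ?k0 ?subrK//; exact: L2_rJ.
exists A, (Bf A); split.
- split => // k k0; rewrite fA /Tf Pf ?(negbTE k0) ?subr0; last exact: L2_rJ.
  by have [e|//] := eqVneq k 0; rewrite e lexx in k0.
- split => // k k0; rewrite /Bf Pf ?(negbTE k0)//; exact: L2_r.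
- split; first exact: L2_U.
  by move=> k; rewrite -ltNge => k0; rewrite fU ?(ltW k0)// lt_eqF.
- by rewrite fU.
- split; first exact: L2_V.
  move=> k; rewrite -ltNge ltrBlDr ltzD1 => nk.
  rewrite fourierB; [|by apply: L2_L1; exact: L2_r|exact: L2_L1].
  by rewrite /Bf Pf ?nk ?subrr//; exact: L2_r.
Qed.

(** The difference (X, Y) solves the homogeneous system, in which [Uf X Y] and X have disjoint
    spectra, and likewise [Vf X Y] and Y; the energy identity leaves msq X + msq Y = 0. *)
Lemma sol_uniq n A B A' B' : Sol n A B -> Sol n A' B' ->
  aeT (fun t => A t = A' t) /\ aeT (fun t => B t = B' t).
Proof.
move=> [hA hB hU U1 hV] [hA' hB' hU' U1' hV'].
pose X t := A t - A' t; pose Y t := B t - B' t.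
have hX : Hle 0 X by exact: SuppB.
have hY : Hge n Y by exact: SuppB.
have UE : Uf X Y = fun t => Uf A B t - Uf A' B' t.
  by apply/funext => t; rewrite /Uf /X /Y mulrBr opprD addrACA.
have hUX : Hge 0 (Uf X Y) by rewrite UE; exact: SuppB.
have hVX : Hle (n - 1) (Vf X Y).
  rewrite (_ : Vf X Y = fun t => Vf A B t - Vf A' B' t); first exact: SuppB.
  by apply/funext => t; rewrite /Vf /X /Y mulrBr [in LHS]opprD addrACA -opprD.
have U0 : fourier (Uf X Y) 0 = 0.
  by rewrite UE fourierB ?U1 ?U1' ?subrr//; apply: L2_L1; [case: hU|case: hU'].
have [L2X _] := hX; have [L2Y _] := hY.
have V0 : inp (Vf X Y) Y = 0.
  apply: inp_disj L2Y _; first by case: hVX.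
  move=> k; have [nk|nk] := leP n k.
    by rewrite (Hle_fourier0 hVX) ?mul0r// ltrBlDr ltzD1.
  by rewrite (Hge_fourier0 hY)// cj0 mulr0.
have U0' : inp (Uf X Y) X = 0.
  apply: inp_disj L2X _; first by case: hUX.
  move=> k; have [k0|k0|->] := ltgtP k 0; last by rewrite U0 mul0r.
  - by rewrite (Hge_fourier0 hUX)// mul0r.
  - by rewrite (Hle_fourier0 hX)// cj0 mulr0.
have := energy L2X L2Y; rewrite V0 U0'.
rewrite subrr => /eqP; rewrite paddr_eq0 ?msq_ge0// => /andP[/eqP x0 /eqP y0].
split; [apply: filterS (msq0_ae L2X x0)|apply: filterS (msq0_ae L2Y y0)] => t /eqP;
  by rewrite subr_eq0 => /eqP.
Qed.

(** |A|^2 + |B|^2 = A cj(U) - cj(B) V, where the first product has frequencies <= 0 and the second <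
    0. A real function of this kind is constant, and its mean is that of A because U has mean 1. *)
Lemma sol_const n A B : Sol n A B -> exists K : R,
  [/\ 0 < K, fourier A 0 = K%:C, msq A + msq B = K & aeT (fun t => cabs2 (A t) + cabs2 (B t) = K)].
Proof.
move=> [hA hB hU U1 hV].
have [L2A _] := hA; have [L2B _] := hB; have [L2U _] := hU; have [L2V _] := hV.
have hUJ := HgeJ hU; rewrite oppr0 in hUJ.
have hBJ := HgeJ hB.
pose phi t : R[i] := (cabs2 (A t) + cabs2 (B t))%:C.
have phiE : phi = (fun t => A t * cj (Uf A B t) - cj (B t) * Vf A B t).
  by apply/funext => t; rewrite /phi /Uf /Vf rmorphD /= !cabs2E cjD cjM cjK; ring.
have L1a : L1 (fun t => A t * cj (Uf A B t)) by exact: L2_inp.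
have L1b : L1 (fun t => cj (B t) * Vf A B t) by apply: L2M => //; exact: L2J.
have L1phi : L1 phi by rewrite phiE; exact: L1B.
have [p1 p2] := HleM_fourier hA hUJ; rewrite !addr0 in p1 p2.
have [p3 _] := HleM_fourier hBJ hV.
have m1 : - n + (n - 1) = -1 by rewrite addrA addNr sub0r.
rewrite m1 in p3.
have phi0 : fourier phi 0 = fourier A 0.
  rewrite phiE fourierB// p2 p3// subr0 fourierJ; last exact: L2_L1.
  by rewrite oppr0 U1 cj1 mulr1.
have phic : aeT (fun t => phi t = fourier A 0).
  rewrite -phi0; apply: real_L1_const => // [t|k k0]; first exact: cjR.
  rewrite phiE fourierB// p1// p3 ?subr0//; exact: lt_trans k0.
pose K := complex.Re (fourier A 0).
have [t0 _ ht0] := aeT_ex phic.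
have AK : fourier A 0 = K%:C by rewrite /K -ht0.
have Kae : aeT (fun t => cabs2 (A t) + cabs2 (B t) = K).
  by apply: filterS phic => t; rewrite AK => /complexI.
have mK : msq A + msq B = K.
  have := energy L2A L2B.
  rewrite (inp_single (m := 0) L2U L2A); last first.
    move=> k; rewrite neq_lt => /orP[k0|k0]; first by rewrite (Hge_fourier0 hU)// mul0r.
    by rewrite (Hle_fourier0 hA)// cj0 mulr0.
  rewrite U1 mul1r Re_conj AK inp_disj ?subr0// => k; have [nk|nk] := leP n k.
    by rewrite (Hle_fourier0 hV) ?mul0r// ltrBlDr ltzD1.
  by rewrite (Hge_fourier0 hB)// cj0 mulr0.
exists K; split => //.
(* K = 0 would force A = B = 0, so that U would have mean 0 instead of 1. *)
rewrite lt_neqAle -mK addr_ge0 ?msq_ge0// andbT; apply/eqP => /esym /eqP.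
rewrite paddr_eq0 ?msq_ge0// => /andP[/eqP /(msq0_ae L2A) A0 /eqP /(msq0_ae L2B) B0].
have U0 : fourier (Uf A B) 0 = 0.
  rewrite -[RHS](_ : fourier (fun=> 0) 0 = 0); last by rewrite fourier_cst.
  apply: fourier_ae; [exact: L2_meas|exact: measC_cst|].
  by apply: filterS2 A0 B0 => t a0 b0; rewrite /Uf a0 b0 mulr0 addr0.
by move: U1; rewrite U0 => /eqP; rewrite eq_sym oner_eq0.
Qed.

End Solution.

(** * Factorizations of (a, b) *)

Section PairAlgebra.
Variable R : realType.
Implicit Types (x y u v : R[i]).

Lemma unit_pairE x y : cabs2 x + cabs2 y = 1 -> x * cj x + y * cj y = 1.
Proof. by rewrite -!cabs2E -rmorphD /= => ->. Qed.

Lemma cabs2_pmulA x y u v :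
  cabs2 (x * u - y * cj v) + cabs2 (x * v + y * cj u) =
  (cabs2 x + cabs2 y) * (cabs2 u + cabs2 v).
Proof. by rewrite /cabs2 !ReImE; ring. Qed.

(** Multiplication on the right by (cj x, - y), the inverse of the unitary pair (x, y). *)
Lemma pair_left_solve x y u v (a b : R[i]) : cabs2 x + cabs2 y = 1 ->
  a = u * x - v * cj y -> b = u * y + v * cj x ->
  u = a * cj x + b * cj y /\ v = b * x - a * y.
Proof.
move=> /unit_pairE h -> ->; split.
  by rewrite -[LHS]mulr1 -h; ring.
by rewrite -[LHS]mulr1 -h; ring.
Qed.

Lemma pair_right_solve x y u v (a b : R[i]) : cabs2 x + cabs2 y = 1 ->
  u = a * cj x + b * cj y -> v = b * x - a * y ->
  a = u * x - v * cj y /\ b = u * y + v * cj x.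
Proof.
move=> /unit_pairE h -> ->; split.
  by rewrite -[LHS]mulr1 -h; ring.
by rewrite -[LHS]mulr1 -h; ring.
Qed.

Lemma posCP (z : R[i]) : 0 < z -> exists2 x : R, 0 < x & z = x%:C.
Proof.
case: z => x y; rewrite ltcE /= => /andP[/eqP -> x0]; by exists x.
Qed.

Lemma posC (x : R) : 0 < x -> 0 < x%:C.
Proof. by rewrite ltcR. Qed.

End PairAlgebra.

(** Frequencies of modulus at least M do not occur in the M-th partial sum, so the projection is
    dominated by a Fourier tail of f. *)
Lemma proj_tail (R : realType) (f : R -> R[i]) (e : R) : L2 f -> 0 < e ->
  exists M : nat, forall (S : pred int) g, L2 g ->
    (forall k, fourier g k = if S k then fourier f k else 0) ->
    (forall k : int, S k -> (M <= `|k|)%N) -> msq g <= e.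
Proof.
move=> hf e0; have /cvgrPdist_le /(_ _ e0) [M _ hM] := cvg_tsum hf.
exists M => S g hg gS SM.
have := hM M (leqnn M); rewrite /= sub0r normrN ger0_norm ?msq_ge0// => h.
apply: le_trans h; have hT := L2_tsum (coefs f) (iota 0 M).
apply: msq_le_coefs => //; first exact: L2B.
move=> k; rewrite gS; case: ifPn => Sk; last by rewrite cabs20 cabs2_ge0.
rewrite fourierB; [|exact: L2_L1..]; rewrite fourier_tsum ?iota_uniq// mem_iota add0n.
rewrite ifN ?sub0r ?cabs2N//; rewrite leq0n /= -leqNgt (leq_trans (SM _ Sk))//.
by have := absz_znth_le (zidx k); rewrite zidxK.
Qed.

Lemma fourier0_le1 (R : realType) (f : R -> R[i]) (x : R) : L2 f ->
  aeT (fun t => cabs2 (f t) <= 1) -> fourier f 0 = x%:C -> 0 < x -> x <= 1.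
Proof.
move=> hf f1 fx x0.
have [|_] := @msq_ae_le _ 1 f (fun=> 1) ler01 (L2_meas hf) (L2_cst _).
  by apply: filterS f1 => t; rewrite cabs21 mulr1.
have -> : msq (fun=> 1 : R[i]) = 1 :> R.
  by rewrite -(@msq_e R 0); congr msq; apply/funext => t; rewrite e_0.
rewrite mul1r => h; have := le_trans (fourier_le 0 hf) h.
by rewrite fx cabs2_real -[X in _ <= X](expr1n _ 2) ler_sqr ?nnegrE// ltW.
Qed.

(* (a, b) = (la, lb)(ra, rb), where the left factor carries the frequencies
   below n and the right factor those from n on. *)
Record Fac (R : realType) (a b : R -> R[i]) (n : int) (ra rb la lb : R -> R[i]) : Prop := MkFac {
  fac_ra : Hle 0 ra; fac_rb : Hge n rb; fac_la : Hle 0 la; fac_lb : Hle (n - 1) lb;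
  fac_ra0 : 0 < fourier ra 0; fac_la0 : 0 < fourier la 0;
  fac_r1 : aeT (fun t => cabs2 (ra t) + cabs2 (rb t) = 1);
  fac_l1 : aeT (fun t => cabs2 (la t) + cabs2 (lb t) = 1);
  fac_a : aeT (fun t => a t = la t * ra t - lb t * cj (rb t));
  fac_b : aeT (fun t => b t = la t * rb t + lb t * cj (ra t)) }.

Section Factorization.
Variables (R : realType) (a b : R -> R[i]) (alpha c : R).
Hypotheses (ma : measC a) (mb : measC b).
Hypothesis hab : aeT (fun t => cabs2 (a t) + cabs2 (b t) = 1).
Hypothesis ha : Hle 0 a.
Hypotheses (ainf : fourier a 0 = alpha%:C) (alpha0 : 0 < alpha).
Hypotheses (hc : 2^-1 < c) (ca : aeT (fun t => c <= cabs2 (a t))).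
Hypothesis hai : Hle 0 (fun t => (a t)^-1).
Implicit Types (f g h A B ra rb la lb : R -> R[i]) (n k : int).

Let r t := b t / a t.
(** |b / a|^2 = 1 / |a|^2 - 1 <= 1 / c - 1, which is below 1 exactly because c > 1/2. *)
Let q := (1 - c) / c.

Let c0 : 0 < c. Proof. by apply: lt_trans hc; rewrite invr_gt0. Qed.

Let q01 : 0 <= q < 1.
Proof.
have [t [t1 t2]] : exists t, c <= cabs2 (a t) /\ cabs2 (a t) + cabs2 (b t) = 1.
  by have [t _ h] := aeT_ex (aeTI ca hab); exists t.
have := cabs2_ge0 (b t) => b0.
rewrite /q divr_ge0 ?(ltW c0)//=; last by lra.
by rewrite ltr_pdivrMr// mul1r; have := hc; lra.
Qed.

Let mr : measC r. Proof. by apply: measCM => //; exact: measCV. Qed.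

Let rq : aeT (fun t => cabs2 (r t) <= q).
Proof.
apply: filterS2 ca hab => t h1 h2; rewrite /r cabs2M cabs2V /q.
have b1 : cabs2 (b t) <= 1 - c by lra.
apply: ler_pM => //; rewrite ?cabs2_ge0 ?invr_ge0 ?cabs2_ge0//.
by rewrite lef_pV2 ?posrE// (lt_le_trans c0).
Qed.

Let a_neq0 : aeT (fun t => a t != 0).
Proof. by apply: filterS ca => t h; rewrite -cabs2_gt0 (lt_le_trans c0). Qed.

Let a_le1 : aeT (fun t => cabs2 (a t) <= 1).
Proof. by apply: filterS hab => t <-; rewrite lerDl cabs2_ge0. Qed.

Let ai_le : aeT (fun t => cabs2 (a t)^-1 <= c^-1).
Proof. by apply: filterS ca => t h; rewrite cabs2V lef_pV2 ?posrE// (lt_le_trans c0). Qed.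

Let ainf_inv : fourier (fun t => (a t)^-1) 0 = (alpha^-1)%:C.
Proof.
have [_] := HleM_fourier ha hai; rewrite addr0 ainf => h.
have h1 : fourier (fun t => a t * (a t)^-1) 0 = 1.
  rewrite -[RHS](_ : fourier (fun=> 1) 0 = 1); last by rewrite fourier_cst.
  apply: fourier_ae; [by apply: measCM => //; exact: measCV|exact: measC_cst|].
  by apply: filterS a_neq0 => t at0; rewrite divff.
have aC : alpha%:C != 0 by rewrite -(rmorph0 (real_complex R)) (inj_eq (@complexI R)) gt_eqF.
by apply: (mulfI aC); rewrite -h h1 -rmorphM divff ?gt_eqF.
Qed.

(** K^(-1/2) makes (A, B) unitary. The left factor is the same constant times a (cj U, V): its
    spectra are right because a has frequencies <= 0 and |a| <= 1, and its first component has mean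
    alpha K^(-1/2) > 0. *)
Lemma Fac_of_Sol n A B : Sol r n A B -> exists ra rb la lb, Fac a b n ra rb la lb.
Proof.
move=> hS; have [K [K0 AK _ Kae]] := sol_const mr rq hS.
have [hA hB hU U1 hV] := hS.
pose kap := (Num.sqrt K)^-1.
have sK0 : 0 < Num.sqrt K by rewrite sqrtr_gt0.
have kap0 : 0 < kap by rewrite invr_gt0.
have kapK : kap ^+ 2 * K = 1 by rewrite /kap exprVn sqr_sqrtr ?mulVf ?gt_eqF// ltW.
pose U := Uf r A B; pose V := Vf r A B.
have hUJ := HgeJ hU; rewrite oppr0 in hUJ.
have L2aU : L2 (fun t => a t * cj (U t)) by apply: L2_bdd a_le1 _ => //; case: hUJ.
have L2aV : L2 (fun t => a t * V t) by apply: L2_bdd a_le1 _ => //; case: hV.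
have haU := HleM ha hUJ L2aU; rewrite addr0 in haU.
have haV := HleM ha hV L2aV; rewrite add0r in haV.
have [_ aU0] := HleM_fourier ha hUJ; rewrite addr0 ainf in aU0.
have r1 : aeT (fun t => cabs2 (kap%:C * A t) + cabs2 (kap%:C * B t) = 1).
  by apply: filterS Kae => t h; rewrite !cabs2M !cabs2_real -mulrDr h.
have solve : aeT (fun t =>
    kap%:C * (a t * cj (U t)) = a t * cj (kap%:C * A t) + b t * cj (kap%:C * B t) /\
    kap%:C * (a t * V t) = b t * (kap%:C * A t) - a t * (kap%:C * B t)).
  apply: filterS a_neq0 => t at0; rewrite /U /V /Uf /Vf !(cjD, cjM, cjK, cjR) /r.
  by split; field.
exists (fun t => kap%:C * A t), (fun t => kap%:C * B t),
  (fun t => kap%:C * (a t * cj (U t))), (fun t => kap%:C * (a t * V t)); split.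
- exact: SuppZ.
- exact: SuppZ.
- exact: SuppZ.
- exact: SuppZ.
- rewrite fourierZ ?AK -?rmorphM; last by apply: L2_L1; case: hA.
  by apply: posC; rewrite mulr_gt0.
- rewrite fourierZ; last exact: L2_L1.
  rewrite aU0 fourierJ; last by apply: L2_L1; case: hU.
  by rewrite oppr0 U1 cj1 mulr1 -rmorphM; apply: posC; rewrite mulr_gt0.
- exact: r1.
- apply: filterS2 (aeTI r1 solve) hab => t [h1 [-> ->]] h2.
  have := cabs2_pmulA (a t) (b t) (cj (kap%:C * A t)) (- (kap%:C * B t)).
  rewrite h2 mul1r cabs2J cabs2N h1 => <-.
  by congr (cabs2 _ + cabs2 _); rewrite ?cjN ?cjK; ring.
- by apply: filterS2 r1 solve => t h1 [h2 h3]; have [] := pair_right_solve h1 h2 h3.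
- by apply: filterS2 r1 solve => t h1 [h2 h3]; have [] := pair_right_solve h1 h2 h3.
Qed.

Lemma Fac_exists n : exists ra rb la lb, Fac a b n ra rb la lb.
Proof. by have [A [B h]] := sol_exists mr q01 rq n; exact: Fac_of_Sol h. Qed.

Lemma Fac_ratio n ra rb la lb : Fac a b n ra rb la lb ->
  aeT (fun t => la t / a t = cj (ra t) + r t * cj (rb t) /\ lb t / a t = r t * ra t - rb t).
Proof.
move=> F; apply: filterS3 a_neq0 (fac_r1 F) (aeTI (fac_a F) (fac_b F)) => t at0 h1 [h2 h3].
have [h4 h5] := pair_left_solve h1 h2 h3.
by rewrite h4 h5 /r; split; field.
Qed.

(** This is where the reciprocal of a enters: its spectrum and its bound let the conditions on the
    left factor survive the division. *)
Lemma Fac_ratio_Hle n ra rb la lb : Fac a b n ra rb la lb ->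
  [/\ Hle 0 (fun t => la t / a t), Hle (n - 1) (fun t => lb t / a t) &
      fourier (fun t => la t / a t) 0 = fourier la 0 * (alpha^-1)%:C].
Proof.
move=> F; have hla := fac_la F; have hlb := fac_lb F.
have mai : measC (fun t => (a t)^-1) by exact: measCV.
have L1' f : L2 f -> L2 (fun t => f t / a t).
  by move=> hf; under eq_fun do rewrite mulrC; apply: L2_bdd ai_le hf.
have [_ e] := HleM_fourier hla hai; rewrite addr0 ainf_inv in e.
split=> //.
- by rewrite -[X in Hle X](addr0 0); apply: HleM => //; apply: L1'; case: hla.
- by rewrite -[X in Hle X](addr0 (n - 1)); apply: HleM => //; apply: L1'; case: hlb.
Qed.

(** The mean 1 of U forces x = alpha / la^(0). The constant K of this solution is x^2 by unitarity
    and also the mean of x ra, whence ra^(0) = x: the means of the two factors multiply to alpha. *)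
Lemma Sol_of_Fac n ra rb la lb : Fac a b n ra rb la lb -> exists x : R,
  [/\ 0 < x, fourier ra 0 = x%:C, fourier la 0 = (alpha / x)%:C &
      Sol r n (fun t => x%:C * ra t) (fun t => x%:C * rb t)].
Proof.
move=> F; have [y y0 ye] := posCP (fac_la0 F).
have [hla hlb la0] := Fac_ratio_Hle F; rewrite ye -rmorphM in la0.
pose x := alpha / y; have x0 : 0 < x by rewrite divr_gt0.
have ratio := Fac_ratio F.
have hra := fac_ra F; have hrb := fac_rb F.
have [L2ra _] := hra; have [L2rb _] := hrb.
pose A t := x%:C * ra t; pose B t := x%:C * rb t.
have L2A : L2 A by exact: L2Z. have L2B : L2 B by exact: L2Z.
have mU : measC (Uf r A B) by apply: L2_meas; exact: L2_U rq _ _ L2A L2B.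
have mV : measC (Vf r A B) by apply: L2_meas; exact: L2_V rq _ _ L2A L2B.
have hlaJ := HleJ hla; rewrite oppr0 in hlaJ.
have UE : aeT (fun t => x%:C * cj (la t / a t) = Uf r A B t).
  by apply: filterS ratio => t [-> _]; rewrite /Uf /A /B cjD cjM !cjK; ring.
have VE : aeT (fun t => x%:C * (lb t / a t) = Vf r A B t).
  by apply: filterS ratio => t [_ ->]; rewrite /Vf /A /B; ring.
have S : Sol r n A B.
  split; [exact: SuppZ|exact: SuppZ| | |].
  - by apply: Supp_ae UE _ => //; exact: SuppZ.
  - rewrite -(fourier_ae 0 _ mU UE); last first.
      by apply: measCM; [exact: measC_cst|apply: L2_meas; case: hlaJ].
    rewrite fourierZ; last by apply: L2_L1; case: hlaJ.
    rewrite fourierJ ?oppr0 ?la0 ?cjR -?rmorphM; last by apply: L2_L1; case: hla.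
    by rewrite /x (_ : alpha / y * (y / alpha) = 1) ?rmorph1//; field; rewrite !gt_eqF.
  - by apply: Supp_ae VE _ => //; exact: SuppZ.
have [K [K0 AK _ Kae]] := sol_const mr rq S.
have Kx : K = x ^+ 2.
  have [t _ [h1 h2]] := aeT_ex (aeTI Kae (fac_r1 F)).
  by rewrite -h1 /A /B !cabs2M !cabs2_real -mulrDr h2 mulr1.
exists x; split => //.
- move: AK; rewrite fourierZ ?Kx; last exact: L2_L1.
  have xC : x%:C != 0 by rewrite -(rmorph0 (real_complex R)) (inj_eq (@complexI R)) gt_eqF.
  by move=> h; apply: (mulfI xC); rewrite h expr2 rmorphM.
- by rewrite ye /x; congr _%:C; field; rewrite !gt_eqF.
Qed.

Lemma Fac_uniq n ra rb la lb ra' rb' la' lb' :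
  Fac a b n ra rb la lb -> Fac a b n ra' rb' la' lb' ->
  [/\ aeT (fun t => ra t = ra' t), aeT (fun t => rb t = rb' t),
      aeT (fun t => la t = la' t) & aeT (fun t => lb t = lb' t)].
Proof.
move=> F F'; have [x [x0 ex _ S]] := Sol_of_Fac F; have [x' [x0' ex' _ S']] := Sol_of_Fac F'.
have [eA eB] := sol_uniq mr rq S S'.
have L2ra := (fac_ra F).1; have L2ra' := (fac_ra F').1.
have xx : x = x'.
  have := fourier_ae 0 (L2_meas (L2Z x%:C L2ra)) (L2_meas (L2Z x'%:C L2ra')) eA.
  rewrite !fourierZ; try exact: L2_L1.
  rewrite ex ex' -!rmorphM => /complexI /eqP; rewrite -!expr2 eqrXn2 ?ltW// => /eqP //.
have xC : x%:C != 0 by rewrite -(rmorph0 (real_complex R)) (inj_eq (@complexI R)) gt_eqF.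
rewrite -xx in eA eB.
have era : aeT (fun t => ra t = ra' t) by apply: filterS eA => t /(mulfI xC).
have erb : aeT (fun t => rb t = rb' t) by apply: filterS eB => t /(mulfI xC).
have key : aeT (fun t => la t = la' t /\ lb t = lb' t).
  apply: filterS3 (aeTI era erb) (aeTI (fac_r1 F) (fac_r1 F'))
    (aeTI (aeTI (fac_a F) (fac_b F)) (aeTI (fac_a F') (fac_b F'))).
  move=> t [e1 e2] [h1 h1'] [[h2 h3] [h2' h3']].
  have [-> ->] := pair_left_solve h1 h2 h3; have [-> ->] := pair_left_solve h1' h2' h3'.
  by rewrite e1 e2.
by split => //; apply: filterS key => t [].
Qed.

Lemma Hge_Hle_const g h : Hge 0 g -> Hle 0 h -> aeT (fun t => g t = h t) ->
  exists z : R[i], aeT (fun t => g t = z).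
Proof.
move=> hg hh gh; exists (fourier g 0); apply: L1_const; first by apply: L2_L1; case: hg.
move=> k; rewrite neq_lt => /orP[k0|k0]; first exact: Hge_fourier0 hg k0.
rewrite (fourier_ae k _ _ gh); [exact: Hle_fourier0 hh k0|apply: L2_meas; by case: hg|].
by apply: L2_meas; case: hh.
Qed.

Lemma Fac_det n ra rb la lb : Fac a b n ra rb la lb ->
  aeT (fun t => ra t * (la t / a t) - cj (rb t) * (lb t / a t) = 1).
Proof.
move=> F; apply: filterS2 (Fac_ratio F) (fac_r1 F) => t [-> ->] /unit_pairE <-; ring.
Qed.

(** On the circle 1 / cj(g) = g, so the conjugate of f / g is g cj(f). *)
Lemma inner_mulJ f g : inner g -> H2D (fun t => f t / g t) -> L2 f ->
  Hle 0 (fun t => g t * cj (f t)).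
Proof.
move=> [hg g1] /H2D_Hge /HgeJ h hf; rewrite oppr0 in h.
have mg : measC g by case: hg => -[].
apply: Supp_ae h; first by apply: measCM => //; apply: measCJ; exact: L2_meas.
apply: filterS g1 => t gt.
have g0 : g t != 0 by rewrite -cabs2_gt0 gt ltr01.
by rewrite cjM cjV (mulVc_conj (w := cj (g t))) ?cabs2J ?gt ?invr1 ?mul1r ?cjK 1?mulrC// -cabs2_eq0 cabs2J gt oner_neq0.
Qed.

(** The terms are grouped as (g ra)(la / a) and (g cj(rb))(lb / a): division by a falls on the
    factor not multiplied by g, whose quotients are bounded, so that both products stay in L^2. *)
Lemma Fac_right_inner ra rb la lb g : Fac a b 0 ra rb la lb -> inner g ->
  H2D (fun t => cj (ra t) / g t) -> H2D (fun t => rb t / g t) ->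
  exists z : R[i], aeT (fun t => g t = z).
Proof.
move=> F ig h1 h2; have [hl1 hl2 _] := Fac_ratio_Hle F.
have g1 : Hle 0 (fun t => g t * ra t).
  by have := inner_mulJ ig h1 (L2J (fac_ra F).1); under eq_fun do rewrite cjK.
have g2 := inner_mulJ ig h2 (fac_rb F).1.
have [/H2D_Hge hg _] := ig.
have bl : aeT (fun t => cabs2 (la t / a t) <= c^-1 /\ cabs2 (lb t / a t) <= c^-1).
  apply: filterS2 ai_le (fac_l1 F) => t h h'; rewrite !cabs2M.
  have := cabs2_ge0 (la t); have := cabs2_ge0 (lb t) => p1 p2.
  split; rewrite -[leRHS]mul1r ler_pM ?cabs2_ge0//; lra.
have p1 : L2 (fun t => (g t * ra t) * (la t / a t)).
  under eq_fun do rewrite mulrC; apply: (@L2_bdd _ c^-1); [|by apply: filterS bl => t []|by case: g1].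
  by apply: L2_meas; case: hl1.
have p2 : L2 (fun t => (g t * cj (rb t)) * (lb t / a t)).
  under eq_fun do rewrite mulrC; apply: (@L2_bdd _ c^-1); [|by apply: filterS bl => t []|by case: g2].
  by apply: L2_meas; case: hl2.
have q1 := HleM g1 hl1 p1; have q2 := HleM g2 hl2 p2; rewrite !add0r in q1 q2.
have q2' : Hle 0 (fun t => (g t * cj (rb t)) * (lb t / a t)) by apply: HleW q2.
apply: (Hge_Hle_const hg (SuppB q1 q2')).
by apply: filterS (Fac_det F) => t h; rewrite -[LHS]mulr1 -h; ring.
Qed.

(** The grouping is now (ra / a)(g la) and (cj(rb) / a)(g lb), with the division by a on the right
    factor. *)
Lemma Fac_left_inner ra rb la lb g : Fac a b 0 ra rb la lb -> inner g ->
  H2D (fun t => cj (la t) / g t) -> H2D (fun t => cj (lb t) / g t) ->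
  exists z : R[i], aeT (fun t => g t = z).
Proof.
move=> F ig h1 h2.
have g1 : Hle 0 (fun t => g t * la t).
  by have := inner_mulJ ig h1 (L2J (fac_la F).1); under eq_fun do rewrite cjK.
have g2 : Hle 0 (fun t => g t * lb t).
  by have := inner_mulJ ig h2 (L2J (fac_lb F).1); under eq_fun do rewrite cjK.
have [/H2D_Hge hg _] := ig.
have hrb := HgeJ (fac_rb F); rewrite oppr0 in hrb.
have hra := fac_ra F.
have bl : aeT (fun t => cabs2 ((a t)^-1 * ra t) <= c^-1 /\ cabs2 ((a t)^-1 * cj (rb t)) <= c^-1).
  apply: filterS2 ai_le (fac_r1 F) => t h h'; rewrite !cabs2M cabs2J.
  have := cabs2_ge0 (ra t); have := cabs2_ge0 (rb t) => p1 p2.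
  split; rewrite -[leRHS]mulr1 ler_pM ?cabs2_ge0//; lra.
have mai : measC (fun t => (a t)^-1) by exact: measCV.
have r1 := HleM hai hra (L2_bdd mai ai_le hra.1).
have r2 := HleM hai hrb (L2_bdd mai ai_le hrb.1).
rewrite addr0 in r1 r2.
have p1 : L2 (fun t => ((a t)^-1 * ra t) * (g t * la t)).
  apply: (@L2_bdd _ c^-1); [|by apply: filterS bl => t []|by case: g1].
  by apply: L2_meas; case: r1.
have p2 : L2 (fun t => ((a t)^-1 * cj (rb t)) * (g t * lb t)).
  apply: (@L2_bdd _ c^-1); [|by apply: filterS bl => t []|by case: g2].
  by apply: L2_meas; case: r2.
have q1 := HleM r1 g1 p1; have q2 := HleM r2 g2 p2; rewrite addr0 in q1 q2.
apply: (Hge_Hle_const hg (SuppB q1 q2)).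
by apply: filterS (Fac_det F) => t h; rewrite -[LHS]mulr1 -h; ring.
Qed.

(** F is the value for which F e_n cj(ra) cancels the coefficient of rb at n. The mean of ra is
    multiplied by nu (1 + |F|^2), and nu = (1 + |F|^2)^(-1/2). *)
Lemma Fac_step n ra rb la lb (F : R[i]) (nu : R) : Fac a b n ra rb la lb ->
  F = fourier rb n / fourier ra 0 -> nu = (Num.sqrt (1 + cabs2 F))^-1 ->
  Fac a b (n + 1) (fun t => nu%:C * (ra t + F * e_ n t * cj (rb t)))
    (fun t => nu%:C * (rb t - F * e_ n t * cj (ra t)))
    (fun t => nu%:C * (la t - lb t * cj (F * e_ n t)))
    (fun t => nu%:C * (la t * (F * e_ n t) + lb t)) /\
  fourier (fun t => nu%:C * (ra t + F * e_ n t * cj (rb t))) 0 =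
    fourier ra 0 * (Num.sqrt (1 + cabs2 F))%:C.
Proof.
move=> Fc Fe nue.
have hra := fac_ra Fc; have hrb := fac_rb Fc; have hla := fac_la Fc; have hlb := fac_lb Fc.
have [x x0 ex] := posCP (fac_ra0 Fc); have [y y0 ey] := posCP (fac_la0 Fc).
have xC : x%:C != 0 by rewrite -(rmorph0 (real_complex R)) (inj_eq (@complexI R)) gt_eqF.
have F1 : 0 < 1 + cabs2 F by rewrite ltr_pwDl ?cabs2_ge0.
have s0 : 0 < Num.sqrt (1 + cabs2 F) by rewrite sqrtr_gt0.
have nu0 : 0 < nu by rewrite nue invr_gt0.
have nu2 : nu ^+ 2 * (1 + cabs2 F) = 1.
  by rewrite nue exprVn sqr_sqrtr ?mulVf ?gt_eqF// ltW.
have rbn : fourier rb n = F * x%:C by rewrite Fe ex divfK.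
have hrbJ := HgeJ hrb.
have h1 : Hle 0 (fun t => e_ n t * cj (rb t)).
  by have := Hle_shift n hrbJ; rewrite subrr.
have h2 : Hge n (fun t => e_ n t * cj (ra t)).
  by have := Hge_shift n (HleJ hra); rewrite oppr0 addr0.
have h3 : Hle (- 1) (fun t => e_ (- n) t * lb t).
  by have := Hle_shift (- n) hlb; rewrite addrA addNr sub0r.
have h4 : Hle n (fun t => e_ n t * la t).
  by have := Hle_shift n hla; rewrite addr0.
have A1 : (fun t => F * e_ n t * cj (rb t)) = (fun t => F * (e_ n t * cj (rb t))).
  by apply/funext => t; rewrite mulrA.
have A2 : (fun t => F * e_ n t * cj (ra t)) = (fun t => F * (e_ n t * cj (ra t))).
  by apply/funext => t; rewrite mulrA.
have H1 : Hle 0 (fun t => ra t + F * e_ n t * cj (rb t)).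
  by apply: SuppD => //; rewrite A1; exact: SuppZ.
have H2 : Hge n (fun t => rb t - F * e_ n t * cj (ra t)).
  by apply: SuppB => //; rewrite A2; exact: SuppZ.
have H2n : fourier (fun t => rb t - F * e_ n t * cj (ra t)) n = 0.
  rewrite fourierB; [|by apply: L2_L1; case: hrb|by rewrite A2; apply: L2_L1; apply: L2Z; case: h2].
  rewrite A2 fourierZ ?fourier_shift ?subrr ?fourierJ; [|by apply: L2_L1; case: hra|by apply: L2_L1; case: h2].
  by rewrite oppr0 ex cjR rbn subrr.
have H2' : Hge (n + 1) (fun t => rb t - F * e_ n t * cj (ra t)).
  split; first by case: H2.
  move=> k; rewrite -ltNge ltzD1 le_eqVlt => /orP[/eqP ->//|kn].
  exact: Hge_fourier0 H2 kn.
have E3 : (fun t => la t - lb t * cj (F * e_ n t)) =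
    (fun t => la t - cj F * (e_ (- n) t * lb t)).
  by apply/funext => t; rewrite cjM e_N; congr (_ - _); ring.
have h3' : Hle 0 (fun t => e_ (- n) t * lb t) by apply: HleW h3.
have H3 : Hle 0 (fun t => la t - lb t * cj (F * e_ n t)).
  by rewrite E3; apply: SuppB => //; exact: SuppZ.
have H4 : Hle n (fun t => la t * (F * e_ n t) + lb t).
  apply: SuppD; last by apply: HleW hlb; rewrite gerBl.
  have -> : (fun t => la t * (F * e_ n t)) = (fun t => F * (e_ n t * la t)).
    by apply/funext => t; ring.
  exact: SuppZ.
have ra1 : fourier (fun t => nu%:C * (ra t + F * e_ n t * cj (rb t))) 0 =
    (x * Num.sqrt (1 + cabs2 F))%:C.
  rewrite fourierZ; last by apply: L2_L1; case: H1.
  rewrite fourierD; [|by apply: L2_L1; case: hra|by rewrite A1; apply: L2_L1; apply: L2Z; case: h1].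
  rewrite A1 fourierZ ?fourier_shift ?fourierJ; [|by apply: L2_L1; case: hrb|by apply: L2_L1; case: h1].
  rewrite sub0r opprK rbn cjM cjR mulrA -cabs2E ex -rmorphM -rmorphD -rmorphM.
  congr _%:C; have -> : x + cabs2 F * x = x * (1 + cabs2 F) by ring.
  rewrite mulrCA; congr (_ * _); rewrite nue -{2}(@sqr_sqrtr _ (1 + cabs2 F)) ?(ltW F1)//.
  by rewrite expr2 mulrA mulVf ?mul1r// gt_eqF.
have fe t : cabs2 (F * e_ n t) = cabs2 F by rewrite cabs2M cabs2_e mulr1.
split; last by rewrite ra1 ex rmorphM.
split; [exact: SuppZ|exact: SuppZ|exact: SuppZ|by rewrite addrK; exact: SuppZ| | | | | |].
- by rewrite ra1; apply: posC; rewrite mulr_gt0.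
- rewrite fourierZ; last by apply: L2_L1; case: H3.
  rewrite E3 fourierB; [|by apply: L2_L1; case: hla|by apply: L2_L1; apply: L2Z; case: h3].
  rewrite fourierZ; last by apply: L2_L1; case: h3.
  by rewrite (Hle_fourier0 h3)// mulr0 subr0 ey -rmorphM; apply: posC; rewrite mulr_gt0.
- apply: filterS (fac_r1 Fc) => t h.
  rewrite !cabs2M !cabs2_real -mulrDr.
  have := cabs2_pmulA 1 (- (F * e_ n t)) (ra t) (rb t).
  rewrite !mul1r !mulNr opprK => ->.
  by rewrite cabs21 cabs2N fe h mulr1.
- apply: filterS (fac_l1 Fc) => t h.
  rewrite !cabs2M !cabs2_real -mulrDr.
  have := cabs2_pmulA (la t) (lb t) 1 (F * e_ n t).
  rewrite cj1 !mulr1 => ->.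
  by rewrite cabs21 fe h mul1r.
- apply: filterS (fac_a Fc) => t ->.
  (* The elementary factor is unitary: it cancels against its inverse between the two new
     factors. *)
  have n2 : nu%:C * nu%:C * (1 + F * e_ n t * cj (F * e_ n t)) = 1.
    by rewrite -cabs2E fe -[X in X + _](rmorph1 (real_complex R)) -rmorphD -!rmorphM -expr2 nu2 rmorph1.
  rewrite -[LHS]mul1r -n2 !(cjD, cjM, cjN, cjK, cjR); ring.
- apply: filterS (fac_b Fc) => t ->.
  have n2 : nu%:C * nu%:C * (1 + F * e_ n t * cj (F * e_ n t)) = 1.
    by rewrite -cabs2E fe -[X in X + _](rmorph1 (real_complex R)) -rmorphD -!rmorphM -expr2 nu2 rmorph1.
  rewrite -[LHS]mul1r -n2 !(cjD, cjM, cjN, cjK, cjR); ring.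
Qed.

Lemma Fac_ra0_le1 n ra rb la lb : Fac a b n ra rb la lb -> complex.Re (fourier ra 0) <= 1.
Proof.
move=> F; have [x x0 ex] := posCP (fac_ra0 F); rewrite ex /=.
apply: (fourier0_le1 (fac_ra F).1 _ ex x0).
by apply: filterS (fac_r1 F) => t <-; rewrite lerDl cabs2_ge0.
Qed.

Lemma Fac_la0_le1 n ra rb la lb : Fac a b n ra rb la lb -> complex.Re (fourier la 0) <= 1.
Proof.
move=> F; have [x x0 ex] := posCP (fac_la0 F); rewrite ex /=.
apply: (fourier0_le1 (fac_la F).1 _ ex x0).
by apply: filterS (fac_l1 F) => t <-; rewrite lerDl cabs2_ge0.
Qed.

(** The solution is compared with (1, 0), which would be exact if r had no frequencies >= n. With p
    that part of r, the energy of the difference is Re <p, B>, hence at most [msq p], and A - 1 has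
    mean x^2 - 1. *)
Lemma Fac_lim_plus (e : R) : 0 < e -> exists M : nat, forall n ra rb la lb,
  (M%:Z <= n) -> Fac a b n ra rb la lb -> 1 - e <= complex.Re (fourier ra 0).
Proof.
move=> e0.
have L2r : L2 r.
  have -> : r = (fun t => r t * 1) by apply/funext => t; rewrite mulr1.
  exact: L2_bdd rq (L2_cst 1).
have e2 : 0 < e ^+ 2 by rewrite exprn_gt0.
have [M hM] := proj_tail L2r e2.
exists M => n ra rb la lb Mn F.
have [x [x0 ex _ S]] := Sol_of_Fac F; rewrite ex /=.
have x1 : x <= 1 by have := Fac_ra0_le1 F; rewrite ex.
have [hA hB hU U1 hV] := S.
have [p [L2p pf _]] := projection (fun k => n <= k) L2r.
have mp : msq p <= e ^+ 2.
  by apply: hM L2p pf _ => k nk; have := le_trans Mn nk; case: k {nk} => //= k; rewrite lez_nat.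
set A := (fun t => x%:C * ra t) in hA hU U1 hV; set B := (fun t => x%:C * rb t) in hB hU U1 hV.
have [L2A _] := hA; have [L2Bf _] := hB.
pose X t := A t - 1.
have hX : Hle 0 X by apply: SuppB => //; exact: Hle_cst.
have [L2X _] := hX.
have UE : Uf r X B = (fun t => Uf r A B t - 1).
  by apply/funext => t; rewrite /Uf /X addrAC.
have VE : Vf r X B = (fun t => Vf r A B t - r t).
  by apply/funext => t; rewrite /Vf /X mulrBr mulr1 addrAC.
have L2U := hU.1. have L2V := hV.1.
have U0 : inp (Uf r X B) X = 0.
  rewrite UE; apply: inp_disj => //; first by apply: L2B => //; exact: L2_cst.
  move=> k; rewrite fourierB ?fourier_cst; [|exact: L2_L1|exact: L1_cst].
  have [k0|k0|->] := ltgtP k 0; last by rewrite U1 subrr mul0r.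
  - by rewrite (Hge_fourier0 hU) ?sub0r ?oppr0 ?mul0r.
  - by rewrite (Hle_fourier0 hX)// cj0 mulr0.
have V0 : inp (Vf r X B) B = - inp p B.
  rewrite VE inpBl//.
  rewrite (inp_disj L2V L2Bf); last first.
    move=> k; have [nk|nk] := leP n k.
      by rewrite (Hle_fourier0 hV) ?mul0r// ltrBlDr ltzD1.
    by rewrite (Hge_fourier0 hB)// cj0 mulr0.
  rewrite sub0r; congr (- _); apply/eqP; rewrite -subr_eq0 -inpBl//; apply/eqP.
  apply: inp_disj => //; first exact: L2B.
  move=> k; rewrite fourierB; [|exact: L2_L1..]; rewrite pf.
  have [nk|nk] := leP n k; first by rewrite subrr mul0r.
  by rewrite (Hge_fourier0 hB)// cj0 mulr0.
have := energy mr rq L2X L2Bf; rewrite U0 V0 Re_opp opprK add0r => en.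
have := Re_inp_le L2p L2Bf; rewrite ler_norml => /andP[_ h].
have bp : nrm B <= nrm p.
  have [B0|B0] := leP (nrm B) 0; first exact: le_trans B0 (nrm_ge0 _).
  rewrite -(ler_pM2r B0) -expr2 sqr_nrm; have := msq_ge0 X; lra.
have mX : msq X <= e ^+ 2.
  apply: le_trans mp; rewrite -(sqr_nrm p) expr2.
  have : nrm p * nrm B <= nrm p * nrm p by rewrite ler_wpM2l// nrm_ge0.
  by have := msq_ge0 B; lra.
have X0 : fourier X 0 = (x ^+ 2 - 1)%:C.
  rewrite fourierB ?fourier_cst; [|exact: L2_L1|exact: L1_cst].
  by rewrite eqxx /A fourierZ ?ex -?rmorphM -?expr2 ?rmorphB ?rmorph1//; apply: L2_L1; case: (fac_ra F).
have := le_trans (fourier_le 0 L2X) mX; rewrite X0 cabs2_real => sq.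
have : `|x ^+ 2 - 1| <= e.
  by move: sq; rewrite -real_normK ?num_real// ler_sqr ?nnegrE ?normr_ge0// ltW.
rewrite ler_norml => /andP[lo _]; nra.
Qed.

(** The comparison is with alpha (a, b), for which [Vf] vanishes and [Uf] is alpha / cj(a), of mean
    1; it would be exact if b had no frequencies < n. With p that part of b, the energy of the
    difference is alpha Re <V, p>. *)
Lemma Fac_lim_minus (e : R) : 0 < e -> exists M : nat, forall n ra rb la lb,
  (n <= - M%:Z) -> Fac a b n ra rb la lb -> complex.Re (fourier ra 0) <= alpha + e.
Proof.
move=> e0.
have L2b : L2 b.
  have -> : b = (fun t => b t * 1) by apply/funext => t; rewrite mulr1.
  apply: (@L2_bdd _ 1) mb _ (L2_cst 1).
  by apply: filterS hab => t <-; rewrite lerDr cabs2_ge0.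
have L2a := ha.1.
(* x > alpha + e would give x^2 - alpha^2 > d. The norm of p is made at most d^2 / 2, which together
   with |V| <= 2 yields [msq X] <= d^2. *)
pose d := e * alpha.
have d0 : 0 < d by rewrite mulr_gt0.
have d4 : 0 < (d ^+ 2 / 2) ^+ 2 by rewrite exprn_gt0// divr_gt0// exprn_gt0.
have [M hM] := proj_tail L2b d4.
exists M.+1 => n ra rb la lb Mn F.
have [x [x0 ex _ S]] := Sol_of_Fac F; rewrite ex /=.
have x1 : x <= 1 by have := Fac_ra0_le1 F; rewrite ex.
have [hA hB hU U1 hV] := S.
have [K [K0 AK mK _]] := sol_const mr rq S.
have [p [L2p pf _]] := projection (fun k => k < n) L2b.
have mp : msq p <= (d ^+ 2 / 2) ^+ 2.
  by apply: hM L2p pf _ => k nk; clear -nk Mn; lia.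
set A := (fun t => x%:C * ra t) in hA hU U1 hV AK mK; set B := (fun t => x%:C * rb t) in hB hU U1 hV mK.
have [L2A _] := hA; have [L2B' _] := hB.
have Kx : K = x ^+ 2.
  apply: (@complexI R); rewrite -AK /A fourierZ ?ex -?rmorphM -?expr2//.
  by apply: L2_L1; case: (fac_ra F).
have alpha1 : alpha <= 1 := fourier0_le1 L2a a_le1 ainf alpha0.
pose X t := A t - alpha%:C * a t; pose Y t := B t - alpha%:C * b t.
have hX : Hle 0 X by apply: SuppB => //; exact: SuppZ.
have [L2X _] := hX.
have L2Y : L2 Y by apply: L2B => //; exact: L2Z.
have L2V := hV.1.
have VE : aeT (fun t => Vf r X Y t = Vf r A B t).
  by apply: filterS a_neq0 => t at0; rewrite /Vf /X /Y /r; field.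
have UE : aeT (fun t => Uf r X Y t = Uf r A B t - alpha%:C * cj (a t)^-1).
  apply: filterS2 a_neq0 hab => t at0 h.
  have ca0 : cj (a t) != 0 by rewrite -cabs2_eq0 cabs2J cabs2_eq0.
  rewrite /Uf /X /Y /r cjM cjV.
  have e1 : (cj (a t))^-1 = a t + cj (b t) / cj (a t) * b t.
    by apply: (mulfI ca0); rewrite divff// -(unit_pairE h); field.
  by rewrite [X in _ = _ - _ * X]e1; ring.
have haiJ := HleJ hai; rewrite oppr0 in haiJ.
have L2UX := L2_U mr rq L2X L2Y.
have fU k : fourier (Uf r X Y) k = fourier (Uf r A B) k - alpha%:C * fourier (fun t => cj (a t)^-1) k.
  rewrite (fourier_ae k (L2_meas L2UX) _ UE); last first.
    by apply: L2_meas; apply: L2B; [case: hU|apply: L2Z; case: haiJ].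
  by rewrite fourierB ?fourierZ//; apply: L2_L1; [case: haiJ|case: hU|apply: L2Z; case: haiJ].
have U0 : inp (Uf r X Y) X = 0.
  apply: inp_disj => // k; rewrite fU.
  have [k0|k0|->] := ltgtP k 0.
  - by rewrite (Hge_fourier0 hU)// (Hge_fourier0 haiJ)// mulr0 subrr mul0r.
  - by rewrite (Hle_fourier0 hX)// cj0 mulr0.
  - rewrite U1 fourierJ; last by apply: L2_L1; case: hai.
    by rewrite oppr0 ainf_inv cjR -rmorphM divff ?gt_eqF// rmorph1 subrr mul0r.
have mV : msq (Vf r A B) <= 2 ^+ 2.
  have q1 : q <= 1 by case/andP: q01 => _ /ltW.
  have h1 : msq (fun t => r t * A t) <= msq A.
    have := msq_bdd mr rq L2A; have := msq_ge0 A; nra.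
  have := msqB_le (L2_r mr rq L2A) L2B'; rewrite -/(Vf r A B) => h2.
  have K1 : K <= 1 by rewrite Kx expr_le1// ltW.
  by have := msq_ge0 A; have := msq_ge0 B; rewrite expr2; move: h1 h2 mK; lra.
have V0 : inp (Vf r X Y) Y = - (alpha%:C * inp (Vf r A B) p).
  have -> : inp (Vf r X Y) Y = inp (Vf r A B) Y.
    apply: avg_ae; [apply: measCM| apply: measCM |].
    - by apply: L2_meas; exact: L2_V mr rq _ _ L2X L2Y.
    - by apply: measCJ; exact: L2_meas.
    - exact: L2_meas.
    - by apply: measCJ; exact: L2_meas.
    - by apply: filterS VE => t ->.
  rewrite inpBr//; last exact: L2Z.
  rewrite (inp_disj L2V L2B'); last first.
    move=> k; have [nk|nk] := leP n k.
      by rewrite (Hle_fourier0 hV) ?mul0r// ltrBlDr ltzD1.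
    by rewrite (Hge_fourier0 hB)// cj0 mulr0.
  rewrite sub0r inpZr// cjR; congr (- (_ * _)).
  apply/eqP; rewrite -subr_eq0 -inpBr//; apply/eqP.
  apply: inp_disj => //; first exact: L2B.
  move=> k; rewrite fourierB; [|exact: L2_L1..]; rewrite pf.
  have [nk|nk] := ltP k n; first by rewrite subrr cj0 mulr0.
  by rewrite (Hle_fourier0 hV) ?mul0r// ltrBlDr ltzD1.
have := energy mr rq L2X L2Y; rewrite U0 V0 Re_opp opprK add0r => en.
have np : nrm p <= d ^+ 2 / 2.
  rewrite -ler_sqr ?nnegrE ?nrm_ge0 ?sqr_nrm//.
  by rewrite divr_ge0// sqr_ge0.
have nV : nrm (Vf r A B) <= 2 by rewrite -ler_sqr ?nnegrE ?nrm_ge0// sqr_nrm.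
have mX : msq X <= d ^+ 2.
  have := Re_inp_le L2V L2p; rewrite ler_norml => /andP[_ h].
  have h2 : nrm (Vf r A B) * nrm p <= 2 * (d ^+ 2 / 2) by apply: ler_pM; rewrite ?nrm_ge0.
  have h3 : complex.Re (alpha%:C * inp (Vf r A B) p) <= d ^+ 2.
    rewrite Re_mul /= mul0r subr0.
    have [neg|pos] := leP (complex.Re (inp (Vf r A B) p)) 0.
      by apply: (@le_trans _ _ 0); [rewrite mulr_ge0_le0// ltW|exact: sqr_ge0].
    apply: (@le_trans _ _ (complex.Re (inp (Vf r A B) p))); last by move: h h2; lra.
    by rewrite ler_piMl// ltW.
  by have := msq_ge0 Y; move: en h3; lra.
have X0 : fourier X 0 = (x ^+ 2 - alpha ^+ 2)%:C.
  rewrite fourierB; [|exact: L2_L1|by apply: L2_L1; exact: L2Z].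
  by rewrite AK Kx fourierZ ?ainf -?rmorphM -?expr2 ?rmorphB//; exact: L2_L1.
have := le_trans (fourier_le 0 L2X) mX; rewrite X0 cabs2_real => sq.
have : `|x ^+ 2 - alpha ^+ 2| <= d.
  by move: sq; rewrite -real_normK ?num_real// ler_sqr ?nnegrE ?normr_ge0// ltW.
rewrite ler_norml => /andP[_ up].
rewrite leNgt; apply/negP => lt; move: up; rewrite leNgt => /negP; apply.
have p1 : (x - alpha) * (x + alpha) = x ^+ 2 - alpha ^+ 2 by ring.
rewrite -p1 /d; apply: ltr_pM => //; [exact: ltW|exact: ltW| |]; lra.
Qed.

End Factorization.

(** * Finite nonlinear Fourier series *)

Section PairGroup.
Variable R : realType.
Implicit Types (p q x y : R[i] * R[i]).

(** Quaternion multiplication: [pnorm] is multiplicative, so unit pairs form a group and act by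
    isometries. *)
Definition pm p q : R[i] * R[i] :=
  (p.1 * q.1 - p.2 * cj q.2, p.1 * q.2 + p.2 * cj q.1).
Definition pinv p : R[i] * R[i] := (cj p.1, - p.2).
Definition pnorm p : R := cabs2 p.1 + cabs2 p.2.

Lemma pmA p q x : pm p (pm q x) = pm (pm p q) x.
Proof.
by rewrite /pm /= !(cjB, cjD, cjM, cjK); congr (_, _); ring.
Qed.

Lemma pm1l p : pm (1, 0) p = p.
Proof. by case: p => u v; rewrite /pm /= !mul1r !mul0r subr0 addr0. Qed.

Lemma pm1r p : pm p (1, 0) = p.
Proof. by case: p => u v; rewrite /pm /= cj0 cj1 !mulr1 !mulr0 subr0 add0r. Qed.

Lemma pmVr p : pnorm p = 1 -> pm p (pinv p) = (1, 0).
Proof.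
move=> h; rewrite /pm /= cjN cjK mulrN opprK; congr (_, _); last by ring.
by apply: unit_pairE.
Qed.

Lemma pmVl p : pnorm p = 1 -> pm (pinv p) p = (1, 0).
Proof.
move=> h; rewrite /pm /= mulNr opprK -(unit_pairE h); congr (_, _); ring.
Qed.

Lemma pnormM p q : pnorm (pm p q) = pnorm p * pnorm q.
Proof. exact: cabs2_pmulA. Qed.

Lemma pnormV p : pnorm (pinv p) = pnorm p.
Proof. by rewrite /pnorm /= cabs2J cabs2N. Qed.

Lemma pm_lcancel p x y : pnorm p = 1 -> x = pm p y -> y = pm (pinv p) x.
Proof. by move=> h ->; rewrite pmA pmVl// pm1l. Qed.

Lemma pm_rcancel p x y : pnorm p = 1 -> x = pm y p -> y = pm x (pinv p).
Proof. by move=> h ->; rewrite -pmA pmVr// pm1r. Qed.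

(** p q - p = p (q - 1), and [pnorm] is multiplicative. *)
Lemma pnorm_mul_dist p q : pnorm p = 1 ->
  pnorm ((pm p q).1 - p.1, (pm p q).2 - p.2) = pnorm (q.1 - 1, q.2).
Proof.
move=> h; rewrite -[RHS]mul1r -h -pnormM; congr pnorm; rewrite /pm /= cjB cj1.
by congr (_, _); ring.
Qed.

Lemma pnorm_dist_mul p q : pnorm p = 1 ->
  pnorm ((pm q p).1 - p.1, (pm q p).2 - p.2) = pnorm (q.1 - 1, q.2).
Proof.
move=> h; rewrite -[RHS]mulr1 -h -pnormM; congr pnorm; rewrite /pm /=.
by congr (_, _); ring.
Qed.

(* [pm] is multiplication of the matrices [[u, v], [- cj v, cj u]] in SU(2). *)
Definition pmx p : 'M[R[i]]_2 :=
  \matrix_(i < 2, j < 2) (if (i == 0 :> nat) then (if (j == 0 :> nat) then p.1 else p.2)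
   else (if (j == 0 :> nat) then - cj p.2 else cj p.1)).

Lemma pmxM p q : pmx p * pmx q = pmx (pm p q).
Proof.
apply/matrixP => i j; rewrite mxE !big_ord_recl big_ord0 !mxE /= addr0.
by case: ifP => _; case: ifP => _; rewrite ?(cjB, cjD, cjM, cjK); ring.
Qed.

Lemma pmx1 : pmx (1, 0) = 1.
Proof.
apply/matrixP => i j; rewrite !mxE /= cj1 cj0 oppr0.
by case: i => -[|[|//]] /= hi; case: j => -[|[|//]] /= hj.
Qed.

Lemma pmx_row p : (pmx p ord0 ord0, pmx p ord0 ord_max) = p.
Proof. by rewrite !mxE /=; case: p. Qed.

End PairGroup.

Section NonlinearProducts.
Variable R : realType.
Implicit Types (G : int -> R[i]) (m n : int) (t : R).

Definition nfac_scale (z : R[i]) : R := (Num.sqrt (1 + cabs2 z))^-1.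

Lemma nfac_scale_gt0 z : 0 < nfac_scale z.
Proof. by rewrite invr_gt0 sqrtr_gt0 ltr_pwDl ?cabs2_ge0. Qed.

Lemma nfac_scale2 z : nfac_scale z ^+ 2 * (1 + cabs2 z) = 1.
Proof.
have h : 0 < 1 + cabs2 z by rewrite ltr_pwDl ?cabs2_ge0.
by rewrite exprVn sqr_sqrtr ?mulVf ?gt_eqF// ltW.
Qed.

Definition nfac G n t : R[i] * R[i] :=
  ((nfac_scale (G n))%:C, (nfac_scale (G n))%:C * (G n * e_ n t)).

Definition nlf G m (len : nat) t : R[i] * R[i] := (nlftA G m len t, nlftB G m len t).

Lemma pnorm_nfac G n t : pnorm (nfac G n t) = 1.
Proof.
rewrite /pnorm /= !cabs2M cabs2_e cabs2_real mulr1 -[RHS](nfac_scale2 (G n)); ring.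
Qed.

Lemma nlf_factorE G n t : nlf_factor G n t = pmx (nfac G n t).
Proof.
apply/matrixP => i j; rewrite !mxE /= cjR cjM cjR.
case: ifP => _; case: ifP => _; rewrite ?mulr1// mulrN; congr (- (_ * _)).
by rewrite cjM -e_N /e_ mulrNz.
Qed.

Lemma nlf_prodSl G m len t :
  nlf_prod G m len.+1 t = nlf_factor G m t * nlf_prod G (m + 1) len t.
Proof.
rewrite /nlf_prod /= big_cons addr0; congr (_ * _).
suff -> : [seq m + i%:Z | i <- iota 1 len] = [seq m + 1 + i%:Z | i <- iota 0 len] by [].
rewrite (iotaDl 1 0 len) -map_comp; apply/eq_map => i /=.
by rewrite PoszD addrA.
Qed.

Lemma nlf_prodS G m len t :
  nlf_prod G m len.+1 t = nlf_prod G m len t * nlf_factor G (m + len%:Z) t.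
Proof. by rewrite /nlf_prod -[X in iota _ X]addn1 iotaD map_cat big_cat /= big_seq1. Qed.

Lemma nlf_prodE G m len t : nlf_prod G m len t = pmx (nlf G m len t).
Proof.
suff [p hp] : exists p, nlf_prod G m len t = pmx p.
  by rewrite /nlf /nlftA /nlftB hp pmx_row.
elim: len => [|len [p hp]]; first by exists (1, 0); rewrite pmx1 /nlf_prod big_nil.
by exists (pm p (nfac G (m + len%:Z) t)); rewrite nlf_prodS hp nlf_factorE pmxM.
Qed.

Lemma nlf0 G m t : nlf G m 0 t = (1, 0).
Proof. by rewrite -[LHS]pmx_row -nlf_prodE /nlf_prod big_nil -pmx1 pmx_row. Qed.

Lemma nlfS G m len t : nlf G m len.+1 t = pm (nlf G m len t) (nfac G (m + len%:Z) t).
Proof.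
by rewrite -[LHS]pmx_row -nlf_prodE nlf_prodS nlf_prodE nlf_factorE pmxM pmx_row.
Qed.

Lemma nlfSl G m len t : nlf G m len.+1 t = pm (nfac G m t) (nlf G (m + 1) len t).
Proof.
by rewrite -[LHS]pmx_row -nlf_prodE nlf_prodSl nlf_prodE nlf_factorE pmxM pmx_row.
Qed.

Lemma pnorm_nlf G m len t : pnorm (nlf G m len t) = 1.
Proof.
elim: len => [|len IH]; last by rewrite nlfS pnormM IH pnorm_nfac mulr1.
by rewrite nlf0 /pnorm /= cabs21 cabs20 addr0.
Qed.

(** The terms e_n cj(g) and e_n cj(f) have frequencies < 0 and >= n. Hence the mean of the first
    component is merely scaled, and the coefficient of the second at n comes from f alone, which
    later recovers G n. *)
Lemma nfac_mul_supp G n (f g : R -> R[i]) : Hle 0 f -> Hge (n + 1) g ->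
  let h t := pm (nfac G n t) (f t, g t) in
  [/\ Hle 0 (fun t => (h t).1), Hge n (fun t => (h t).2),
      fourier (fun t => (h t).1) 0 = (nfac_scale (G n))%:C * fourier f 0 &
      fourier (fun t => (h t).2) n = (nfac_scale (G n))%:C * (G n * cj (fourier f 0))].
Proof.
move=> hf hg h; set x := (nfac_scale (G n))%:C.
have h1 : Hle (- 1) (fun t => e_ n t * cj (g t)).
  by have := Hle_shift n (HgeJ hg); rewrite opprD addrA subrr sub0r.
have h2 : Hge n (fun t => e_ n t * cj (f t)).
  by have := Hge_shift n (HleJ hf); rewrite oppr0 addr0.
have hg' : Hge n g by apply: HgeW hg; rewrite lerDl.
have h1' : Hle 0 (fun t => e_ n t * cj (g t)) by exact: HleW h1.
have E1 : (fun t => (h t).1) = (fun t => x * (f t - G n * (e_ n t * cj (g t)))).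
  by apply/funext => t; rewrite /h /pm /= -/x; ring.
have E2 : (fun t => (h t).2) = (fun t => x * (g t + G n * (e_ n t * cj (f t)))).
  by apply/funext => t; rewrite /h /pm /= -/x; ring.
have H1 := SuppB hf (SuppZ (G n) h1'); have H2 := SuppD hg' (SuppZ (G n) h2).
rewrite E1 E2; split; [exact: SuppZ|exact: SuppZ| |].
- rewrite fourierZ; last exact: L2_L1 H1.1.
  rewrite fourierB; [|exact: L2_L1 hf.1|exact: L2_L1 (L2Z _ h1.1)].
  rewrite fourierZ; last exact: L2_L1 h1.1.
  by rewrite (Hle_fourier0 h1)// mulr0 subr0.
- rewrite fourierZ; last exact: L2_L1 H2.1.
  rewrite fourierD; [|exact: L2_L1 hg.1|exact: L2_L1 (L2Z _ h2.1)].
  rewrite fourierZ; last exact: L2_L1 h2.1.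
  rewrite (Hge_fourier0 hg) ?ltzD1// add0r fourier_shift subrr fourierJ ?oppr0//.
  exact: L2_L1 hf.1.
Qed.

Lemma mul_nfac_supp G n (f g : R -> R[i]) : Hle 0 f -> Hle (n - 1) g ->
  let h t := pm (f t, g t) (nfac G n t) in
  [/\ Hle 0 (fun t => (h t).1), Hle n (fun t => (h t).2) &
      fourier (fun t => (h t).1) 0 = (nfac_scale (G n))%:C * fourier f 0].
Proof.
move=> hf hg h; set x := (nfac_scale (G n))%:C.
have h1 : Hle (- 1) (fun t => e_ (- n) t * g t).
  by have := Hle_shift (- n) hg; rewrite addrA addNr sub0r.
have h2 : Hle n (fun t => e_ n t * f t).
  by have := Hle_shift n hf; rewrite addr0.
have hg' : Hle n g by apply: HleW hg; rewrite gerBl.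
have h1' : Hle 0 (fun t => e_ (- n) t * g t) by exact: HleW h1.
have E1 : (fun t => (h t).1) = (fun t => x * (f t - cj (G n) * (e_ (- n) t * g t))).
  by apply/funext => t; rewrite /h /pm /= -/x cjM [cj x]cjR cjM -e_N -/x; ring.
have E2 : (fun t => (h t).2) = (fun t => x * (G n * (e_ n t * f t) + g t)).
  by apply/funext => t; rewrite /h /pm /= [cj _]cjR -/x; ring.
have H1 := SuppB hf (SuppZ (cj (G n)) h1'); have H2 := SuppD (SuppZ (G n) h2) hg'.
rewrite E1 E2; split; [exact: SuppZ|exact: SuppZ|].
rewrite fourierZ; last exact: L2_L1 H1.1.
rewrite fourierB; [|exact: L2_L1 hf.1|exact: L2_L1 (L2Z _ h1.1)].
rewrite fourierZ; last exact: L2_L1 h1.1.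
by rewrite (Hle_fourier0 h1)// mulr0 subr0.
Qed.

(** The leftmost factor is peeled off, which raises the lowest frequency of the rest to m + 1. *)
Lemma nlf_supp_ge G m len : Hle 0 (nlftA G m len) /\ Hge m (nlftB G m len).
Proof.
elim: len m => [|len IH] m.
  have -> : nlftA G m 0 = fun=> 1 by apply/funext => t; have [] := nlf0 G m t.
  have -> : nlftB G m 0 = fun=> 0 by apply/funext => t; have [] := nlf0 G m t.
  split; first exact: Hle_cst.
  by split=> [|n _]; [exact: L2_cst|rewrite fourier_cst if_same].
have [h1 h2] := IH (m + 1); have [H1 H2 _ _] := nfac_mul_supp G h1 h2.
have -> : nlftA G m len.+1 = fun t => (nlf G m len.+1 t).1 by [].
have -> : nlftB G m len.+1 = fun t => (nlf G m len.+1 t).2 by [].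
by under eq_fun do rewrite nlfSl; under [X in Hge _ X]eq_fun do rewrite nlfSl.
Qed.

(** Here the last factor is peeled off, so that the highest frequency is tracked. *)
Lemma nlf_supp_le G m len : Hle (m + len%:Z - 1) (nlftB G m len).
Proof.
suff: Hle 0 (nlftA G m len) /\ Hle (m + len%:Z - 1) (nlftB G m len) by case.
elim: len => [|len [h1 h2]].
  have -> : nlftA G m 0 = fun=> 1 by apply/funext => t; have [] := nlf0 G m t.
  have -> : nlftB G m 0 = fun=> 0 by apply/funext => t; have [] := nlf0 G m t.
  split; first exact: Hle_cst.
  by split=> [|n _]; [exact: L2_cst|rewrite fourier_cst if_same].
have [H1 H2 _] := mul_nfac_supp G h1 h2.
have -> : nlftA G m len.+1 = fun t => (nlf G m len.+1 t).1 by [].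
have -> : nlftB G m len.+1 = fun t => (nlf G m len.+1 t).2 by [].
have -> : (fun t => (nlf G m len.+1 t).1) =
    (fun t => (pm (nlf G m len t) (nfac G (m + len%:Z) t)).1).
  by apply/funext => t; rewrite nlfS.
have -> : (fun t => (nlf G m len.+1 t).2) =
    (fun t => (pm (nlf G m len t) (nfac G (m + len%:Z) t)).2).
  by apply/funext => t; rewrite nlfS.
by split => //; rewrite -addn1 PoszD addrA addrK.
Qed.

End NonlinearProducts.

(** * Mean-square convergence of pairs *)

Section PairConvergence.
Variable R : realType.
Implicit Types (X : nat -> R -> R[i] * R[i]) (Y U V : R -> R[i] * R[i]).

Definition pL2 Y := L2 (fun t => (Y t).1) /\ L2 (fun t => (Y t).2).
(** A squared distance without the logarithmic term of [rho]; multiplication by a unitary pair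
    preserves it. *)
Definition pdist U V : R :=
  msq (fun t => (U t).1 - (V t).1) + msq (fun t => (U t).2 - (V t).2).
Definition pcvg X Y := (fun k => pdist (X k) Y) @ \oo --> (0 : R).
Definition punit U := [/\ measC (fun t => (U t).1), measC (fun t => (U t).2) &
  aeT (fun t => pnorm (U t) = 1)].

Lemma pdist_ge0 U V : 0 <= pdist U V.
Proof. by rewrite addr_ge0 ?msq_ge0. Qed.

Lemma cvg0_le (u v : nat -> R) : (forall k, 0 <= u k <= v k) ->
  v @ \oo --> (0 : R) -> u @ \oo --> (0 : R).
Proof.
move=> h hv; apply: (@squeeze_cvgr _ _ _ _ (fun=> 0) v) => //; last exact: cvg_cst.
by apply: nearW.
Qed.

Lemma punit_L2 U : punit U -> pL2 U.
Proof.
move=> [m1 m2 h]; have L1' : L2 (fun=> 1 : R[i]) := L2_cst 1.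
have e f : (fun t : R => f t * 1) = f :> (R -> R[i]) by apply/funext => t; rewrite mulr1.
split.
- rewrite -[X in L2 X]e; apply: (@L2_bdd _ 1) => //.
  by apply: filterS h => t <-; rewrite lerDl cabs2_ge0.
- rewrite -[X in L2 X]e; apply: (@L2_bdd _ 1) => //.
  by apply: filterS h => t <-; rewrite lerDr cabs2_ge0.
Qed.

Lemma punitV U : punit U -> punit (fun t => pinv (U t)).
Proof.
move=> [m1 m2 h]; split; [exact: measCJ|exact: measCN|].
by apply: filterS h => t <-; rewrite pnormV.
Qed.

Lemma punit_nfac G n : punit (@nfac R G n).
Proof.
split; [exact: measC_cst| |by apply: aeT_on => t _; exact: pnorm_nfac].
apply: measCM; first exact: measC_cst.
by apply: measCM; [exact: measC_cst|exact: measC_expi].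
Qed.

Lemma punit_nlf G m len : punit (@nlf R G m len).
Proof.
have [h1 h2] := nlf_supp_ge G m len.
by split; [exact: L2_meas h1.1|exact: L2_meas h2.1|by apply: aeT_on => t _; exact: pnorm_nlf].
Qed.

Lemma pdist_le U V U' V' : pL2 U -> pL2 V -> pL2 U' -> pL2 V' ->
  aeT (fun t => pnorm ((U t).1 - (V t).1, (U t).2 - (V t).2) <=
                pnorm ((U' t).1 - (V' t).1, (U' t).2 - (V' t).2)) ->
  pdist U V <= pdist U' V'.
Proof.
move=> [U1 U2] [V1 V2] [U1' U2'] [V1' V2'] h.
have /L2P[m1 i1] := L2B U1 V1; have /L2P[m2 i2] := L2B U2 V2.
have /L2P[_ i1'] := L2B U1' V1'; have /L2P[_ i2'] := L2B U2' V2'.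
rewrite /pdist /msq -!mulrDr ler_wpM2l ?invr_ge0 ?(ltW (@pi2_gt0 R))//.
rewrite -!RintegralD//; try exact: mD.
apply: (rint_ae_le _ (rintD i1' i2') _ _ _).2.
- exact: rint_meas (rintD i1 i2).
- by move=> t; rewrite addr_ge0 ?cabs2_ge0.
- by move=> t; rewrite addr_ge0 ?cabs2_ge0.
- exact: h.
Qed.

Lemma pL2M U V : punit U -> pL2 V -> pL2 (fun t => pm (U t) (V t)).
Proof.
move=> [m1 m2 h] [V1 V2].
have b1 : aeT (fun t => cabs2 (U t).1 <= 1).
  by apply: filterS h => t <-; rewrite lerDl cabs2_ge0.
have b2 : aeT (fun t => cabs2 (U t).2 <= 1).
  by apply: filterS h => t <-; rewrite lerDr cabs2_ge0.
split; first by apply: L2B; [exact: L2_bdd b1 _|apply: L2_bdd b2 _ => //; exact: L2J].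
by apply: L2D; [exact: L2_bdd b1 _|apply: L2_bdd b2 _ => //; exact: L2J].
Qed.

Lemma pL2Mr U V : punit V -> pL2 U -> pL2 (fun t => pm (U t) (V t)).
Proof.
move=> [m1 m2 h] [U1 U2].
have b1 : aeT (fun t => cabs2 (V t).1 <= 1).
  by apply: filterS h => t <-; rewrite lerDl cabs2_ge0.
have b2 : aeT (fun t => cabs2 (V t).2 <= 1).
  by apply: filterS h => t <-; rewrite lerDr cabs2_ge0.
have b1' : aeT (fun t => cabs2 (cj (V t).1) <= 1) by apply: filterS b1 => t; rewrite cabs2J.
have b2' : aeT (fun t => cabs2 (cj (V t).2) <= 1) by apply: filterS b2 => t; rewrite cabs2J.
have c x y : x * y = y * x :> R[i] by rewrite mulrC.
split.
- under eq_fun do rewrite /pm /= c [(U _).2 * _]c.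
  by apply: L2B; [exact: L2_bdd b1 _|apply: L2_bdd b2' _ => //; exact: measCJ].
- under eq_fun do rewrite /pm /= c [(U _).2 * _]c.
  by apply: L2D; [exact: L2_bdd b2 _|apply: L2_bdd b1' _ => //; exact: measCJ].
Qed.

Lemma pcvgMl U X Y : punit U -> (forall k, pL2 (X k)) -> pL2 Y -> pcvg X Y ->
  pcvg (fun k t => pm (U t) (X k t)) (fun t => pm (U t) (Y t)).
Proof.
move=> hU hX hY; apply: cvg0_le => k; rewrite pdist_ge0; apply: pdist_le => //.
- exact: pL2M.
- exact: pL2M.
have [_ _ h] := hU; apply: filterS h => t h.
rewrite -[leRHS]mul1r -h -pnormM le_eqVlt; apply/orP; left; apply/eqP; congr pnorm.
by rewrite /pm /= !cjB; congr (_, _); ring.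
Qed.

Lemma pcvgMr U X Y : punit U -> (forall k, pL2 (X k)) -> pL2 Y -> pcvg X Y ->
  pcvg (fun k t => pm (X k t) (U t)) (fun t => pm (Y t) (U t)).
Proof.
move=> hU hX hY; apply: cvg0_le => k; rewrite pdist_ge0; apply: pdist_le => //.
- exact: pL2Mr.
- exact: pL2Mr.
have [_ _ h] := hU; apply: filterS h => t h.
rewrite -[leRHS]mulr1 -h -pnormM le_eqVlt; apply/orP; left; apply/eqP; congr pnorm.
by rewrite /pm /=; congr (_, _); ring.
Qed.

Lemma pcvg_supp S S' X Y : pL2 Y -> pcvg X Y ->
  (forall k, Supp S (fun t => (X k t).1)) -> (forall k, Supp S' (fun t => (X k t).2)) ->
  Supp S (fun t => (Y t).1) /\ Supp S' (fun t => (Y t).2).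
Proof.
move=> [Y1 Y2] h h1 h2; split.
- apply: Supp_cvg h1 Y1 _; apply: cvg0_le h => k.
  by rewrite msq_ge0 lerDl msq_ge0.
- apply: Supp_cvg h2 Y2 _; apply: cvg0_le h => k.
  by rewrite msq_ge0 lerDr msq_ge0.
Qed.

Lemma pdist_one U : punit U ->
  pdist U (fun=> (1, 0)) = 2 - 2 * complex.Re (fourier (fun t => (U t).1) 0).
Proof.
move=> hU; have [U1 U2] := punit_L2 hU; have [m1 m2 h] := hU.
rewrite fourier_inp.
have -> : pdist U (fun=> (1, 0)) = msq (fun t => (U t).1 - 1) + msq (fun t => (U t).2).
  by rewrite /pdist; congr (_ + msq _); apply/funext => t; rewrite /= subr0.
rewrite msqB//; last exact: L2_cst.
have e1 : (fun=> 1) = @e_ R 0 by apply/funext => t; rewrite e_0.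
rewrite e1 msq_e.
suff : msq (fun t => (U t).1) + msq (fun t => (U t).2) = 1 by lra.
have /L2P[_ i1] := U1; have /L2P[_ i2] := U2.
rewrite /msq -mulrDr -RintegralD//; try exact: mD.
rewrite -[RHS](@msq_e R 0) -e1.
rewrite /msq; congr (_ * _). apply: Rintegral_ae.
- exact: rint_meas (rintD i1 i2).
- exact: measurable_cabs2 (measC_cst 1).
- by apply: filterS h => t h1; rewrite /= cabs21; exact: h1.
Qed.

End PairConvergence.

(** * Comparison with the metric [rho] *)

Section RhoConvergence.
Variable R : realType.
Implicit Types (ak bk : nat -> R -> R[i]) (f ap bp : R -> R[i]).

Lemma l2normE f : l2norm f = Num.sqrt (2 * pi * msq f).
Proof. by rewrite /msq mulVKf ?gt_eqF// pi2_gt0. Qed.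

Lemma sqr_l2norm f : msq f = (2 * pi)^-1 * l2norm f ^+ 2.
Proof.
rewrite l2normE sqr_sqrtr ?mulKf ?gt_eqF ?pi2_gt0//.
by rewrite mulr_ge0 ?msq_ge0// ltW// pi2_gt0.
Qed.

Lemma cvg0_sqrt (u : nat -> R) : u @ \oo --> (0 : R) ->
  (fun k => Num.sqrt (u k)) @ \oo --> (0 : R).
Proof.
move=> h; rewrite -[X in _ --> X](@sqrtr0 R).
exact: (continuous_cvg _ (@sqrt_continuous R 0) h).
Qed.

Lemma cvg0_msq_l2norm (f : nat -> R -> R[i]) :
  (fun k => msq (f k)) @ \oo --> (0 : R) -> (fun k => l2norm (f k)) @ \oo --> (0 : R).
Proof.
move=> h; under eq_fun do rewrite l2normE; apply: cvg0_sqrt.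
by rewrite -(mulr0 (2 * pi)); apply: cvgM => //; exact: cvg_cst.
Qed.

Lemma cvg_at_infty ak ap : (forall k, L2 (ak k)) -> L2 ap -> cvgL2 ak ap ->
  (fun k => complex.Re (at_infty (ak k))) @ \oo --> complex.Re (at_infty ap).
Proof.
move=> hk hp /cvg0_sqrt h; apply/cvgrPdist_le => e e0.
move/cvgrPdist_le : h => /(_ _ e0); apply: filterS => k.
cbv beta; rewrite sub0r normrN ger0_norm ?sqrtr_ge0// => h; apply: le_trans h.
rewrite -sqrtr_sqr ler_wsqrtr// -Re_opp -Re_add msqBC.
apply: le_trans (sqr_Re_le _) _; rewrite /at_infty -fourierB; [|exact: L2_L1..].
by apply: fourier_le; exact: L2B.
Qed.

(** The logarithmic term follows from the others: the value at infinity is a Fourier coefficient,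
    continuous in L^2, and [ln] is continuous at its positive limit. *)
Lemma rho_of_pcvg ak bk ap bp :
  (forall k, L2 (ak k)) -> (forall k, L2 (bk k)) -> L2 ap -> L2 bp ->
  0 < complex.Re (at_infty ap) ->
  pcvg (fun k t => (ak k t, bk k t)) (fun t => (ap t, bp t)) -> rho_cvg ak bk ap bp.
Proof.
move=> hak hbk hap hbp pos h.
have h1 : cvgL2 ak ap.
  by apply: cvg0_le h => k; rewrite msq_ge0 lerDl msq_ge0.
have h2 : cvgL2 bk bp.
  by apply: cvg0_le h => k; rewrite msq_ge0 lerDr msq_ge0.
have h3 : (fun k => `|ln (complex.Re (at_infty (ak k))) - ln (complex.Re (at_infty ap))|) @ \oo --> (0 : R).
  have l : (fun k => ln (complex.Re (at_infty (ak k)))) @ \oo --> ln (complex.Re (at_infty ap)).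
    exact: (continuous_cvg _ (continuous_ln pos) (cvg_at_infty hak hap h1)).
  have z : (fun k => ln (complex.Re (at_infty (ak k))) - ln (complex.Re (at_infty ap))) @ \oo --> (0 : R).
    by rewrite -(subrr (ln (complex.Re (at_infty ap)))); apply: cvgB => //; exact: cvg_cst.
  by rewrite -[X in _ --> X](@normr0 _ R); exact: (cvg_norm z).
rewrite /rho_cvg /rho -[X in _ --> X](addr0 0).
apply: cvgD h3; rewrite -[X in _ --> X](addr0 0).
by apply: cvgD; exact: cvg0_msq_l2norm.
Qed.

Lemma pcvg_of_rho ak bk ap bp : rho_cvg ak bk ap bp ->
  pcvg (fun k t => (ak k t, bk k t)) (fun t => (ap t, bp t)).
Proof.
move=> h; have h2 : (fun k => (2 * pi)^-1 * (rho (ak k) (bk k) ap bp * rho (ak k) (bk k) ap bp)) @ \oo --> (0 : R).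
  rewrite -[X in _ --> X](mulr0 (2 * pi)^-1); apply: cvgM; first exact: cvg_cst.
  by rewrite -[X in _ --> X](mulr0 0); apply: cvgM.
apply: cvg0_le h2 => k; rewrite pdist_ge0 /=.
rewrite /pdist /= !sqr_l2norm -mulrDr ler_wpM2l ?invr_ge0 ?(ltW (@pi2_gt0 R))//.
rewrite /rho; set x := l2norm _; set y := l2norm _; set z := `| _ |.
have x0 : 0 <= x by rewrite sqrtr_ge0.
have y0 : 0 <= y by rewrite sqrtr_ge0.
have z0 : 0 <= z by rewrite normr_ge0.
have : 0 <= x * y + x * z + y * z by rewrite !addr_ge0// mulr_ge0.
rewrite !expr2; have := sqr_ge0 z; rewrite expr2; nra.
Qed.

End RhoConvergence.

(** * Layer stripping *)

Section LayerStripping.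
Variables (R : realType) (a b : R -> R[i]) (alpha c : R).
Hypotheses (ma : measC a) (mb : measC b).
Hypothesis hab : aeT (fun t => cabs2 (a t) + cabs2 (b t) = 1).
Hypothesis ha : Hle 0 a.
Hypotheses (ainf : fourier a 0 = alpha%:C) (alpha0 : 0 < alpha).
Hypotheses (hc : 2^-1 < c) (ca : aeT (fun t => c <= cabs2 (a t))).
Hypothesis hai : Hle 0 (fun t => (a t)^-1).
Implicit Types (X L : R -> R[i] * R[i]) (n : int) (F G : int -> R[i]).

Definition Facp n X L := Fac a b n (fun t => (X t).1) (fun t => (X t).2)
  (fun t => (L t).1) (fun t => (L t).2).

Definition ratio n X : R[i] := fourier (fun t => (X t).2) n / fourier (fun t => (X t).1) 0.

Lemma Facp_right n X L : Facp n X L -> punit X.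
Proof.
move=> F; split; [exact: L2_meas (fac_ra F).1|exact: L2_meas (fac_rb F).1|exact: fac_r1 F].
Qed.

Lemma Facp_left n X L : Facp n X L -> punit L.
Proof.
move=> F; split; [exact: L2_meas (fac_la F).1|exact: L2_meas (fac_lb F).1|exact: fac_l1 F].
Qed.

Lemma Facp_prod n X L : Facp n X L -> aeT (fun t => (a t, b t) = pm (L t) (X t)).
Proof. by move=> F; apply: filterS2 (fac_a F) (fac_b F) => t -> ->. Qed.

Lemma Facp_uniq n X L X' L' : Facp n X L -> Facp n X' L' ->
  aeT (fun t => X t = X' t) /\ aeT (fun t => L t = L' t).
Proof.
move=> F F'; have [h1 h2 h3 h4] := Fac_uniq ma mb hab ha ainf alpha0 hc ca hai F F'.
split; [apply: filterS2 h1 h2|apply: filterS2 h3 h4] => t.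
  by case: (X t) (X' t) => ? ? [? ?] /= -> ->.
by case: (L t) (L' t) => ? ? [? ?] /= -> ->.
Qed.

Lemma Facp_ratio_uniq n X L X' L' : Facp n X L -> Facp n X' L' -> ratio n X = ratio n X'.
Proof.
move=> F F'; have [h _] := Facp_uniq F F'.
have [m1 m2 _] := Facp_right F; have [m1' m2' _] := Facp_right F'.
congr (_ / _); apply: fourier_ae => //; by apply: filterS h => t ->.
Qed.

Lemma Facp_exists n : exists p : (R -> R[i] * R[i]) * (R -> R[i] * R[i]), Facp n p.1 p.2.
Proof.
have [ra [rb [la [lb h]]]] := Fac_exists ma mb hab ha ainf alpha0 hc ca n.
by exists (fun t => (ra t, rb t), fun t => (la t, lb t)).
Qed.

Lemma Facp_step n G X L : Facp n X L -> ratio n X = G n ->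
  Facp (n + 1) (fun t => pm (pinv (nfac G n t)) (X t)) (fun t => pm (L t) (nfac G n t)) /\
  fourier (fun t => (pm (pinv (nfac G n t)) (X t)).1) 0 =
    fourier (fun t => (X t).1) 0 * (Num.sqrt (1 + cabs2 (G n)))%:C.
Proof.
move=> F e; have [h1 h2] := Fac_step F (esym e) erefl; rewrite /Facp.
have <- : (fun t => (nfac_scale (G n))%:C * ((X t).1 + G n * e_ n t * cj (X t).2)) =
   (fun t => (pm (pinv (nfac G n t)) (X t)).1).
  by apply/funext => t; rewrite /pm /= cjR; ring.
have <- : (fun t => (nfac_scale (G n))%:C * ((X t).2 - G n * e_ n t * cj (X t).1)) =
   (fun t => (pm (pinv (nfac G n t)) (X t)).2).
  by apply/funext => t; rewrite /pm /= cjR; ring.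
have <- : (fun t => (nfac_scale (G n))%:C * ((L t).1 - (L t).2 * cj (G n * e_ n t))) =
   (fun t => (pm (L t) (nfac G n t)).1).
  by apply/funext => t; rewrite /pm /= [cj (_%:C * _)]cjM cjR; ring.
have <- : (fun t => (nfac_scale (G n))%:C * ((L t).1 * (G n * e_ n t) + (L t).2)) =
   (fun t => (pm (L t) (nfac G n t)).2).
  by apply/funext => t; rewrite /pm /= cjR; ring.
by [].
Qed.

Lemma ratio_nfac G n X : Hle 0 (fun t => (X t).1) -> Hge (n + 1) (fun t => (X t).2) ->
  0 < fourier (fun t => (X t).1) 0 -> ratio n (fun t => pm (nfac G n t) (X t)) = G n.
Proof.
move=> h1 h2 h0; have [x x0 ex] := posCP h0.
have XE : (fun t => pm (nfac G n t) (X t)) = (fun t => pm (nfac G n t) ((X t).1, (X t).2)).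
  by apply/funext => t; case: (X t).
have [_ _ e1 e2] := nfac_mul_supp G h1 h2.
rewrite XE /ratio e1 e2 ex cjR.
have xC : x%:C != 0 by rewrite -(rmorph0 (real_complex R)) (inj_eq (@complexI R)) gt_eqF.
have kC : (nfac_scale (G n))%:C != 0.
  by rewrite -(rmorph0 (real_complex R)) (inj_eq (@complexI R)) gt_eqF// nfac_scale_gt0.
by field; rewrite xC kC.
Qed.

Section Uniqueness.
Variables (G : int -> R[i]) (X0 L0 : R -> R[i] * R[i]).
Hypothesis F0 : Facp 0 X0 L0.
Hypothesis cX : pcvg (fun k => nlf G 0 k) X0.
Hypothesis cL : pcvg (fun k => nlf G (- k%:Z) k) L0.

(** Stripping the factor of index n from the limit leaves the limit of the products from n + 1 on,
    which inherits their spectrum; X is then [nfac] times a pair of frequencies > n, and its ratio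
    is G n. *)
Lemma limit_ratio n X L : Facp n X L -> pcvg (fun k => nlf G n k) X ->
  pcvg (fun k => nlf G (n + 1) k) (fun t => pm (pinv (nfac G n t)) (X t)) /\ ratio n X = G n.
Proof.
move=> F cv; have LX := punit_L2 (Facp_right F).
pose X' t := pm (pinv (nfac G n t)) (X t).
have uV := punitV (punit_nfac G n).
have LX' : pL2 X' by exact: pL2M.
have cv' : pcvg (fun k => nlf G (n + 1) k) X'.
  have h : pcvg (fun k t => pm (pinv (nfac G n t)) (nlf G n k.+1 t)) X'.
    apply: (pcvgMl uV _ LX); first by move=> k; exact: punit_L2 (punit_nlf _ _ _).
    by move: cv; rewrite /pcvg -cvg_shiftS.
  suff E : (fun k t => pm (pinv (nfac G n t)) (nlf G n k.+1 t)) = (fun k => nlf G (n + 1) k).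
    by rewrite E in h.
  apply/funext => k; apply/funext => t.
  by rewrite nlfSl pmA pmVl ?pm1l ?pnorm_nfac.
have [h1 h2] : Hle 0 (fun t => (X' t).1) /\ Hge (n + 1) (fun t => (X' t).2).
  apply: (pcvg_supp LX' cv') => k; first exact: (nlf_supp_ge G _ k).1.
  exact: (nlf_supp_ge G _ k).2.
have XE : X = (fun t => pm (nfac G n t) (X' t)).
  by apply/funext => t; rewrite /X' pmA pmVr ?pm1l// pnorm_nfac.
have X'0 : 0 < fourier (fun t => (X' t).1) 0.
  have := fac_ra0 F; have [_ _ + _] := nfac_mul_supp G h1 h2.
  have -> : (fun t => (pm (nfac G n t) ((X' t).1, (X' t).2)).1) = (fun t => (X t).1).
    by rewrite XE; apply/funext => t; case: (X' t).
  by move=> ->; rewrite pmulr_rgt0//; exact: posC (nfac_scale_gt0 _).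
by split => //; rewrite XE ratio_nfac.
Qed.

Lemma forward_factors (n : nat) :
  exists X L, Facp n X L /\ pcvg (fun k => nlf G n k) X.
Proof.
elim: n => [|n [X [L [F cv]]]]; first by exists X0, L0.
have [cv' rG] := limit_ratio F cv; have [F' _] := Facp_step F rG.
have E : n.+1%:Z = n%:Z + 1 by rewrite -addn1 PoszD.
by rewrite E; do 2 eexists; split; [exact: F'|exact: cv'].
Qed.

(** Below 0 a factor is moved from the left limit to the right one. That the remaining left limit
    has the required spectrum follows from the finite products that converge to it. *)
Lemma backward_factors (n : nat) :
  exists X L, [/\ Facp (- n%:Z) X L, pcvg (fun k => nlf G (- (k + n)%:Z) k) L &
    (0 < n)%N -> ratio (- n%:Z) X = G (- n%:Z)].
Proof.
elim: n => [|n [X [L [F cv _]]]].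
  by exists X0, L0; split => //; under [X in pcvg X]eq_fun do rewrite addn0.
pose m : int := - n%:Z - 1.
have mE : m = - n.+1%:Z by rewrite /m -addn1 PoszD opprD.
have m1 : m + 1 = - n%:Z by rewrite /m subrK.
pose X' t := pm (nfac G m t) (X t).
pose L' t := pm (L t) (pinv (nfac G m t)).
have LL := punit_L2 (Facp_left F).
have uV := punitV (punit_nfac G m).
have LL' : pL2 L' by exact: pL2Mr.
have cv' : pcvg (fun k => nlf G (- (k + n.+1)%:Z) k) L'.
  (* The product of length k + 1 starting at -(k + 1 + n) ends with index -n - 1 = m, the factor
     that the inverse cancels. *)
  have h : pcvg (fun k t => pm (nlf G (- (k.+1 + n)%:Z) k.+1 t) (pinv (nfac G m t))) L'.
    apply: (pcvgMr uV _ LL); first by move=> k; exact: punit_L2 (punit_nlf _ _ _).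
    by move: cv; rewrite /pcvg -cvg_shiftS.
  suff E : (fun k t => pm (nlf G (- (k.+1 + n)%:Z) k.+1 t) (pinv (nfac G m t))) =
      (fun k => nlf G (- (k + n.+1)%:Z) k) by rewrite E in h.
  apply/funext => k; apply/funext => t; rewrite nlfS addSnnS.
  have -> : - (k + n.+1)%:Z + k%:Z = m by rewrite mE PoszD opprD addrAC addNr add0r.
  by rewrite -pmA pmVr ?pm1r// pnorm_nfac.
have [h1 h2] : Hle 0 (fun t => (L' t).1) /\ Hle (m - 1) (fun t => (L' t).2).
  apply: (pcvg_supp LL' cv') => k; first exact: (nlf_supp_ge G _ k).1.
  have := nlf_supp_le G (- (k + n.+1)%:Z) k.
  by rewrite (_ : - (k + n.+1)%:Z + k%:Z = m)// mE PoszD opprD addrAC addNr add0r.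
have hX2 : Hge (m + 1) (fun t => (X t).2) by rewrite m1; exact: fac_rb F.
have [r1 r2 r3 _] := nfac_mul_supp G (fac_ra F) hX2.
have [l1 l2 l3] := mul_nfac_supp G h1 h2.
have LE t : pm ((L' t).1, (L' t).2) (nfac G m t) = L t.
  by rewrite -surjective_pairing /L' -pmA pmVl ?pm1r// pnorm_nfac.
have XE t : pm (nfac G m t) ((X t).1, (X t).2) = X' t by rewrite -surjective_pairing.
have k0 := posC (nfac_scale_gt0 (G m)).
exists X', L'; rewrite -mE; split=> //; last by move=> _; exact: (ratio_nfac G (fac_ra F) hX2 (fac_ra0 F)).
split => //.
- have -> : (fun t => (X' t).1) = (fun t => (pm (nfac G m t) ((X t).1, (X t).2)).1).
    by apply/funext => t; rewrite XE.
  by rewrite r3 mulr_gt0//; exact: fac_ra0 F.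
- move: l3; have -> : (fun t => (pm ((L' t).1, (L' t).2) (nfac G m t)).1) = (fun t => (L t).1).
    by apply/funext => t; rewrite LE.
  by move=> e; have := fac_la0 F; rewrite e pmulr_rgt0.
- apply: filterS (fac_r1 F) => t h.
  by have := pnormM (nfac G m t) (X t); rewrite pnorm_nfac mul1r {2}/pnorm h.
- apply: filterS (fac_l1 F) => t h.
  by have := pnormM (L t) (pinv (nfac G m t)); rewrite pnormV pnorm_nfac mulr1 {2}/pnorm h.
- apply: filterS (Facp_prod F) => t.
  have <- : pm (L' t) (X' t) = pm (L t) (X t).
    by rewrite /L' /X' -pmA [pm (pinv _) _]pmA pmVl ?pm1l// pnorm_nfac.
  by case.
- apply: filterS (Facp_prod F) => t.
  have <- : pm (L' t) (X' t) = pm (L t) (X t).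
    by rewrite /L' /X' -pmA [pm (pinv _) _]pmA pmVl ?pm1l// pnorm_nfac.
  by case.
Qed.

Lemma factor_ratio n : exists X L, Facp n X L /\ ratio n X = G n.
Proof.
case: n => n.
  by have [X [L [F cv]]] := forward_factors n; exists X, L; split => //; case: (limit_ratio F cv).
by have [X [L [F _ h]]] := backward_factors n.+1; exists X, L; rewrite NegzE; split => //; exact: h.
Qed.

End Uniqueness.

Section Existence.
Variables (XX LL : int -> R -> R[i] * R[i]) (F : int -> R[i]).
Hypothesis FF : forall n, Facp n (XX n) (LL n).
Hypothesis ratioF : forall n, ratio n (XX n) = F n.

(** The factorizations at different n are chosen independently; since stepping from n also gives one
    at n + 1, uniqueness ties them together. *)
Lemma factor_rel n :
  [/\ aeT (fun t => XX n t = pm (nfac F n t) (XX (n + 1) t)),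
      aeT (fun t => LL (n + 1) t = pm (LL n t) (nfac F n t)) &
      fourier (fun t => (XX (n + 1) t).1) 0 =
        fourier (fun t => (XX n t).1) 0 * (Num.sqrt (1 + cabs2 (F n)))%:C].
Proof.
have [F' e] := Facp_step (FF n) (ratioF n).
have [h1 h2] := Facp_uniq (FF (n + 1)) F'; split.
- apply: filterS h1 => t ->; by rewrite pmA pmVr ?pm1l// pnorm_nfac.
- by [].
- rewrite -e; apply: fourier_ae; last by apply: filterS h1 => t ->.
    exact: L2_meas (fac_ra (FF (n + 1))).1.
  exact: L2_meas (fac_ra F').1.
Qed.

Lemma nlf_right (n : nat) : aeT (fun t => XX 0 t = pm (nlf F 0 n t) (XX n t)).
Proof.
elim: n => [|n IH]; first by apply: aeT_on => t _; rewrite nlf0 pm1l.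
have [h _ _] := factor_rel n; apply: filterS2 IH h => t -> ->.
by rewrite nlfS pmA add0r -addn1 PoszD.
Qed.

Lemma nlf_left (n : nat) : aeT (fun t => LL 0 t = pm (LL (- n%:Z) t) (nlf F (- n%:Z) n t)).
Proof.
elim: n => [|n IH]; first by apply: aeT_on => t _; rewrite nlf0 pm1r.
have [_ h _] := factor_rel (- n.+1%:Z).
have E : - n.+1%:Z + 1 = - n%:Z by rewrite -addn1 PoszD opprD subrK.
by rewrite E in h; apply: filterS2 IH h => t -> ->; rewrite nlfSl pmA E.
Qed.

Let x n : R := complex.Re (fourier (fun t => (XX n t).1) 0).

Let xE n : fourier (fun t => (XX n t).1) 0 = (x n)%:C.
Proof. by have [y _ e] := posCP (fac_ra0 (FF n)); rewrite /x e. Qed.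

(** The means of the two factors multiply to alpha, and each is at most 1. *)
Let x_bounds n : alpha <= x n <= 1 /\ complex.Re (fourier (fun t => (LL n t).1) 0) = alpha / x n.
Proof.
have [y [y0 ey el _]] := Sol_of_Fac ma mb hab ha ainf alpha0 hc ca hai (FF n).
have := Fac_la0_le1 (FF n); have := Fac_ra0_le1 (FF n); rewrite /x ey el /= => -> h.
by rewrite andbT; move: h; rewrite ler_pdivrMr// mul1r.
Qed.

Let x_step n : x (n + 1) ^+ 2 = x n ^+ 2 * (1 + cabs2 (F n)).
Proof.
have [_ _] := factor_rel n; rewrite !xE -rmorphM => /complexI ->.
by rewrite exprMn sqr_sqrtr// addr_ge0 ?cabs2_ge0.
Qed.

(** alpha^2 |F n|^2 <= x(n)^2 |F n|^2 = x(n + 1)^2 - x(n)^2, and these differences telescope to at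
    most 1. *)
Lemma factors_l2Z : l2Z F.
Proof.
exists ((alpha ^+ 2)^-1) => N.
have a2 : 0 < alpha ^+ 2 by rewrite exprn_gt0.
have step n : alpha ^+ 2 * cabs2 (F n) <= x (n + 1) ^+ 2 - x n ^+ 2.
  rewrite x_step (_ : _ - _ = x n ^+ 2 * cabs2 (F n)); last by ring.
  rewrite ler_wpM2r ?cabs2_ge0//.
  have [/andP[h _] _] := x_bounds n.
  by rewrite lerXn2r ?nnegrE// ltW// (lt_le_trans alpha0).
suff h : alpha ^+ 2 * \sum_(k < N) (cabs2 (F k%:Z) + cabs2 (F (- k%:Z - 1))) <=
    x N ^+ 2 - x (- N%:Z) ^+ 2.
  rewrite -[X in _ <= X]mul1r ler_pdivlMr// mulrC; apply: le_trans h _.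
  have [/andP[h0 h1] _] := x_bounds N.
  have := sqr_ge0 (x (- N%:Z)).
  have : x N ^+ 2 <= 1 by rewrite expr_le1// ltW// (lt_le_trans alpha0).
  by lra.
elim: N => [|N IH]; first by rewrite big_ord0 mulr0 oppr0 subrr.
rewrite big_ord_recr /= mulrDr mulrDr.
have := step N; have := step (- N%:Z - 1).
have E : N%:Z + 1 = N.+1%:Z by rewrite -addn1 PoszD.
have E' : - N%:Z - 1 = - N.+1%:Z by rewrite -E opprD.
rewrite subrK E E'; move: IH; lra.
Qed.

(** The partial product is [XX 0] times the inverse of [XX k]; by invariance its distance from
    [XX 0] is that of this inverse from (1, 0). *)
Let pdist_right (k : nat) : pdist (nlf F 0 k) (XX 0) <= 2 - 2 * x k.
Proof.
have uk := punitV (Facp_right (FF k)); have u0 := Facp_right (FF 0).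
have -> : x k = complex.Re (fourier (fun t => (pinv (XX k t)).1) 0).
  have := fourierJ 0 (L2_L1 (fac_ra (FF k)).1); rewrite oppr0 xE cjR.
  by move=> ->.
rewrite -(pdist_one uk); apply: pdist_le.
- exact: punit_L2 (punit_nlf _ _ _).
- exact: punit_L2 u0.
- exact: punit_L2 uk.
- by split; exact: L2_cst.
have [_ _ n0] := u0; have [_ _ nk] := Facp_right (FF k).
apply: filterS2 (aeTI n0 nk) (nlf_right k) => t [h0 hk] e.
have -> : nlf F 0 k t = pm (XX 0 t) (pinv (XX k t)) by rewrite -(pm_rcancel hk e).
by rewrite pnorm_mul_dist//= subr0.
Qed.

Let pdist_left (k : nat) : pdist (nlf F (- k%:Z) k) (LL 0) <= 2 - 2 * (alpha / x (- k%:Z)).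
Proof.
have uk := punitV (Facp_left (FF (- k%:Z))); have u0 := Facp_left (FF 0).
have -> : alpha / x (- k%:Z) = complex.Re (fourier (fun t => (pinv (LL (- k%:Z) t)).1) 0).
  have := fourierJ 0 (L2_L1 (fac_la (FF (- k%:Z))).1); rewrite oppr0 => ->.
  by rewrite Re_conj; have [_ ->] := x_bounds (- k%:Z).
rewrite -(pdist_one uk); apply: pdist_le.
- exact: punit_L2 (punit_nlf _ _ _).
- exact: punit_L2 u0.
- exact: punit_L2 uk.
- by split; exact: L2_cst.
have [_ _ n0] := u0; have [_ _ nk] := Facp_left (FF (- k%:Z)).
apply: filterS2 (aeTI n0 nk) (nlf_left k) => t [h0 hk] e.
have -> : nlf F (- k%:Z) k t = pm (pinv (LL (- k%:Z) t)) (LL 0 t) by rewrite -(pm_lcancel hk e).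
by rewrite pnorm_dist_mul//= subr0.
Qed.

Lemma nlf_cvg_right : pcvg (fun k => nlf F 0 k) (XX 0).
Proof.
apply/cvgrPdist_le => e e0; have e2 : 0 < e / 2 by rewrite divr_gt0.
have [M hM] := Fac_lim_plus ma mb hab ha ainf alpha0 hc ca hai e2.
exists M => // k Mk; cbv beta; rewrite sub0r normrN ger0_norm ?pdist_ge0//.
apply: le_trans (pdist_right k) _.
have := hM k _ _ _ _ _ (FF k); rewrite lez_nat => /(_ Mk); rewrite -/(x k); lra.
Qed.

Lemma nlf_cvg_left : pcvg (fun k => nlf F (- k%:Z) k) (LL 0).
Proof.
(* y <= alpha (1 + e / 2) gives alpha / y >= 1 - e / 2, because (1 - e / 2)(1 + e / 2) <= 1. *)
apply/cvgrPdist_le => e e0; have e2 : 0 < alpha * (e / 2) by rewrite mulr_gt0// divr_gt0.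
have [M hM] := Fac_lim_minus ma mb hab ha ainf alpha0 hc ca hai e2.
exists M => // k Mk; cbv beta; rewrite sub0r normrN ger0_norm ?pdist_ge0//.
apply: le_trans (pdist_left k) _.
have := hM (- k%:Z) _ _ _ _ _ (FF (- k%:Z)); rewrite lerN2 lez_nat => /(_ Mk).
rewrite -/(x (- k%:Z)); have [/andP[h1 h2] _] := x_bounds (- k%:Z).
set y := x _ in h1 h2 *; move=> h3.
have y0 : 0 < y := lt_le_trans alpha0 h1.
have : 1 - e / 2 <= alpha / y.
  rewrite ler_pdivlMr//.
  have [e1|e1] := leP (1 - e / 2) 0.
    by apply: le_trans (ltW alpha0); rewrite mulr_le0_ge0// ltW.
  have : (1 - e / 2) * y <= (1 - e / 2) * (alpha + alpha * (e / 2)) by rewrite ler_wpM2l// ltW.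
  move=> h; apply: le_trans h _.
  have -> : (1 - e / 2) * (alpha + alpha * (e / 2)) = alpha * (1 - (e / 2) ^+ 2) by ring.
  by rewrite ler_piMr ?(ltW alpha0)// gerBl sqr_ge0.
lra.
Qed.

End Existence.
End LayerStripping.

(** * Factorizations at 0 and the two Hardy-type spaces of pairs *)

Section HardyPairs.
Variables (R : realType) (a b : R -> R[i]) (alpha c : R).
Hypotheses (ma : measC a) (mb : measC b).
Hypothesis hab : aeT (fun t => cabs2 (a t) + cabs2 (b t) = 1).
Hypothesis ha : Hle 0 a.
Hypotheses (ainf : fourier a 0 = alpha%:C) (alpha0 : 0 < alpha).
Hypotheses (hc : 2^-1 < c) (ca : aeT (fun t => c <= cabs2 (a t))).
Hypothesis hai : Hle 0 (fun t => (a t)^-1).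
Implicit Types (ap bp am bm : R -> R[i]).

Lemma Fac_inH ap bp am bm : Fac a b 0 ap bp am bm -> inH ap bp.
Proof.
move=> F; split; first split.
- split; [exact: L2_meas (fac_ra F).1|exact: L2_meas (fac_rb F).1|exact: fac_r1 F| |exact: fac_ra0 F].
  by apply/H2Dstar_Hle; exact: fac_ra F.
- by apply/H2D_Hge; exact: fac_rb F.
- by move=> g hg h1 h2; exact: (Fac_right_inner ma ha ainf alpha0 hc ca hai F hg h1 h2).
Qed.

Lemma Fac_inH0star ap bp am bm : Fac a b 0 ap bp am bm -> inH0star am bm.
Proof.
move=> F; have hb1 := HleJ (fac_lb F); rewrite sub0r opprK in hb1.
have LM : inL am bm.
  split; [exact: L2_meas (fac_la F).1|exact: L2_meas (fac_lb F).1|exact: fac_l1 F| |exact: fac_la0 F].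
  by apply/H2Dstar_Hle; exact: fac_la F.
split=> //; split; last by exact: (Hge_fourier0 hb1 ltr01).
have [l1 l2 l3 l4 l5] := LM.
split; first split.
- by split=> //; [exact: measCJ|apply: filterS l3 => t <-; rewrite cabs2J].
- by apply/H2D_Hge; apply: HgeW hb1.
- by move=> g hg h1 h2; exact: (Fac_left_inner ma hc ca hai F hg h1 h2).
Qed.

(** The vanishing mean of cj(bm) raises its lowest frequency from 0 to 1, which is the condition on
    bm in a factorization at n = 0. *)
Lemma inH_Fac ap bp am bm : inH ap bp -> inH0star am bm ->
  aeT (fun t => pmulA am bm ap bp t = a t) -> aeT (fun t => pmulB am bm ap bp t = b t) ->
  Fac a b 0 ap bp am bm.
Proof.
move=> [[[p1 p2 p3 /H2Dstar_Hle p4 p5] /H2D_Hge p6] _].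
move=> [[m1 m2 m3 /H2Dstar_Hle m4 m5] [[[_ m6] _] m7]] ea eb.
split=> //; [|by apply: filterS ea|by apply: filterS eb].
have m6' : Hge 0 (fun t => cj (bm t)) by apply/H2D_Hge.
have m6'' : Hge 1 (fun t => cj (bm t)).
  split; first exact: m6'.1.
  move=> n; rewrite -ltNge -[1]add0r ltzD1 le_eqVlt => /orP[/eqP ->//|n0].
  exact: Hge_fourier0 m6' n0.
have := HgeJ m6''; rewrite sub0r; by under eq_fun do rewrite cjK.
Qed.

End HardyPairs.

Lemma inB_bounded_below (R : realType) (a b : R -> R[i]) : inB a b -> exists alpha c : R,
  [/\ Hle 0 a, fourier a 0 = alpha%:C, 0 < alpha, 2^-1 < c &
      aeT (fun t => c <= cabs2 (a t)) /\ Hle 0 (fun t => (a t)^-1)].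
Proof.
move=> [[_ _ _ /H2Dstar_Hle ha a0] [c [c2 cinf cext]]].
have [alpha alpha0 ea] := posCP a0; exists alpha, c; split=> //.
by apply: reciprocal => //; apply: lt_trans c2; rewrite invr_gt0.
Qed.

Theorem theorem7p2 (R : realType) (a b : R -> R[i]) :
  inB a b ->
  (exists ap bp am bm : R -> R[i],
     [/\ inH ap bp, inH0star am bm,
         aeT (fun t => pmulA am bm ap bp t = a t),
         aeT (fun t => pmulB am bm ap bp t = b t) &
         forall ap' bp' am' bm' : R -> R[i],
           inH ap' bp' -> inH0star am' bm' ->
           aeT (fun t => pmulA am' bm' ap' bp' t = a t) ->
           aeT (fun t => pmulB am' bm' ap' bp' t = b t) ->
           [/\ aeT (fun t => ap' t = ap t), aeT (fun t => bp' t = bp t),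
               aeT (fun t => am' t = am t) & aeT (fun t => bm' t = bm t)]])
  /\
  (exists F : int -> R[i],
     [/\ l2Z F, is_nlfs F a b &
         forall G : int -> R[i], l2Z G -> is_nlfs G a b -> G = F]).
Proof.
move=> hB; have [[ma mb hab _ _] _] := hB.
have [alpha [c [ha ainf alpha0 hc [ca hai]]]] := inB_bounded_below hB.
split.
  have [ap [bp [am [bm F]]]] := Fac_exists ma mb hab ha ainf alpha0 hc ca 0.
  exists ap, bp, am, bm; split.
  - exact: (Fac_inH ma ha ainf alpha0 hc ca hai F).
  - exact: (Fac_inH0star ma hc ca hai F).
  - by apply: filterS (fac_a F) => t ->.
  - by apply: filterS (fac_b F) => t ->.
  - move=> ap' bp' am' bm' h1 h2 h3 h4.
    exact: (Fac_uniq ma mb hab ha ainf alpha0 hc ca hai (inH_Fac h1 h2 h3 h4) F).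
have /choice[D FD] := Facp_exists ma mb hab ha ainf alpha0 hc ca.
pose F n := ratio n (D n).1.
have rF n : ratio n (D n).1 = F n by [].
have L2nlf m k := punit_L2 (@punit_nlf R F m k).
exists F; split.
- exact: (factors_l2Z ma mb hab ha ainf alpha0 hc ca hai FD rF).
- have F0 := FD 0.
  have LR : inL (fun t => ((D 0).1 t).1) (fun t => ((D 0).1 t).2).
    by have [[]] := Fac_inH ma ha ainf alpha0 hc ca hai F0.
  have LL : inL (fun t => ((D 0).2 t).1) (fun t => ((D 0).2 t).2).
    by have [] := Fac_inH0star ma hc ca hai F0.
  have [r1 r2] := punit_L2 (Facp_right F0); have [l1 l2] := punit_L2 (Facp_left F0).
  exists (fun t => ((D 0).1 t).1), (fun t => ((D 0).1 t).2),
    (fun t => ((D 0).2 t).1), (fun t => ((D 0).2 t).2); split=> //.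
  + have [x x0 ex] := posCP (fac_ra0 F0).
    apply: rho_of_pcvg => //; [by move=> k; case: (L2nlf 0 k.+1)|by move=> k; case: (L2nlf 0 k.+1)|
      by rewrite /at_infty ex|].
    (* The series of F on [0, k] has k + 1 factors, hence the shift of the index. *)
    have := nlf_cvg_right ma mb hab ha ainf alpha0 hc ca hai FD rF.
    by rewrite /pcvg -cvg_shiftS.
  + have [x x0 ex] := posCP (fac_la0 F0).
    apply: rho_of_pcvg => //; [by move=> k; case: (L2nlf (- k%:Z) k)|
      by move=> k; case: (L2nlf (- k%:Z) k)|by rewrite /at_infty ex|].
    exact: (nlf_cvg_left ma mb hab ha ainf alpha0 hc ca hai FD rF).
  + exact: fac_a F0.
  + exact: fac_b F0.
- move=> G _ [ap [bp [am [bm [[hp hm] cp cm ea eb]]]]].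
  have [p1 p2 p3 /H2Dstar_Hle p4 p5] := hp; have [m1 m2 m3 /H2Dstar_Hle m4 m5] := hm.
  have up : punit (fun t => (ap t, bp t)) by [].
  have um : punit (fun t => (am t, bm t)) by [].
  have cX : pcvg (fun k => nlf G 0 k) (fun t => (ap t, bp t)).
    by have := pcvg_of_rho cp; rewrite /pcvg -[X in _ -> X]cvg_shiftS.
  have cL : pcvg (fun k => nlf G (- k%:Z) k) (fun t => (am t, bm t)) := pcvg_of_rho cm.
  (* [is_nlfs] provides limits in L only; the frequency conditions on bp and bm are inherited from
     the finite products. *)
  have [_ sb] : Hle 0 ap /\ Hge 0 bp.
    by apply: (pcvg_supp (punit_L2 up) cX) => k; case: (nlf_supp_ge G 0 k).
  have [_ sm] : Hle 0 am /\ Hle (0 - 1) bm.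
    apply: (pcvg_supp (punit_L2 um) cL) => k; first by case: (nlf_supp_ge G (- k%:Z) k).
    by have := nlf_supp_le G (- k%:Z) k; rewrite addNr.
  have F0 : Facp a b 0 (fun t => (ap t, bp t)) (fun t => (am t, bm t)) by split.
  apply/funext => n; have [X [L [FX <-]]] := factor_ratio F0 cX cL n.
  exact: (Facp_ratio_uniq ma mb hab ha ainf alpha0 hc ca hai FX (FD n)).
Qed.
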